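(* Let $\Omega=(-1,1)$, let $\mu\in(k-1,k]$ with $k\in\mathbb N$, $k\ge1$, let $m\ge0$ be an integer, and assume that $u$ is of AC-BV$_{\mu,m}$-regularity on $[-1,1]$, with $v_\mu:={}^{C}\!D_{-1+}^{\mu}u$ and $$U_-^{(\mu,m)}:=V_{[-1,1]}[v_\mu^{(m)}]+|\sin(\mu\pi)|\sum_{l=0}^m\big|v_\mu^{(l)}(-1+)\big|.$$ (i) If $\mu>1/2$ then for every integer $N\ge\mu+m$, $$\|u-\pi_N^Lu\|_{L^\infty(\Omega)}\le\bigg\{\frac{1}{2^{\mu+m-1}(\mu+m-1/2)\sqrt\pi}\,\frac{\Gamma((N-\mu-m+1)/2)}{\Gamma((N+\mu+m)/2)}+\sum_{j=0}^m\frac{2^{\mu+j}\,\Gamma(\mu+j+1)}{\pi(\mu+j)}\,\frac{\Gamma(N-\mu-j+1)}{\Gamma(N+\mu+j+1)}\bigg\}\,U_-^{(\mu,m)}.$$ (ii) If $\mu>-1/2$ then for every integer $N>\mu+m$, $$\|u-\pi_N^Lu\|_{L^2(\Omega)}\le\bigg\{\frac{4}{(2\mu+2m+1)\pi}\,\frac{\Gamma(N-\mu-m)}{\Gamma(N+\mu+m+1)}+\frac{2^{6\mu+8}\,\Gamma^2(\mu+1)}{\pi^2(4\mu+2)}\,\frac{(N+1)^2\,\Gamma(2N-2\mu+1)}{(2N+1)^2\,\Gamma(2N+2\mu+3)}\bigg\}^{1/2}U_-^{(\mu,m)}.$$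
   Context: $P_n$ is the Legendre polynomial of degree $n$, $\hat u_n^L=\frac{2n+1}{2}\int_{-1}^1u(x)P_n(x)\,\mathrm dx$, and $\pi_N^Lu=\sum_{n=0}^N\hat u_n^LP_n$ is the $L^2(-1,1)$-orthogonal projection onto polynomials of degree at most $N$. $\mathrm{AC}$ and $\mathrm{BV}$ denote absolutely continuous functions and functions of bounded variation on $[-1,1]$; $V_{[-1,1]}[h]$ is the total variation of $h$; $h(-1+)$ is the right limit at $-1$. Fractional integral: for $\rho>0$ and $f\in L^1(-1,1)$, $(I_{-1+}^\rho f)(x)=\frac1{\Gamma(\rho)}\int_{-1}^x\frac{f(y)}{(x-y)^{1-\rho}}\,\mathrm dy$; $I_{-1+}^0$ is the identity. Caputo derivative: for $\mu\in(k-1,k]$, ${}^{C}\!D_{-1+}^{\mu}u=I_{-1+}^{k-\mu}u^{(k)}$. AC-BV$_{\mu,m}$-regularity of $u$ (with $\mu\in(k-1,k]$) means: $u,\dots,u^{(k-1)}\in\mathrm{AC}([-1,1])$; $v_\mu:={}^{C}\!D_{-1+}^{\mu}u\in\mathrm{BV}([-1,1])$; and moreover $v_\mu,\dots,v_\mu^{(m-1)}\in\mathrm{AC}([-1,1])$ and $v_\mu^{(m)}\in\mathrm{BV}([-1,1])$. (Functions defined only a.e. are identified with their AC or BV representative.) *)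

(* Defs.v *)
From HB Require Import structures.
From mathcomp Require Import all_boot all_order all_algebra.
From mathcomp Require Import all_classical all_reals all_analysis.
Set Implicit Arguments.
Unset Strict Implicit.
Unset Printing Implicit Defensive.
Import Order.TTheory GRing.Theory Num.Theory.
Import numFieldNormedType.Exports.
Local Open Scope classical_set_scope.
Local Open Scope ring_scope.

Section Definitions.
Context {R : realType}.
Local Notation leb := (@lebesgue_measure R).

(* Euler's integral; the value is meaningful only for z > 0. *)
Definition Gamma (z : R) : R :=
  \int[leb]_(t in `]0, +oo[) (t `^ (z - 1) * expR (- t)).

(* Rodrigues' formula. *)
Definition legendre (n : nat) : {poly R} :=
  (2 ^+ n * n`!%:R)^-1 *: derivn n (('X ^+ 2 - 1) ^+ n).

Definition legendre_coef (u : R -> R) (n : nat) : R :=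
  (2 * n%:R + 1) / 2 * \int[leb]_(x in `]-1, 1[) (u x * (legendre n).[x]).

Definition legendre_proj (N : nat) (u : R -> R) (x : R) : R :=
  \sum_(n < N.+1) legendre_coef u n * (legendre n).[x].

(* The norm of L^p(-1,1): the restriction [f \_ D] extends f by 0 outside D. *)
Definition Lnorm_Omega (p : \bar R) (f : R -> R) : \bar R :=
  Lnorm leb p (EFin \o (f \_ `]-1, 1[)).

Definition absolutely_continuous (a b : R) (f : R -> R) : Prop :=
  forall e : R, 0 < e -> exists2 d : R, 0 < d &
    forall (n : nat) (lo hi : 'I_n -> R),
      (forall i, a <= lo i /\ lo i <= hi i /\ hi i <= b) ->
      trivIset setT (fun i => `]lo i, hi i[%classic) ->
      \sum_(i < n) (hi i - lo i) < d ->
      \sum_(i < n) `|f (hi i) - f (lo i)| < e.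

Definition ae_eq_Omega (f g : R -> R) : Prop :=
  {ae leb, forall x : R, x \in `]-1, 1[ -> f x = g x}.

Definition ae_derivative (f g : R -> R) : Prop :=
  {ae leb, forall x : R, x \in `]-1, 1[ -> is_derive x 1 f (g x)}.

(* f i is a representative of the i-th derivative of f 0, for all i <= n. *)
Definition derivative_chain (n : nat) (f : nat -> R -> R) : Prop :=
  forall i, (i < n)%N -> ae_derivative (f i) (f i.+1).

(* Left-sided fractional integral of order rho >= 0 based at -1. *)
Definition frac_int (rho : R) (f : R -> R) (x : R) : R :=
  if rho == 0 then f x
  else (Gamma rho)^-1 *
       \int[leb]_(y in `]-1, x[) (f y / (x - y) `^ (1 - rho)).

(* Caputo derivative of order mu in ]k-1, k] of a function whose k-th
   derivative is uk. *)
Definition caputo (mu : R) (k : nat) (uk : R -> R) : R -> R :=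
  frac_int (k%:R - mu) uk.

(* AC-BV_{mu,m}-regularity of u, where v l is a representative of the l-th
   derivative of the Caputo derivative v_mu of u, the AC one when l < m and a
   BV one when l = m.  The derivatives of u and v_mu are only defined almost
   everywhere a priori, hence the families of representatives ud and v. *)
Definition AC_BV_regular (mu : R) (k m : nat) (u : R -> R)
    (v : nat -> R -> R) : Prop :=
  exists ud : nat -> R -> R,
    [/\ ud 0%N = u,
        derivative_chain k ud &
        forall i, (i < k)%N -> absolutely_continuous (-1) 1 (ud i)] /\
    [/\ ae_eq_Omega (v 0%N) (caputo mu k (ud k)),
        bounded_variation (-1) 1 (v 0%N),
        derivative_chain m v,
        forall l, (l < m)%N -> absolutely_continuous (-1) 1 (v l) &
        bounded_variation (-1) 1 (v m)].

(* U_-^{(mu,m)}; the limit is the right limit of v l at -1. *)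
Definition U_minus (mu : R) (m : nat) (v : nat -> R -> R) : \bar R :=
  (total_variation (-1) 1 (v m) +
   (`|sin (mu * pi)| *
    \sum_(l < m.+1) `|lim (v l x @[x --> (-1 : R)^'+])|)%R%:E)%E.

End Definitions.

(* Main.v *)
(* Let [I^s] be the fractional integral based at [1] and [v = v_mu].  For
   [n > mu + m], [k] integrations by parts, the semigroup law
   [I^k P_n = I^(k - mu) I^mu P_n] with Fubini's theorem, and [m] further
   integrations by parts write the [n]-th Legendre coefficient of [u] as the
   integral of [v^(m)] against [I^(mu + m) P_n], plus terms at [-1] in
   [v^(l)(-1+)] and [I^(mu + l + 1) P_n (-1)].  The first is at most the
   variation of [v^(m)] times the supremum of [I^(mu + m + 1) P_n], which a
   Sonin function reduces to explicit quotients of Gamma values at [0]; the value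
   of [I^s P_n] at [-1] is an explicit Gamma product in which the reflection
   formula produces the factor [sin (mu pi)].  Summed over [n > N] these bounds
   telescope.  The coefficients being absolutely summable in (i), and square
   summable in (ii), the remainder is the tail of the Legendre series, because
   by Bernstein's theorem polynomials determine a continuous function. *)
From HB Require Import structures.
Require Import Defs.
From mathcomp Require Import all_boot all_order all_algebra.
From mathcomp Require Import all_classical all_reals all_analysis measurable_realfun.
From mathcomp Require Import ring lra.
Set Implicit Arguments.
Unset Strict Implicit.
Unset Printing Implicit Defensive.
Import Order.TTheory GRing.Theory Num.Theory.
Import numFieldNormedType.Exports.
Local Open Scope classical_set_scope.
Local Open Scope ring_scope.

(** * Preliminaries on integration *)

(** The derivatives of [u] and [v_mu] are prescribed only off null sets. The fundamental theorem for
    an absolutely continuous function is therefore proved from difference quotients on uniform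
    partitions, and it delivers an integrable modification of the given derivative. On the
    polynomial side, fractional integrals based at [1] are finite sums of truncated powers of
    [1 - x], so the differential equation, the contiguity in the degree and the values at [0] and
    [-1] all reduce to identities between coefficients. Asymptotics enter only as one-sided
    inequalities: log-convexity and Wendel's inequality for Gamma, and moments of powers of cosine
    to bring in [pi]. In (i) the bounds on the coefficients telescope over steps of two in the
    degree; in (ii), once squared, over steps of one. In (i) the variation and the one-sided limits
    are estimated separately against [U]. In (ii) the endpoint terms of all [l <= m] are first
    dominated by the one with [l = 0], which is why the second summand there depends on [mu] alone
    and carries no sum over [j]. *)

Section LebesgueAffine.
Context {R : realType}.
Local Notation leb := (@lebesgue_measure R).

Lemma measurable_affine (a b : R) :
  measurable_fun setT ((fun x => a * x + b) : measurableTypeR R -> measurableTypeR R).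
Proof.
apply: continuous_measurable_fun => x; apply: cvgD; last exact: cvg_cst.
by apply: cvgM; [exact: cvg_cst|].
Qed.

(** [|a|] times the image of Lebesgue measure under the affine map is a measure with the right value
    on every []x, y]], and these values determine Lebesgue measure. For [a < 0] the preimage of []x,
    y]] is closed on the left instead of the right, with the same length. *)
Lemma lebesgue_measure_affine (a b : R) (A : set R) : a != 0 -> measurable A ->
  (`|a|%:E * leb ((fun x => a * x + b)%R @^-1` A) = leb A)%E.
Proof.
move=> a0 mA.
have an : 0 < `|a| by rewrite normr_gt0.
pose k := NngNum (ltW an).
pose m : {measure set _ -> \bar R} := mscale k
  (measure_function_pushforward__canonical__measure_function_Measure leb
    (measurable_affine a b)).
transitivity (m A); first by [].
apply/esym/lebesgue_measure_unique => //.
move=> _ [[x y]] /= _ <-.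
change (leb `]x, y] = `|a|%:E * leb ((fun x0 => a * x0 + b)%R @^-1` `]x, y]%classic))%E.
have [ap|an0|] := ltgtP 0 a; last by move=> /esym/eqP; rewrite (negbTE a0).
- have -> : ((fun x0 => a * x0 + b) @^-1` `]x, y] = `](x - b) / a, (y - b) / a])%classic.
    apply/seteqP; split => z /=; rewrite !in_itv /= ltr_pdivrMr// ler_pdivlMr// ltrBlDr lerBrDr mulrC//.
  rewrite !lebesgue_measure_itv /= !lte_fin ltr_pM2r ?invr_gt0// ltrD2r.
  case: ifPn => xy; last by rewrite mule0.
  rewrite -!EFinB -EFinM gtr0_norm//; congr (_%:E); field; exact: a0.
- have -> : ((fun x0 => a * x0 + b) @^-1` `]x, y] = `[(y - b) / a, (x - b) / a[)%classic.
    apply/seteqP; split => z /=; rewrite !in_itv /= ltr_ndivlMr// ler_ndivrMr// lerBrDr ltrBlDr mulrC andbC//.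
  rewrite !lebesgue_measure_itv /= !lte_fin ltr_nM2r ?invr_lt0// ltrD2r.
  case: ifPn => xy; last by rewrite mule0.
  rewrite -!EFinB -EFinM ltr0_norm//; congr (_%:E); field; exact: a0.
Qed.

(** A change of variables without integrability: the Beta integrals are translated and rescaled
    before they are known to be finite. *)
Lemma ge0_integral_affine (a b : R) (f : R -> \bar R) : a != 0 ->
  measurable_fun setT f -> (forall x, 0 <= f x)%E ->
  (`|a|%:E * \int[leb]_x f (a * x + b)%R = \int[leb]_x f x)%E.
Proof.
move=> a0 mf f0.
have an : 0 < `|a| by rewrite normr_gt0.
pose k := NngNum (ltW an).
pose m : {measure set _ -> \bar R} := mscale k
  (measure_function_pushforward__canonical__measure_function_Measure leb
    (measurable_affine a b)).
transitivity (\int[m]_x f x)%E; last first.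
  apply: eq_measure_integral => A mA _.
  by first [exact: (lebesgue_measure_affine b a0 mA) | exact: esym (lebesgue_measure_affine b a0 mA)].
rewrite ge0_integral_mscale//; congr (_ * _)%E.
rewrite (@ge0_integral_pushforward _ _ _ _ _ _ (measurable_affine a b) leb setT f)//.
Qed.

End LebesgueAffine.

(** * Integrals and null sets *)

Section AeIntegral.
Context d (T : measurableType d) (R : realType) (mu : {measure set T -> \bar R}).
Import HBNNSimple.

Let ge0_le_integral_off_null (D N : set T) (f g : T -> \bar R) :
  measurable D -> measurable N -> mu N = 0%E ->
  (forall x, 0 <= f x)%E -> (forall x, 0 <= g x)%E ->
  (forall x, D x -> ~ N x -> f x = g x) ->
  (\int[mu]_(x in D) f x <= \int[mu]_(x in D) g x)%E.
Proof.
move=> mD mN N0 f0 g0 fg.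
rewrite integral_mkcond [leRHS]integral_mkcond.
rewrite ge0_integralTE; last by move=> x; exact: erestrict_ge0.
rewrite [leRHS]ge0_integralTE; last by move=> x; exact: erestrict_ge0.
apply: ereal_sup_le => /= _ [h hf <-].
have mCN : measurable (~` N) by exact: measurableC.
exists (proj_nnsfun h mCN) => /= [x|].
  rewrite mindicE; case: (boolP (x \in ~` N)) => [/set_mem Nx|_]; last by rewrite mulr0; exact: erestrict_ge0.
  rewrite mulr1 (le_trans (hf x))// !patchE; case: ifPn => // /set_mem Dx.
  by rewrite fg.
rewrite -!integralT_nnsfun [RHS](ge0_negligible_integral mN)//; last 2 first.
- exact/measurable_EFinP.
- by move=> x _; rewrite lee_fin.
rewrite setTD [RHS]integral_mkcond; apply: eq_integral => x _.
by rewrite /= patchE /= mindicE; case: ifPn; rewrite /= ?mulr1 ?mulr0.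
Qed.

(* No measurability of [f] or [g] is required: the integral of a nonnegative
   function is a supremum over the simple functions below it, and these can be
   cut off on a null set. *)
Lemma eq_integral_ae (D : set T) (f g : T -> \bar R) : measurable D ->
  {ae mu, forall x, D x -> f x = g x} ->
  (\int[mu]_(x in D) f x = \int[mu]_(x in D) g x)%E.
Proof.
move=> mD [N [mN N0 fgN]].
have fg x : D x -> ~ N x -> f x = g x.
  by move=> Dx Nx; apply: contrapT => fgx; apply: Nx; apply: fgN => /= /(_ Dx).
rewrite integralE [RHS]integralE; congr (_ - _)%E; apply/eqP; rewrite eq_le;
  apply/andP; split; apply: (@ge0_le_integral_off_null D N) => // x Dx Nx;
  by rewrite !(funeposE, funenegE) fg.
Qed.

Lemma eq_Rintegral_ae (D : set T) (f g : T -> R) : measurable D ->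
  {ae mu, forall x, D x -> f x = g x} ->
  \int[mu]_(x in D) f x = \int[mu]_(x in D) g x.
Proof.
move=> mD fg; congr fine; apply: eq_integral_ae => //.
by apply: filterS fg => x + Dx => ->.
Qed.

Lemma integrableZ1 (D : set T) (f : T -> R) c : measurable D ->
  mu.-integrable D (EFin \o f) -> mu.-integrable D (EFin \o (fun t => c * f t)).
Proof. by move=> mD h; exact: (integrableZl mD c h). Qed.

Lemma integrableD1 (D : set T) (f g : T -> R) : measurable D ->
  mu.-integrable D (EFin \o f) -> mu.-integrable D (EFin \o g) ->
  mu.-integrable D (EFin \o (fun t => f t + g t)).
Proof. by move=> mD hf hg; exact: (integrableD mD hf hg). Qed.

Lemma integrableB1 (D : set T) (f g : T -> R) : measurable D ->
  mu.-integrable D (EFin \o f) -> mu.-integrable D (EFin \o g) ->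
  mu.-integrable D (EFin \o (fun t => f t - g t)).
Proof. by move=> mD hf hg; exact: (integrableB mD hf hg). Qed.

Lemma integrable_sum1 (D : set T) n (F : 'I_n -> T -> R) : measurable D ->
  (forall i, mu.-integrable D (EFin \o F i)) ->
  mu.-integrable D (EFin \o (fun t => \sum_(i < n) F i t)) /\
  \int[mu]_(t in D) (\sum_(i < n) F i t) = \sum_(i < n) \int[mu]_(t in D) F i t.
Proof.
move=> mD; elim: n F => [|n IH] F iF.
  have -> : (fun t => \sum_(i < 0) F i t) = (fun=> 0) by apply/funext => t; rewrite big_ord0.
  rewrite big_ord0; split; first exact: integrable0.
  by rewrite /Rintegral integral0.
have -> : (fun t => \sum_(i < n.+1) F i t) = (fun t => \sum_(i < n) F (widen_ord (leqnSn n) i) t + F ord_max t).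
  by apply/funext => t; rewrite big_ord_recr.
have [i1 e1] := IH (fun i => F (widen_ord (leqnSn n) i)) (fun i => iF _).
split; first exact: integrableD1.
by rewrite RintegralD// e1 big_ord_recr.
Qed.

End AeIntegral.

(** * Derivatives on the real line *)

Section PointwiseDerivatives.
Context {R : realType}.
Implicit Types (f g : R -> R) (x a b : R).

(** This and the next rules are phrased on explicit [fun t], so that they apply to concrete
    expressions by unification. *)
Lemma deriveD1 f g x a b : is_derive x 1 f a -> is_derive x 1 g b ->
  is_derive x 1 (fun t => f t + g t) (a + b).
Proof. exact: is_deriveD. Qed.

Lemma deriveB1 f g x a b : is_derive x 1 f a -> is_derive x 1 g b ->
  is_derive x 1 (fun t => f t - g t) (a - b).
Proof. exact: is_deriveB. Qed.

Lemma deriveN1 f x a : is_derive x 1 f a -> is_derive x 1 (fun t => - f t) (- a).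
Proof. exact: is_deriveN. Qed.

Lemma deriveM1 f g x a b : is_derive x 1 f a -> is_derive x 1 g b ->
  is_derive x 1 (fun t => f t * g t) (a * g x + f x * b).
Proof.
move=> df dg; rewrite addrC [a * _]mulrC; exact: is_deriveM.
Qed.

Lemma deriveZ1 f x a b : is_derive x 1 f a -> is_derive x 1 (fun t => b * f t) (b * a).
Proof. exact: is_deriveZ. Qed.

Lemma deriveX1 f n x a : is_derive x 1 f a ->
  is_derive x 1 (fun t => f t ^+ n) (n%:R * f x ^+ n.-1 * a).
Proof.
move=> df; elim: n => [|n IH].
  by rewrite mul0r mul0r; have -> : (fun t => f t ^+ 0) = (fun=> 1) by []; exact: is_derive_cst.
have -> : (fun t => f t ^+ n.+1) = (fun t => f t * f t ^+ n) by apply/funext => t; rewrite exprS.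
apply: is_derive_eq (deriveM1 df IH) _.
case: n {IH} => [|n] /=; first by rewrite !expr0; ring.
by rewrite -[n.+2%:R]natr1 exprS; ring.
Qed.

Lemma deriveC1 x a : is_derive x 1 (fun=> a) 0.
Proof. exact: is_derive_cst. Qed.

Lemma derive_comp1 f g x a b : is_derive (g x) 1 f a -> is_derive x 1 g b ->
  is_derive x 1 (fun t => f (g t)) (a * b).
Proof. exact: is_derive1_comp. Qed.

Lemma derive_sum1 n (h : 'I_n -> R -> R) x (dh : 'I_n -> R) :
  (forall i, is_derive x 1 (h i) (dh i)) ->
  is_derive x 1 (fun t => \sum_(i < n) h i t) (\sum_(i < n) dh i).
Proof.
move=> hd; have -> : (fun t => \sum_(i < n) h i t) = \sum_(i < n) h i.
  by apply/funext => t; rewrite fct_sumE.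
exact: is_derive_sum.
Qed.

Lemma derive_expRN x : is_derive x 1 (fun t : R => expR (- t)) (- expR (- x)).
Proof.
rewrite -[- _]mulrN1.
by apply: derive_comp1; apply: deriveN1.
Qed.

Lemma is_derive1_near_eq f g x a : (\forall y \near x, f y = g y) ->
  is_derive x 1 f a -> is_derive x 1 g a.
Proof.
move=> fg [df <-]; split; last exact/esym/near_eq_derive.
exact: near_eq_derivable df.
Qed.

Lemma is_derive1_continuous f x a : is_derive x 1 f a -> {for x, continuous f}.
Proof. by move=> [df _]; apply: differentiable_continuous; exact/derivable1_diffP. Qed.

Lemma derive_ge0_le f (df : R -> R) a b : a <= b -> {within `[a, b], continuous f} ->
  (forall x, x \in `]a, b[ -> is_derive x 1 f (df x)) ->
  (forall x, x \in `]a, b[ -> 0 <= df x) -> f a <= f b.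
Proof.
rewrite le_eqVlt => /predU1P[-> //|ab] cf d d0.
have [c cab e] := MVT ab d cf.
by rewrite -subr_ge0 e mulr_ge0 ?d0// subr_ge0 ltW.
Qed.

Lemma is_derive_within (A : set R) f (df : R -> R) : (forall x, is_derive x 1 f (df x)) ->
  {within A, continuous f}.
Proof.
move=> d; apply: continuous_subspaceT => x; exact: is_derive1_continuous (d x).
Qed.

Lemma Rintegral_FTC f F a b : a < b ->
  {within `[a, b], continuous f} -> {within `[a, b], continuous F} ->
  (forall x, x \in `]a, b[ -> is_derive x 1 F (f x)) ->
  \int[lebesgue_measure]_(x in `[a, b]) f x = F b - F a.
Proof.
move=> ab cf cF dF; rewrite /Rintegral.
rewrite (@continuous_FTC2 _ f F a b)//.
- have [ci rF lF] := (continuous_within_itvP F ab).1 cF.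
  by split => // x xab; case: (dF x xab).
- by move=> x xab; rewrite derive1E; case: (dF x xab).
Qed.

End PointwiseDerivatives.

(** * The Gamma function *)

Section GammaBasics.
Context {R : realType}.
Local Notation leb := (@lebesgue_measure R).
Implicit Types x y z t h : R.

Lemma powR_addr t x y : 0 < t -> t `^ (x + y) = t `^ x * t `^ y.
Proof. by move=> t0; rewrite powRD// (gt_eqF t0) implybT. Qed.

Definition gammaf z t : R := t `^ (z - 1) * expR (- t).

Lemma gammaf_ge0 z t : 0 <= gammaf z t.
Proof. by rewrite mulr_ge0 ?powR_ge0 ?expR_ge0. Qed.

Lemma measurable_expRN (D : set R) : measurable_fun D (fun t : R => expR (- t)).
Proof. by apply: measurable_funTS; apply: measurableT_comp => //; exact: measurable_expR. Qed.

Lemma measurable_gammaf z (D : set R) : measurable_fun D (gammaf z).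
Proof.
apply: measurable_funTS; apply: measurable_funM.
  have h := @measurable_powR R (z - 1).
  exact h.
exact: measurable_expRN.
Qed.

(** With extended real values the functional equation can be proved before finiteness is known, and
    finiteness is then deduced from it. *)
Definition eGamma z : \bar R := (\int[leb]_(t in `]0%R, +oo[) (gammaf z t)%:E)%E.

Lemma eGamma_ge0 z : (0 <= eGamma z)%E.
Proof. by apply: integral_ge0 => t _; rewrite lee_fin gammaf_ge0. Qed.

Lemma derive_gammaf z x : 0 < x ->
  is_derive x 1 (gammaf (z + 1)) (z * gammaf z x - gammaf (z + 1) x).
Proof.
move=> x0; have := deriveM1 (is_derive1_powR z x0) (derive_expRN x).
rewrite /gammaf addrK mulrA => h; apply: is_derive_eq h _.
by rewrite mulrN.
Qed.

Lemma gammaf_itv_continuous z (a b : R) : 0 < a -> {within `[a, b], continuous (gammaf z)}.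
Proof.
move=> a0; apply: derivable_within_continuous => x; rewrite in_itv /= => /andP[ax _].
have x0 := lt_le_trans a0 ax.
by have := derive_gammaf (z - 1) x0; rewrite subrK => -[].
Qed.

(** [gammaf (z + 1)] has derivative [z * gammaf z - gammaf (z + 1)], and the fundamental theorem of
    calculus applies on a compact interval that avoids [0]. *)
Lemma gammaf_parts z (a b : R) : 0 < a -> a < b ->
  (z%:E * \int[leb]_(t in `[a, b]) (gammaf z t)%:E =
   \int[leb]_(t in `[a, b]) (gammaf (z + 1) t)%:E + (gammaf (z + 1) b - gammaf (z + 1) a)%:E)%E.
Proof.
move=> a0 ab.
have ci w : leb.-integrable `[a, b] (EFin \o gammaf w).
  apply: continuous_compact_integrable; first exact: segment_compact.
  exact: gammaf_itv_continuous.
have fin w : (\int[leb]_(t in `[a, b]) (gammaf w t)%:E \is a fin_num)%E.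
  exact: (integrable_fin_num _ (ci w)).
have := @Rintegral_FTC R (fun x => z * gammaf z x - gammaf (z + 1) x) (gammaf (z + 1)) a b ab.
have cz : {within `[a, b], continuous (fun x => z * gammaf z x)}.
  by move=> x; apply: cvgM; [exact: cvg_cst|exact: gammaf_itv_continuous].
have c1 : {within `[a, b], continuous (gammaf (z + 1))} by exact: gammaf_itv_continuous.
have c2 : {within `[a, b], continuous fun x => z * gammaf z x - gammaf (z + 1) x}.
  by move=> x; apply: cvgB; [exact: cz|exact: c1].
have dG x : x \in `]a, b[ -> is_derive x 1 (gammaf (z + 1)) (z * gammaf z x - gammaf (z + 1) x).
  by rewrite in_itv /= => /andP[ax _]; apply: derive_gammaf; exact: lt_trans ax.
move=> /(_ c2 c1 dG) <-.
have iz : leb.-integrable `[a, b] (EFin \o (fun x => z * gammaf z x)).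
  apply: continuous_compact_integrable; first exact: segment_compact.
  exact: cz.
rewrite RintegralB// RintegralZl// EFinB EFinM fineK// fineK//.
by rewrite addeC -addeA [(- _ + _)%E]addeC subee// adde0.
Qed.

Lemma gammaf_decay z : exists2 K : R, 0 <= K & forall t, 1 <= t -> gammaf (z + 1) t <= K / t.
Proof.
have [k zk] : exists k : nat, z <= k%:R.
  by exists (Num.truncn `|z|).+1; rewrite (le_trans (ler_norm _))// ltW// Num.Theory.truncnS_gt.
(* With [k >= z], the exponential series gives [t ^ (k + 1) <= (k + 1)! e^t]; the power beyond
   [t ^ k] pays for the denominator [t]. *)
exists k.+1`!%:R => // t t1; have t0 : 0 < t by rewrite (lt_le_trans _ t1).
rewrite /gammaf addrK expRN ler_pdivlMr// mulrAC ler_pdivrMr ?expR_gt0//.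
rewrite (@le_trans _ _ (t ^+ k.+1))//.
  rewrite exprSr ler_pM2r// -powR_mulrn ?(ltW t0)//; exact: (ler_powR t1).
have := expR_ge1Dxn k (ltW t0); rewrite -lerBrDl => /le_trans h.
rewrite -ler_pdivrMl ?ltr0n ?fact_gt0// mulrC h// lerBlDl ler_wpDl//.
Qed.

Lemma gammaf_cvgn z : gammaf (z + 1) n.+2%:R @[n --> \oo] --> (0 : R).
Proof.
have [K K0 hK] := gammaf_decay z.
apply: (@squeeze_cvgr _ _ _ _ (cst 0) (fun n : nat => K * n.+1%:R^-1)).
- near=> n; rewrite gammaf_ge0/= (le_trans (hK _ _))// ?ler1n//.
  by rewrite ler_wpM2l// lef_pV2 ?posrE// ler_nat.
- exact: cvg_cst.
- rewrite -[X in _ --> X](mulr0 K); apply: cvgM; first exact: cvg_cst.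
  exact: cvg_harmonic.
Unshelve. all: by end_near. Qed.

Lemma gammaf_cvg0 z : 0 < z -> gammaf (z + 1) n.+2%:R^-1 @[n --> \oo] --> (0 : R).
Proof.
move=> z0.
apply: (@squeeze_cvgr _ _ _ _ (cst 0) (fun n : nat => n.+2%:R^-1 `^ z)).
- near=> n; rewrite gammaf_ge0/= /gammaf addrK ler_piMr ?powR_ge0// -[leRHS]expR0 ler_expR oppr_le0 invr_ge0.
- exact: cvg_cst.
- have [h _] := cvg_at_rightP (fun a : R => a `^ z) 0 0.
  apply: (h (powR_cvg0 z0) (fun n => n.+2%:R^-1)); split.
    by move=> n; rewrite invr_gt0.
  by have := @cvg_harmonic R; rewrite -(cvg_shiftS (@harmonic R)).
Unshelve. all: by end_near. Qed.

(** The shift by two keeps the endpoints strictly ordered already for [n = 0]. *)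
Let itvn (n : nat) : set R := `[n.+2%:R^-1, n.+2%:R]%classic.

Let itvn_bigcup : \bigcup_n itvn n = `]0, +oo[%classic.
Proof.
apply/seteqP; split => x /=.
  move=> [n _]; rewrite /itvn /= !in_itv /= andbT => /andP[+ _].
  by apply: lt_le_trans; rewrite invr_gt0.
rewrite in_itv /= andbT => x0; exists (Num.truncn (x + x^-1)) => //.
have x10 : 0 < x^-1 by rewrite invr_gt0.
have h : x + x^-1 <= (Num.truncn (x + x^-1)).+2%:R.
  by rewrite ltW// (lt_le_trans (Num.Theory.truncnS_gt _))// ler_nat.
rewrite /itvn /= in_itv /=; apply/andP; split; last by rewrite (le_trans _ h)// lerDl ltW.
by rewrite invf_ple ?posrE// (le_trans _ h)// lerDr ltW.
Qed.

Let eGamma_cvg z : (\int[leb]_(t in itvn n) (gammaf z t)%:E)%E @[n --> \oo] --> eGamma z.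
Proof.
rewrite /eGamma -itvn_bigcup; apply: ge0_nondecreasing_set_cvg_integral.
- move=> n m nm; apply/subsetPset => x /=; rewrite /itvn /= !in_itv /= => /andP[a b].
  apply/andP; split; first by apply: le_trans a; rewrite lef_pV2 ?posrE// ler_nat.
  by apply: le_trans b _; rewrite ler_nat.
- by move=> n; exact: measurable_itv.
- by move=> n; apply/measurable_EFinP; exact: measurable_gammaf.
- by move=> n x _; rewrite lee_fin gammaf_ge0.
Qed.

Lemma eGammaS z : 0 < z -> (z%:E * eGamma z = eGamma (z + 1))%E.
Proof.
move=> z0.
have h1 : (z%:E * \int[leb]_(t in itvn n) (gammaf z t)%:E)%E @[n --> \oo] --> (z%:E * eGamma z)%E.
  by apply: cvgeZl => //; exact: eGamma_cvg.
have h2 : (\int[leb]_(t in itvn n) (gammaf (z + 1) t)%:E +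
    (gammaf (z + 1) n.+2%:R - gammaf (z + 1) n.+2%:R^-1)%:E)%E @[n --> \oo] -->
    (eGamma (z + 1) + 0%:E)%E.
  apply: cvgeD; [by rewrite fin_num_adde_defl|exact: eGamma_cvg|].
  apply/fine_cvgP; split; first by near=> n.
  rewrite -[X in _ --> X](subr0 (0 : R)).
  by apply: cvgB; [exact: gammaf_cvgn|exact: gammaf_cvg0].
rewrite -[RHS]adde0; apply: cvg_unique h1 _ => //.
apply: cvg_trans h2; apply: near_eq_cvg; near=> n.
rewrite /itvn gammaf_parts ?invr_gt0//.
by rewrite (@lt_trans _ _ 1)// ?invf_lt1 ?ltr1n.
Unshelve. all: by end_near. Qed.

Lemma eGamma1 : eGamma 1 = 1%E.
Proof.
rewrite /eGamma (_ : (\int[leb]_(t in _) _)%E = \int[leb]_(t in `[0%R, +oo[) (expR (- t))%:E)%E; last first.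
  rewrite -integral_itv_obnd_cbnd//; last first.
    by apply/measurable_EFinP; exact: measurable_expRN.
  by apply: eq_integral => t _; rewrite /gammaf subrr powRr0 mul1r.
rewrite (@ge0_continuous_FTC2y _ _ (fun t => - expR (- t)) 0 0).
- by rewrite oppr0 expR0 sub0e EFinN oppeK.
- by move=> x _; exact: expR_ge0.
- apply: derivable_within_continuous => x _; exact: (@ex_derive _ _ _ _ _ _ _ (derive_expRN x)).
- rewrite -oppr0; apply: cvgN; exact: cvgr_expR.
- by move=> x _; case: (deriveN1 (derive_expRN x)).
- by apply: cvg_at_right_filter; apply: (is_derive1_continuous (deriveN1 (derive_expRN 0))).
- by move=> x _; rewrite derive1E; case: (deriveN1 (derive_expRN x)) => _ ->; rewrite opprK.
Qed.

Lemma eGamma_nat n : (eGamma n.+1%:R < +oo)%E.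
Proof.
elim: n => [|n IH]; first by rewrite eGamma1 ltry.
by rewrite -natr1 -eGammaS// lte_mul_pinfty// ltW.
Qed.

(** For arguments at least [1] the integrand is dominated by that of [1] where [t <= 1] and by that
    of a larger integer where [t > 1]. Smaller arguments are raised by one with the functional
    equation. *)
Lemma eGamma_lty z : 0 < z -> (eGamma z < +oo)%E.
Proof.
have ge1 y : 1 <= y -> (eGamma y < +oo)%E.
  move=> y1; pose k := Num.truncn y.
  have yk : y <= k.+1%:R by rewrite ltW// Num.Theory.truncnS_gt.
  apply: (@le_lt_trans _ _ (eGamma 1 + eGamma k.+1%:R)%E); last first.
    by apply: lte_add_pinfty; [rewrite eGamma1 ltry|exact: eGamma_nat].
  rewrite /eGamma -ge0_integralD//; last 4 first.
  - by move=> t _; rewrite lee_fin gammaf_ge0.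
  - by apply/measurable_EFinP; exact: measurable_gammaf.
  - by move=> t _; rewrite lee_fin gammaf_ge0.
  - by apply/measurable_EFinP; exact: measurable_gammaf.
  apply: ge0_le_integral => //.
  - by move=> t _; rewrite lee_fin gammaf_ge0.
  - by apply/measurable_EFinP; exact: measurable_gammaf.
  - by apply: emeasurable_funD; apply/measurable_EFinP; exact: measurable_gammaf.
  move=> t /=; rewrite in_itv /= andbT => t0; rewrite lee_fin /gammaf -mulrDl.
  rewrite ler_wpM2r ?expR_ge0// subrr powRr0.
  have [t1|t1] := leP t 1.
    rewrite (@le_trans _ _ 1)// ?lerDl ?powR_ge0// -[leRHS](powRr0 t).
    by apply: ger_powR; rewrite ?t0// subr_ge0.
  by rewrite ler_wpDl//; apply: ler_powR; [exact: ltW|rewrite lerB].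
move=> z0; have : (z%:E * eGamma z < +oo)%E by rewrite eGammaS// ge1// lerDr ltW.
have := eGamma_ge0 z; case: (eGamma z) => [r|//|//] _; first by move=> _; exact: ltry.
by rewrite gt0_muley.
Qed.

End GammaBasics.

(* A sealed copy of [Gamma]: conversion must never unfold the integral. *)
HB.lock Definition gamma {R : realType} (z : R) : R := Gamma z.

Section GammaFunction.
Context {R : realType}.
Local Notation leb := (@lebesgue_measure R).
Implicit Types x y z t h : R.

Lemma gammaIE z : gamma z = \int[leb]_(t in `]0, +oo[) gammaf z t.
Proof. by rewrite gamma.unlock. Qed.

Lemma gammaE z : 0 < z -> (gamma z)%:E = eGamma z.
Proof. by move=> z0; rewrite gammaIE /Rintegral fineK// ge0_fin_numE ?eGamma_lty ?eGamma_ge0. Qed.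

Lemma gammaf_integrable z : 0 < z -> leb.-integrable `]0, +oo[ (EFin \o gammaf z).
Proof.
move=> z0; apply/integrableP; split.
  by apply/measurable_EFinP; exact: measurable_gammaf.
rewrite (le_lt_trans _ (eGamma_lty z0))// le_eqVlt; apply/orP; left; apply/eqP.
by apply: eq_integral => t _; rewrite /= ger0_norm ?gammaf_ge0.
Qed.

Lemma gammaS z : 0 < z -> gamma (z + 1) = z * gamma z.
Proof.
move=> z0; apply: EFin_inj; rewrite EFinM !gammaE// ?eGammaS//.
by rewrite addr_gt0.
Qed.

Lemma gamma1 : gamma 1 = 1 :> R.
Proof. by apply: EFin_inj; rewrite gammaE// eGamma1. Qed.

Lemma gamma_gt0 z : 0 < z -> 0 < gamma z.
Proof.
move=> z0; rewrite lt0r -lee_fin gammaE// eGamma_ge0 andbT; apply/eqP => G0.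
have : (\int[leb]_(t in `]0%R, +oo[) `|(gammaf z t)%:E| = 0)%E.
  transitivity (eGamma z); last by rewrite -(gammaE z0) G0.
  apply: eq_integral => t _.
  by rewrite /= ger0_norm ?gammaf_ge0.
move/ae_eq_integral_abs => /(_ (measurable_itv _)) h.
have [|N [mN N0 hN]] := h; first by apply/measurable_EFinP; exact: measurable_gammaf.
have sub : `]0, 1[%classic `<=` N.
  move=> t /=; rewrite in_itv /= => /andP[t0 _]; apply: hN => /=.
  rewrite in_itv /= andbT => /(_ t0) [] /eqP.
  by rewrite mulf_eq0 powR_eq0 gt_eqF//= gt_eqF// expR_gt0.
have : (leb `]0%R, 1%R[ <= 0)%E.
  apply: (@le_trans _ _ (leb N)); last by rewrite le_eqVlt; apply/orP; left; apply/eqP; exact: N0.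
  by apply: le_measure => //; rewrite inE.
by rewrite lebesgue_measure_itv /= lte_fin ltr01 oppr0 adde0 lee_fin ler10.
Qed.

(* The integral of the nonnegative [t^(x-1) e^-t (t^h - a^h) (t^d - a^d)], with
   [a^h = gamma (x + h) / gamma x]. *)
Lemma gamma_log_convex x h (d : R) : 0 < x -> 0 < h -> 0 <= d ->
  gamma (x + h) * gamma (x + d) <= gamma x * gamma (x + h + d).
Proof.
move=> x0 h0 d0.
have G0 := gamma_gt0 x0.
have Gh0 : 0 < gamma (x + h) by rewrite gamma_gt0// addr_gt0.
pose a := (gamma (x + h) / gamma x) `^ h^-1.
have a0 : 0 < a by apply/powR_gt0/divr_gt0.
have ah : a `^ h = gamma (x + h) / gamma x.
  by rewrite -powRrM mulVf ?gt_eqF// powRr1// divr_ge0// ltW.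
have xd : 0 < x + d by rewrite ltr_wpDr.
have xhd : 0 < x + h + d by rewrite ltr_wpDr// addr_gt0.
have xh : 0 < x + h by rewrite addr_gt0.
have E t : 0 < t -> gammaf x t * ((t `^ h - a `^ h) * (t `^ d - a `^ d)) =
   gammaf (x + h + d) t - a `^ d * gammaf (x + h) t - a `^ h * gammaf (x + d) t + (a `^ h * a `^ d) * gammaf x t.
  move=> t0; rewrite /gammaf.
  have e s : t `^ (x + s - 1) = t `^ (x - 1) * t `^ s.
    by rewrite -powR_addr//; congr (t `^ _); ring.
  by rewrite -[x + h + d]addrA !e (powR_addr h d)//; ring.
have : 0 <= \int[leb]_(t in `]0, +oo[) (gammaf x t * ((t `^ h - a `^ h) * (t `^ d - a `^ d))).
  apply: Rintegral_ge0 => t /=; rewrite in_itv /= andbT => t0.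
  rewrite mulr_ge0 ?gammaf_ge0//.
  have [ta|ta] := leP a t.
    by rewrite mulr_ge0// subr_ge0 ge0_ler_powR ?nnegrE// ltW.
  by rewrite mulr_le0// subr_le0 ge0_ler_powR ?nnegrE// ltW.
have -> : \int[leb]_(t in `]0, +oo[) (gammaf x t * ((t `^ h - a `^ h) * (t `^ d - a `^ d))) =
  \int[leb]_(t in `]0, +oo[) (gammaf (x + h + d) t - a `^ d * gammaf (x + h) t - a `^ h * gammaf (x + d) t + (a `^ h * a `^ d) * gammaf x t).
  by apply: eq_Rintegral => t; rewrite inE /= in_itv /= andbT => /E.
have iZ c y : 0 < y -> leb.-integrable `]0, +oo[ (EFin \o (fun t => c * gammaf y t)).
  by move=> y0; apply: integrableZ1 => //; exact: gammaf_integrable.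
have i1 : leb.-integrable `]0, +oo[ (EFin \o (fun t => gammaf (x + h + d) t - a `^ d * gammaf (x + h) t)).
  by apply: integrableB1 => //; [exact: gammaf_integrable|exact: iZ].
have i2 : leb.-integrable `]0, +oo[ (EFin \o (fun t => gammaf (x + h + d) t - a `^ d * gammaf (x + h) t - a `^ h * gammaf (x + d) t)).
  by apply: integrableB1 => //; exact: iZ.
rewrite RintegralD//; last exact: iZ.
rewrite RintegralB//; last exact: iZ.
rewrite RintegralB//; [|exact: gammaf_integrable|exact: iZ].
rewrite !RintegralZl//; [|exact: gammaf_integrable..].
rewrite -!gammaIE ah.
move: (a `^ d) (gamma (x + h)) (gamma (x + d)) (gamma (x + h + d)) (gamma x) G0 => p q r w g g0.
have -> : w - p * q - q / g * r + q / g * p * g = (g * w - q * r) / g by field; rewrite gt_eqF.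
by rewrite pmulr_lge0 ?invr_gt0// subr_ge0.
Qed.

(* Young's inequality [(t/x)^h <= h t/x + 1 - h]. *)
Lemma gamma_Wendel x h : 0 < x -> 0 < h -> h < 1 -> gamma (x + h) <= x `^ h * gamma x.
Proof.
move=> x0 h0 h1.
have k0 : 0 < 1 - h by rewrite subr_gt0.
have iG := gammaf_integrable x0.
have x1 : 0 < x + 1 by rewrite addr_gt0.
have iG1 := gammaf_integrable x1.
have iZ c y : 0 < y -> leb.-integrable `]0, +oo[ (EFin \o (fun t => c * gammaf y t)).
  by move=> y0; apply: integrableZ1 => //; exact: gammaf_integrable.
have -> : x `^ h * gamma x = \int[leb]_(t in `]0, +oo[) (x `^ h * (h / x) * gammaf (x + 1) t + x `^ h * (1 - h) * gammaf x t).
  rewrite RintegralD//; [|exact: iZ..].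
  rewrite !RintegralZl//.
  rewrite -!gammaIE gammaS//.
  by field; rewrite gt_eqF.
rewrite gammaIE; apply: le_Rintegral => //.
- by apply: gammaf_integrable; rewrite addr_gt0.
- by apply: integrableD1 => //; exact: iZ.
move=> t /=; rewrite in_itv /= andbT => t0.
have -> : gammaf (x + 1) t = t * gammaf x t.
  by rewrite /gammaf addrK mulrA mulr_powRB1// ltW.
have -> : gammaf (x + h) t = t `^ h * gammaf x t.
  rewrite /gammaf mulrA -powR_addr//; congr (t `^ _ * _); ring.
have Y : (t / x) `^ h <= h * (t / x) + (1 - h).
  have tx : 0 <= t / x by rewrite ltW// divr_gt0.
  have := @conjugate_powR R ((t / x) `^ h) 1 h^-1 (1 - h)^-1 (powR_ge0 _ _) ler01.
  rewrite !invr_gt0 !invrK h0 k0 addrC subrK.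
  move=> /(_ erefl erefl erefl); rewrite -powRrM mulfV ?gt_eqF// powRr1// powR1 mulr1 mul1r.
  by rewrite [_ * h]mulrC.
rewrite mulrA -mulrDl ler_wpM2r ?gammaf_ge0//.
have -> : x `^ h * (h / x) * t + x `^ h * (1 - h) = x `^ h * (h * (t / x) + (1 - h)) by ring.
rewrite -[t in leLHS](@divfK _ x) ?gt_eqF// powRM ?(ltW x0) ?divr_ge0 ?(ltW t0) ?(ltW x0)// mulrC.
by rewrite ler_wpM2l// powR_ge0.
Qed.

End GammaFunction.

(** * The Beta integral *)

Section Beta.
Context {R : realType}.
Local Notation leb := (@lebesgue_measure R).
Implicit Types a b s x y z t : R.

(** The truncated power: it vanishes off the positive half line, where the values of [powR] are mere
    conventions, so that integrals over moving intervals become integrals over the whole line. *)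
Definition ppow s x : R := if 0 < x then x `^ s else 0.

Lemma ppow_ge0 s x : 0 <= ppow s x.
Proof. by rewrite /ppow; case: ifP => // _; exact: powR_ge0. Qed.

Lemma ppow_gt0E s x : 0 < x -> ppow s x = x `^ s.
Proof. by rewrite /ppow => ->. Qed.

Lemma ppow_le0E s x : x <= 0 -> ppow s x = 0.
Proof. by rewrite /ppow leNgt => /negbTE ->. Qed.

Lemma ppowM s x y : 0 < x -> ppow s (x * y) = x `^ s * ppow s y.
Proof.
move=> x0; rewrite /ppow pmulr_rgt0//; case: ifP => y0; last by rewrite mulr0.
by rewrite powRM// ltW.
Qed.

Lemma measurable_ppow s : measurable_fun setT (ppow s).
Proof.
apply: measurable_fun_if => //.
- by apply: measurable_fun_ltr => //; exact: measurable_cst.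
- apply: measurable_funTS; exact: measurable_powR.
Qed.

Lemma measurable_ppow_sub s (c : R) (D : set R) : measurable_fun D (fun x => ppow s (c - x)).
Proof.
apply: measurable_funTS; apply: measurableT_comp; first exact: measurable_ppow.
by apply: measurable_funB => //; exact: measurable_cst.
Qed.

Lemma eGamma_ppow z : (\int[leb]_t (ppow (z - 1) t * expR (- t))%:E = eGamma z)%E.
Proof.
rewrite /eGamma [RHS]integral_mkcond; apply: eq_integral => t _.
rewrite patchE /ppow /gammaf; case: ifPn => h.
  by rewrite mem_set//= in_itv/= andbT.
by rewrite memNset ?mul0r//= in_itv/= andbT; exact/negP.
Qed.

(** The convolution of two truncated powers; Euler's Beta integral is the case [z = 1]. *)
Definition ebeta a b z : \bar R :=
  (\int[leb]_x (ppow (a - 1) x * ppow (b - 1) (z - x))%:E)%E.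

Let mint a b z : measurable_fun setT (fun x => (ppow (a - 1) x * ppow (b - 1) (z - x))%:E).
Proof.
apply/measurable_EFinP; apply: measurable_funM; first exact: measurable_ppow.
exact: measurable_ppow_sub.
Qed.

Lemma ebeta_ge0 a b z : (0 <= ebeta a b z)%E.
Proof. by apply: integral_ge0 => x _; rewrite lee_fin mulr_ge0 ?ppow_ge0. Qed.

Lemma ebeta_scale a b z : 0 < z -> (ebeta a b z = (z `^ (a + b - 1))%:E * ebeta a b 1)%E.
Proof.
move=> z0; have zn : z != 0 by rewrite gt_eqF.
have f0 x : (0 <= (ppow (a - 1) x * ppow (b - 1) (z - x))%:E)%E by rewrite lee_fin mulr_ge0 ?ppow_ge0.
apply: (etrans (esym (ge0_integral_affine 0 zn (mint a b z) f0))).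
rewrite (gtr0_norm z0).
have -> : (\int[leb]_x (ppow (a - 1) (z * x + 0)%R * ppow (b - 1) (z - (z * x + 0)))%:E =
  \int[leb]_x ((z `^ (a + b - 2))%:E * (ppow (a - 1) x * ppow (b - 1) (1 - x))%:E))%E.
  apply: eq_integral => x _; rewrite addr0 -[X in X - z * x]mulr1 -mulrBr !ppowM// -EFinM; congr EFin.
  rewrite (_ : a + b - 2 = (a - 1) + (b - 1)); last by ring.
  by rewrite (powR_addr (a - 1) (b - 1) z0); ring.
rewrite ge0_integralZl; last 4 first.
- by [].
- exact: mint.
- by move=> x _; rewrite lee_fin mulr_ge0 ?ppow_ge0.
- by rewrite lee_fin powR_ge0.
rewrite muleA -EFinM; congr (_%:E * _)%E.
rewrite -{1}(powRr1 (ltW z0)) -powR_addr//; congr (z `^ _); ring.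
Qed.

Let F a b (p : R * R) : \bar R := (ppow (a - 1) p.1 * ppow (b - 1) (p.2 - p.1) * expR (- p.2))%:E.

(** Tonelli's theorem for [F]: one order of integration gives [gamma a * gamma b], the other
    [ebeta a b 1 * gamma (a + b)] by homogeneity. The comparison also shows that the Beta integral
    is finite. *)
Lemma ebeta1 a b : 0 < a -> 0 < b -> ebeta a b 1 = (gamma a * gamma b / gamma (a + b))%:E.
Proof.
move=> a0 b0; have ab0 : 0 < a + b by rewrite addr_gt0.
have mF : measurable_fun setT (F a b).
  apply/measurable_EFinP; apply: measurable_funM; first apply: measurable_funM.
  - by apply: measurableT_comp => //; exact: measurable_ppow.
  - apply: measurableT_comp; first exact: measurable_ppow.
    by apply: measurable_funB.
  - apply: (@measurableT_comp _ _ _ _ _ _ (fun t : R => expR (- t))) => //; exact: measurable_expRN.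
have F0 p : (0 <= F a b p)%E by rewrite lee_fin !mulr_ge0 ?ppow_ge0 ?expR_ge0.
have mg c : measurable_fun setT (fun t => (ppow (c - 1) t * expR (- t))%:E).
  apply/measurable_EFinP; apply: measurable_funM; first exact: measurable_ppow.
  exact: measurable_expRN.
have g0 c (t : R) : (0 <= (ppow (c - 1) t * expR (- t))%:E)%E.
  by rewrite lee_fin mulr_ge0 ?ppow_ge0 ?expR_ge0.
have := fubini_tonelli (m1 := leb) (m2 := leb) _ mF F0.
have -> : (\int[leb]_x \int[leb]_y F a b (x, y) = eGamma a * eGamma b)%E.
  transitivity (\int[leb]_x ((ppow (a - 1) x * expR (- x))%:E * eGamma b))%E.
    apply: eq_integral => x _; rewrite -eGamma_ppow.
    have <- := ge0_integral_affine (- x) (oner_neq0 _) (mg b) (g0 b).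
    have mc := measurableT_comp (mg b) (measurable_affine 1 (- x)).
    rewrite normr1 mul1e -ge0_integralZl; last 4 first.
    - by [].
    - exact: mc.
    - by move=> t _; exact: g0.
    - exact: g0.
    apply: eq_integral => y _; rewrite /F /= mul1r -EFinM; congr EFin.
    rewrite mulrACA -expRD; congr (_ * expR _); ring.
  rewrite ge0_integralZr ?eGamma_ge0 ?eGamma_ppow//.
  exact: mg.
have -> : (\int[leb]_y \int[leb]_x F a b (x, y) = ebeta a b 1 * eGamma (a + b))%E.
  rewrite -eGamma_ppow -ge0_integralZl ?ebeta_ge0//; last first.
    exact: mg.
  apply: eq_integral => z _.
  transitivity ((expR (- z))%:E * ebeta a b z)%E.
    rewrite /ebeta -ge0_integralZl; last 4 first.
    - by [].
    - exact: mint.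
    - by move=> x _; rewrite lee_fin mulr_ge0 ?ppow_ge0.
    - by rewrite lee_fin expR_ge0.
    by apply: eq_integral => x _; rewrite /F /= -EFinM mulrC.
  have [z0|z0] := ltP 0 z.
    rewrite ebeta_scale// ppow_gt0E// EFinM muleA -EFinM muleC; congr (_ * _)%E.
    by rewrite mulrC EFinM.
  rewrite ppow_le0E// mul0r mule0 /ebeta integral0_eq ?mule0// => x _.
  have [x0|x0] := leP x 0; first by rewrite ppow_le0E// mul0r.
  by rewrite [ppow (b - 1) _]ppow_le0E ?mulr0// subr_le0 (le_trans z0)// ltW.
rewrite -!gammaE// => e.
have G0 := gamma_gt0 ab0.
have := ebeta_ge0 a b 1; move: e; case: (ebeta a b 1) => [r|/=|//].
- by rewrite -!EFinM => /eqP; rewrite eqe => /eqP -> _; rewrite mulfK// gt_eqF.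
- by rewrite gt0_mulye ?lte_fin//.
Qed.

Lemma ebetaE a b z : 0 < a -> 0 < b ->
  ebeta a b z = (gamma a * gamma b / gamma (a + b) * ppow (a + b - 1) z)%:E.
Proof.
move=> a0 b0; have [z0|z0] := ltP 0 z.
  by rewrite ebeta_scale// ebeta1// ppow_gt0E// -EFinM mulrC.
rewrite ppow_le0E// mulr0 /ebeta integral0_eq// => x _.
have [x0|x0] := leP x 0; first by rewrite ppow_le0E// mul0r.
by rewrite [ppow (b - 1) _]ppow_le0E ?mulr0// subr_le0 (le_trans z0)// ltW.
Qed.

(** The semigroup law of fractional integration at the level of kernels. *)
Lemma integral_ppow_ppow a b x y : 0 < a -> 0 < b ->
  (\int[leb]_t (ppow (a - 1) (t - y) * ppow (b - 1) (x - t))%:E =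
   (gamma a * gamma b / gamma (a + b) * ppow (a + b - 1) (x - y))%:E)%E.
Proof.
move=> a0 b0; rewrite -(ebetaE (x - y) a0 b0).
have f0 t : (0 <= (ppow (a - 1) t * ppow (b - 1) (x - y - t))%:E)%E by rewrite lee_fin mulr_ge0 ?ppow_ge0.
apply: (etrans _ (ge0_integral_affine (- y) (oner_neq0 _) (mint a b (x - y)) f0)).
rewrite normr1 mul1e; apply: eq_integral => t _; congr (_ * ppow _ _)%:E.
by rewrite mul1r. by rewrite mul1r; ring.
Qed.

End Beta.

(** * The duplication formula *)

Section GammaDuplication.
Context {R : realType}.
Implicit Types x y z t h : R.

(** Replaces passages to the limit: an inequality with an error of order [1 / n], multiplied by [n],
    has this form. *)
Lemma natmul_bounded_le0 (c K : R) : (forall n : nat, (0 < n)%N -> n%:R * c <= K) -> c <= 0.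
Proof.
move=> cK; rewrite leNgt; apply/negP => c0.
have K0 : 0 <= K / c by rewrite divr_ge0// ?(ltW c0)// (le_trans _ (cK 1%N isT))// mul1r ltW.
have := cK (Num.truncn (K / c)).+1 isT; rewrite -ler_pdivlMr// leNgt.
by rewrite Num.Theory.truncnS_gt.
Qed.

(** Wendel's inequality on the step from [x + h] to [x + 1]. *)
Lemma gamma_ge_Wendel x h : 0 < x -> 0 < h -> h < 1 -> x * gamma x <= (x + h) `^ (1 - h) * gamma (x + h).
Proof.
move=> x0 h0 h1; rewrite -gammaS//.
have -> : x + 1 = x + h + (1 - h) by ring.
by apply: gamma_Wendel; lra.
Qed.

Let dup x : R := gamma (2 * x) / (2 `^ (2 * x) * gamma x * gamma (x + 2^-1)).

Let dup_gt0 x : 0 < x -> 0 < dup x.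
Proof.
move=> x0; rewrite divr_gt0 ?mulr_gt0 ?powR_gt0 ?gamma_gt0//; lra.
Qed.

Let dupS x : 0 < x -> dup (x + 2^-1) = dup x.
Proof.
move=> x0; rewrite /dup.
have -> : 2 * (x + 2^-1) = 2 * x + 1 by field.
have -> : x + 2^-1 + 2^-1 = x + 1 by field.
rewrite (gammaS x0) gammaS ?mulr_gt0// (powR_addr (2 * x) 1)// powRr1//.
have : gamma x != 0 by rewrite gt_eqF// gamma_gt0.
have : gamma (x + 2^-1) != 0 by rewrite gt_eqF// gamma_gt0//; lra.
have : 2 `^ (2 * x) != 0 :> R by rewrite gt_eqF// powR_gt0.
have : x != 0 by rewrite gt_eqF.
move: (gamma _) (gamma x) (gamma (2 * x)) (_ `^ _) => p q r w ? ? ? ?.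
by field; do ?[apply/andP; split].
Qed.

Let dup_nat n x : 0 < x -> dup (x + n%:R / 2) = dup x.
Proof.
move=> x0; elim: n => [|n IH]; first by rewrite mul0r addr0.
rewrite -IH -[in RHS]dupS; last by rewrite ltr_wpDr// divr_ge0.
by congr dup; rewrite -natr1; field.
Qed.

(** Wendel's inequality bounds the numerator from above and both factors of the denominator from
    below, every base being enlarged to [y + 1]. The exponents [2 h], [1 - h] and [1 - h] add up to
    the square; [h < 1/2] keeps the step [2 h] of the numerator below one. *)
Let dup_upper y h : 0 < y -> 0 < h -> h < 2^-1 -> dup (y + h) * y ^+ 2 <= dup y * (y + 1) ^+ 2.
Proof.
move=> y0 h0 h1; have w0 : 0 < y + 1 by lra.
have y20 : 0 < y + 2^-1 by lra.
have a1 : gamma (2 * (y + h)) <= 2 `^ (2 * h) * (y + 1) `^ (2 * h) * gamma (2 * y).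
  rewrite mulrDr (le_trans (@gamma_Wendel R (2 * y) (2 * h) _ _ _)) ?mulr_gt0//; first lra.
  rewrite ler_pM2r ?gamma_gt0 ?mulr_gt0// powRM ?(ltW y0)// ler_pM2l ?powR_gt0//.
  by apply: ge0_ler_powR; rewrite ?nnegrE ?(ltW y0) ?(ltW w0) ?mulr_ge0 ?(ltW h0)//; lra.
have a2 : y * gamma y <= (y + 1) `^ (1 - h) * gamma (y + h).
  rewrite (le_trans (gamma_ge_Wendel y0 h0 _))//; first lra.
  rewrite ler_pM2r ?gamma_gt0 ?addr_gt0//.
  by apply: ge0_ler_powR; rewrite ?nnegrE; lra.
have a3 : y * gamma (y + 2^-1) <= (y + 1) `^ (1 - h) * gamma (y + h + 2^-1).
  apply: (@le_trans _ _ ((y + 2^-1) * gamma (y + 2^-1))).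
    by rewrite ler_pM2r ?gamma_gt0//; lra.
  rewrite (le_trans (gamma_ge_Wendel y20 h0 _))//; first lra.
  rewrite [y + 2^-1 + h]addrAC ler_pM2r; last by apply: gamma_gt0; lra.
  by apply: ge0_ler_powR; rewrite ?nnegrE; lra.
have g1 : 0 < gamma y by exact: gamma_gt0.
have g2 : 0 < gamma (y + 2^-1) by exact: gamma_gt0.
have g3 : 0 < gamma (2 * y) by rewrite gamma_gt0// mulr_gt0.
have g4 : 0 < gamma (y + h) by rewrite gamma_gt0// addr_gt0.
have g5 : 0 < gamma (y + h + 2^-1) by rewrite gamma_gt0//; lra.
have p0 : 0 < 2 `^ (2 * y) :> R by rewrite powR_gt0.
have q0 : 0 < 2 `^ (2 * h) :> R by rewrite powR_gt0.
have e : (y + 1) `^ (2 * h) * ((y + 1) `^ (1 - h) * (y + 1) `^ (1 - h)) = (y + 1) ^+ 2.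
  by rewrite -!powR_addr// -powR_mulrn ?(ltW w0)//; congr (_ `^ _); ring.
have e2 : 2 `^ (2 * (y + h)) = 2 `^ (2 * y) * 2 `^ (2 * h) :> R.
  by rewrite mulrDr powR_addr.
rewrite /dup e2.
move: (gamma (2 * (y + h))) a1 => A a1.
have w1 : 0 < (y + 1) `^ (1 - h) by rewrite powR_gt0.
have w2 : 0 < (y + 1) `^ (2 * h) by rewrite powR_gt0.
move: a1 a2 a3 g1 g2 g3 g4 g5 p0 q0 w1 w2 e.
move: (gamma y) (gamma (y + 2^-1)) (gamma (2 * y)) (gamma (y + h)) (gamma (y + h + 2^-1)) (2 `^ (2 * y)) (2 `^ (2 * h)) ((y+1) `^ (1 - h)) ((y+1) `^ (2 * h)).
move=> g1 g2 g3 g4 g5 p q w1 w2 a1 a2 a3 G1 G2 G3 G4 G5 P Q W1 W2 e.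
have key : A * ((y * g1) * (y * g2)) <= (q * w2 * g3) * ((w1 * g4) * (w1 * g5)).
  have A0 : 0 <= (y * g1) * (y * g2) by apply/ltW; rewrite !mulr_gt0.
  apply: (le_trans (ler_wpM2r A0 a1)).
  rewrite ler_pM2l ?mulr_gt0//; by apply: ler_pM => //; apply/ltW; rewrite mulr_gt0.
rewrite -e -(@ler_pM2r _ (p * q * g4 * g5 * g1 * g2)) ?mulr_gt0//.
have -> : A / (p * q * g4 * g5) * y ^+ 2 * (p * q * g4 * g5 * g1 * g2) = A * ((y * g1) * (y * g2)).
  by field; rewrite !gt_eqF.
have -> // : g3 / (p * g1 * g2) * (w2 * (w1 * w1)) * (p * q * g4 * g5 * g1 * g2) = (q * w2 * g3) * ((w1 * g4) * (w1 * g5)).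
by field; rewrite !gt_eqF.
Qed.

(** The mirror estimate, with exponents [1 - 2 h], [h] and [h], which add up to [1]. *)
Let dup_lower y h : 0 < y -> 0 < h -> h < 2^-1 -> dup y * y <= dup (y + h) * (y + 1).
Proof.
move=> y0 h0 h1; have w0 : 0 < y + 1 by lra.
have y20 : 0 < y + 2^-1 by lra.
have a1 : 2 * y * gamma (2 * y) <= 2 `^ (1 - 2 * h) * (y + 1) `^ (1 - 2 * h) * gamma (2 * (y + h)).
  rewrite (le_trans (@gamma_ge_Wendel (2 * y) (2 * h) _ _ _)) ?mulr_gt0//; first lra.
  rewrite -mulrDr ler_pM2r ?gamma_gt0 ?mulr_gt0 ?addr_gt0// powRM; [|lra|lra].
  rewrite ler_pM2l ?powR_gt0//.
  by apply: ge0_ler_powR; rewrite ?nnegrE; lra.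
have a2 : gamma (y + h) <= (y + 1) `^ h * gamma y.
  rewrite (le_trans (gamma_Wendel y0 h0 _))//; first lra.
  rewrite ler_pM2r ?gamma_gt0//.
  by apply: ge0_ler_powR; rewrite ?nnegrE; lra.
have a3 : gamma (y + h + 2^-1) <= (y + 1) `^ h * gamma (y + 2^-1).
  rewrite [y + h + _]addrAC (le_trans (gamma_Wendel y20 h0 _))//; first lra.
  rewrite ler_pM2r ?gamma_gt0//.
  by apply: ge0_ler_powR; rewrite ?nnegrE; lra.
have g1 : 0 < gamma y by exact: gamma_gt0.
have g2 : 0 < gamma (y + 2^-1) by exact: gamma_gt0.
have g3 : 0 < gamma (2 * y) by rewrite gamma_gt0// mulr_gt0.
have g4 : 0 < gamma (y + h) by rewrite gamma_gt0// addr_gt0.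
have g5 : 0 < gamma (y + h + 2^-1) by rewrite gamma_gt0//; lra.
have g6 : 0 < gamma (2 * (y + h)) by rewrite gamma_gt0// mulr_gt0// addr_gt0.
have p0 : 0 < 2 `^ (2 * y) :> R by rewrite powR_gt0.
have q0 : 0 < 2 `^ (2 * h) :> R by rewrite powR_gt0.
have r0 : 0 < 2 `^ (1 - 2 * h) :> R by rewrite powR_gt0.
have w1 : 0 < (y + 1) `^ h by rewrite powR_gt0.
have w2 : 0 < (y + 1) `^ (1 - 2 * h) by rewrite powR_gt0.
have e : (y + 1) `^ (1 - 2 * h) * ((y + 1) `^ h * (y + 1) `^ h) = y + 1.
  rewrite -!powR_addr// -[RHS]powRr1 ?(ltW w0)//; congr (_ `^ _); ring.
have e2 : 2 `^ (2 * (y + h)) = 2 `^ (2 * y) * 2 `^ (2 * h) :> R.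
  by rewrite mulrDr powR_addr.
have e3 : 2 `^ (1 - 2 * h) * 2 `^ (2 * h) = 2 :> R.
  by rewrite -powR_addr// subrK powRr1.
rewrite /dup e2.
move: a1 a2 a3 g1 g2 g3 g4 g5 g6 p0 q0 r0 w1 w2 e e3.
move: (gamma y) (gamma (y + 2^-1)) (gamma (2 * y)) (gamma (y + h)) (gamma (y + h + 2^-1)) (gamma (2 * (y + h))) (2 `^ (2 * y)) (2 `^ (2 * h)) (2 `^ (1 - 2 * h)) ((y+1) `^ h) ((y+1) `^ (1 - 2 * h)).
move=> g1 g2 g3 g4 g5 g6 p q r w1 w2 a1 a2 a3 G1 G2 G3 G4 G5 G6 P Q RR W1 W2 e e3.
have key : (2 * y * g3) * (g4 * g5) <= (r * w2 * g6) * ((w1 * g1) * (w1 * g2)).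
  apply: ler_pM => //; [by apply/ltW; rewrite !mulr_gt0..|].
  by apply: ler_pM => //; exact/ltW.
rewrite -(@ler_pM2r _ (2 * p * q * g4 * g5 * g1 * g2)) ?mulr_gt0//.
have -> : g3 / (p * g1 * g2) * y * (2 * p * q * g4 * g5 * g1 * g2) = q * ((2 * y * g3) * (g4 * g5)).
  by field; rewrite !gt_eqF.
have -> : g6 / (p * q * g4 * g5) * (y + 1) * (2 * p * q * g4 * g5 * g1 * g2) = q * ((r * w2 * g6) * ((w1 * g1) * (w1 * g2))).
  by rewrite -{1}e3 -{1}e; field; rewrite !gt_eqF.
by rewrite ler_pM2l.
Qed.

Let dup_const x : 0 < x -> dup x = dup 2^-1.
Proof.
move=> x0; pose j := Num.truncn (2 * x); pose h := x - j%:R / 2.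
have /andP[j1 j2] : j%:R <= 2 * x < j.+1%:R by apply: Num.Theory.truncn_itv; rewrite mulr_ge0// ltW.
have h0 : 0 <= h by rewrite /h; lra.
have h1 : h < 2^-1 by rewrite /h; move: j2; rewrite -[j.+1%:R]natr1; lra.
have half0 : 0 < 2^-1 :> R by rewrite invr_gt0.
have dy n : dup (n.+1%:R / 2) = dup 2^-1.
  by rewrite -(dup_nat n half0); congr dup; rewrite -[n.+1%:R]natr1; field.
have dx n : dup x = dup ((j + n)%:R / 2 + h).
  by rewrite -(dup_nat n x0); congr dup; rewrite /h natrD; field.
have [h00|hp] := eqVneq h 0.
  by rewrite (dx 1%N) h00 addr0 addn1 dy.
have {hp}h0 : 0 < h by rewrite lt0r hp.
(* [dup x] is also the value at [y + h] for half-integers [y] arbitrarily far out, where [dup y] is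
   [dup 2^-1]. There [dup_upper] and [dup_lower] bound [n] times either difference by a constant. *)
apply/eqP; rewrite eq_le; apply/andP; split; rewrite -subr_le0.
- apply: (@natmul_bounded_le0 _ (8 * dup 2^-1)) => n n0.
  case: n n0 => // n _.
  have y0 : 0 < (j + n.+1)%:R / 2 :> R by rewrite divr_gt0// ltr0n addnS.
  have := dup_upper y0 h0 h1; rewrite -dx addnS dy -addnS.
  have ny : n.+1%:R / 2 <= (j + n.+1)%:R / 2 :> R by rewrite ler_pM2r// ler_nat leq_addl.
  have n1 : 1 <= n.+1%:R :> R by rewrite ler1n.
  have d0 := dup_gt0 half0.
  move: ny y0 n1 d0; move: ((j + n.+1)%:R / 2) (n.+1%:R) (dup 2^-1) (dup x) => y k d X ny y0 n1 d0 hX.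
  have [Xd|Xd] := leP (X - d) 0.
    rewrite (@le_trans _ _ 0)//; last by apply: mulr_ge0 => //; exact: ltW.
    by apply: mulr_ge0_le0 => //; lra.
  have : k / 2 * (X - d) <= y * (X - d) by rewrite ler_pM2r.
  have : y * (y * (X - d)) <= y * (4 * d).
    have : d * (2 * y - 1) >= 0 by apply: mulr_ge0; lra.
    have := hX; nra.
  by rewrite ler_pM2l//; lra.
- apply: (@natmul_bounded_le0 _ (2 * dup x)) => n n0.
  case: n n0 => // n _.
  have y0 : 0 < (j + n.+1)%:R / 2 :> R by rewrite divr_gt0// ltr0n addnS.
  have := dup_lower y0 h0 h1; rewrite -dx addnS dy -addnS.
  have ny : n.+1%:R / 2 <= (j + n.+1)%:R / 2 :> R by rewrite ler_pM2r// ler_nat leq_addl.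
  have n1 : 1 <= n.+1%:R :> R by rewrite ler1n.
  have d0 := dup_gt0 x0.
  move: ny y0 n1 d0; move: ((j + n.+1)%:R / 2) (n.+1%:R) (dup 2^-1) (dup x) => y k d X ny y0 n1 d0 hX.
  have [Xd|Xd] := leP (d - X) 0.
    rewrite (@le_trans _ _ 0)//; last by apply: mulr_ge0 => //; exact: ltW.
    by apply: mulr_ge0_le0 => //; lra.
  have : k / 2 * (d - X) <= y * (d - X) by rewrite ler_pM2r.
  by lra.
Qed.

(* The quotient of the two sides takes the same value at [x] and [x + 1/2], and
   Wendel's inequalities determine its limit along half-integer steps. *)
Lemma gamma_duplication x : 0 < x ->
  2 * gamma 2^-1 * gamma (2 * x) = 2 `^ (2 * x) * gamma x * gamma (x + 2^-1).
Proof.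
move=> x0; have := dup_const x0; rewrite /dup mulfV// gamma1.
have -> : 2^-1 + 2^-1 = 1 :> R by field.
rewrite gamma1 powRr1//.
have : gamma x != 0 by rewrite gt_eqF// gamma_gt0.
have : gamma (x + 2^-1) != 0 by rewrite gt_eqF// gamma_gt0//; lra.
have : gamma 2^-1 != 0 :> R by rewrite gt_eqF// gamma_gt0// invr_gt0.
have : 2 `^ (2 * x) != 0 :> R by rewrite gt_eqF// powR_gt0.
move: (gamma 2^-1) (gamma (x + _)) (gamma x) (gamma (2 * x)) (_ `^ _) => a p q r w ? ? ? ?.
by move=> /eqP; rewrite eqr_div ?mulf_neq0// !mulr1 mul1r => /eqP <-; ring.
Qed.


End GammaDuplication.

(** * The reflection formula as an inequality *)

Section GammaReflection.
Context {R : realType}.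
Implicit Types x y z t h : R.

Lemma derive_sin1 b x : is_derive x 1 (fun t => sin (b * t)) (b * cos (b * x)).
Proof.
rewrite mulrC; apply: derive_comp1.
by rewrite -[X in is_derive _ _ _ X]mulr1; apply: deriveZ1.
Qed.

Lemma derive_cos1 b x : is_derive x 1 (fun t => cos (b * t)) (- (b * sin (b * x))).
Proof.
have -> : - (b * sin (b * x)) = - sin (b * x) * b by ring.
apply: derive_comp1.
by rewrite -[X in is_derive _ _ _ X]mulr1; apply: deriveZ1.
Qed.

Local Notation leb := (@lebesgue_measure R).
(** The recurrence of these moments in [n] has the factor [(2 n + 2)^2 - b^2]. For [b = 2 th] this
    is four times the factor that [gamma (n + 1 + th) * gamma (n + 1 - th)] gains, so the two can be
    compared; the moment at [n = 0] produces the sine. *)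
Let K n b : R := \int[leb]_(t in `[0, pi / 2]) (cos t ^+ n.*2 * cos (b * t)).

Let cos_cvg (f : R -> R) (df : R -> R) : (forall x, is_derive x 1 f (df x)) -> {within `[0, pi / 2], continuous f}.
Proof. by move=> d; apply: derivable_within_continuous => x _; case: (d x). Qed.

Let dcosn n b x : is_derive x 1 (fun t : R => cos t ^+ n * cos (b * t))
  (- (n%:R * cos x ^+ n.-1 * sin x) * cos (b * x) - cos x ^+ n * (b * sin (b * x))).
Proof.
have h : is_derive x 1 (fun t : R => cos t ^+ n) (- (n%:R * cos x ^+ n.-1 * sin x)).
  by apply: is_derive_eq (deriveX1 n (is_derive_cos x)) _; rewrite mulrN.
by have := deriveM1 h (derive_cos1 b x); rewrite mulrN.
Qed.

Let contK n b : {within `[0, pi / 2], continuous (fun t : R => cos t ^+ n * cos (b * t))}.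
Proof. exact: (cos_cvg (dcosn n b)). Qed.

Let intK n b : leb.-integrable `[0, pi / 2] (EFin \o (fun t : R => cos t ^+ n * cos (b * t))).
Proof.
by apply: continuous_compact_integrable; [exact: segment_compact|exact: contK].
Qed.

Let pihalf_gt0 : 0 < pi / 2 :> R.
Proof. by rewrite divr_gt0// pi_gt0. Qed.

Let KS n b : ((2 * n.+1%:R) ^+ 2 - b ^+ 2) * K n.+1 b = 2 * n.+1%:R * (2 * n.+1%:R - 1) * K n b.
Proof.
pose N : R := 2 * n.+1%:R.
pose f t := (N ^+ 2 - b ^+ 2) * (cos t ^+ n.+1.*2 * cos (b * t)) - N * (N - 1) * (cos t ^+ n.*2 * cos (b * t)).
(* A primitive of [f] that vanishes at both ends, because [cos (pi / 2) = 0] and [sin 0 = 0]. *)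
pose F t := N * (cos t ^+ n.*2.+1 * sin t * cos (b * t)) - b * (cos t ^+ n.+1.*2 * sin (b * t)) : R.
have dX j (x : R) : is_derive x 1 (fun t : R => cos t ^+ j) (- (j%:R * cos x ^+ j.-1 * sin x)).
  by apply: is_derive_eq (deriveX1 j (is_derive_cos x)) _; rewrite mulrN.
have dF x : is_derive x 1 F (f x).
  have h1 := deriveM1 (deriveM1 (dX n.*2.+1 x) (is_derive_sin x)) (derive_cos1 b x).
  have h2 := deriveM1 (dX n.+1.*2 x) (derive_sin1 b x).
  apply: is_derive_eq (deriveB1 (deriveZ1 N h1) (deriveZ1 b h2)) _.
  have eN : n.*2.+1%:R = N - 1 :> R by rewrite /N -muln2 -addn1 natrD natrM -[n.+1%:R]natr1; ring.
  have eN2 : n.+1.*2%:R = N :> R by rewrite -muln2 natrM mulrC.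
  rewrite /f eN eN2 doubleS /= !exprS.
  have e3 : sin x * sin x = 1 - cos x * cos x by rewrite -!expr2 sin2cos2.
  move: e3; move: (cos x) (sin x) (cos (b * x)) (sin (b * x)) (cos x ^+ n.*2) => c s C S p e3.
  have -> : N * ((- ((N - 1) * p * s) * s + c * p * c) * C + c * p * s * - (b * S)) - b * (- (N * (c * p) * s) * S + c * (c * p) * (b * C))
   = N * ((- ((N - 1) * p) * (s * s) + c * p * c) * C) - b * (c * (c * p) * (b * C)) by ring.
  rewrite e3; ring.
have cf : {within `[0, pi / 2], continuous f}.
  by move=> x; apply: cvgB; (apply: cvgM; [exact: cvg_cst|exact: contK]).
have := Rintegral_FTC pihalf_gt0 cf (cos_cvg dF) (fun x _ => dF x).
rewrite /f RintegralB//; [|by apply: integrableZ1 => //; exact: intK..].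
rewrite !RintegralZl//; [|exact: intK..].
move=> e; rewrite /K -/N; apply/eqP; rewrite -subr_eq0; apply/eqP.
rewrite e /F cos_pihalf !mulr0 sin0 !exprS !(mul0r, mulr0); ring.
Qed.

Let sin_le_id t : 0 <= t -> sin t <= t.
Proof.
move=> t0; rewrite -subr_ge0.
have d x : is_derive x 1 (fun t : R => t - sin t) (1 - cos x).
  exact: deriveB1.
have := derive_ge0_le t0 (is_derive_within d) (fun x _ => d x).
by rewrite sin0 subrr; apply => x _; rewrite subr_ge0 cos_le1.
Qed.

Let cos_ge_quadratic t : 0 <= t -> 1 - t ^+ 2 / 2 <= cos t.
Proof.
move=> t0; have -> : t = (t / 2) *+ 2 by rewrite mulr2n; field.
rewrite cos_mulr2n cos2sin2.
have h0 : 0 <= t / 2 by rewrite divr_ge0.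
have h1 := sin_le_id h0.
have h2 : - (t / 2) <= sin (t / 2).
  have d x : is_derive x 1 (fun t : R => t + sin t) (1 + cos x).
    exact: deriveD1.
  have : 0 + sin 0 <= t / 2 + sin (t / 2).
    by apply: derive_ge0_le h0 (is_derive_within d) (fun x _ => d x) _ => x _; have := cos_geN1 x; lra.
  rewrite sin0; lra.
have : sin (t / 2) ^+ 2 <= (t / 2) ^+ 2.
  by rewrite -real_normK ?num_real// ler_pXn2r ?nnegrE// ler_norml h2.
move: (sin (t / 2)) => s hs; have -> : 1 - (t / 2 *+ 2) ^+ 2 / 2 = 1 - 2 * (t / 2) ^+ 2 by rewrite mulr2n; field.
rewrite [X in _ <= X - 1]mulr2n; lra.
Qed.

Let mul_cos_le_sin t : 0 <= t -> t <= pi / 2 -> t * cos t <= sin t.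
Proof.
move=> t0 t1; rewrite -subr_ge0.
have d x : is_derive x 1 (fun t : R => sin t - t * cos t) (x * sin x).
  apply: is_derive_eq (deriveB1 (is_derive_sin x) (deriveM1 (is_derive_id x 1) (is_derive_cos x))) _.
  by rewrite mul1r; ring.
have := derive_ge0_le t0 (is_derive_within d) (fun x _ => d x).
rewrite sin0 mul0r subrr; apply => x; rewrite in_itv /= => /andP[x0 xt].
rewrite mulr_ge0 ?(ltW x0)// sin_ge0_pi// (ltW x0)/=.
have := pi_gt0 R; lra.
Qed.

Let K0S n : (2 * n.+1%:R) * K n.+1 0 = (2 * n.+1%:R - 1) * K n 0.
Proof.
have n0 : 2 * n.+1%:R != 0 :> R by rewrite mulf_neq0// pnatr_eq0.
apply: (mulfI n0); rewrite !mulrA -KS; ring.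
Qed.

Let K00 : K 0%N 0 = pi / 2.
Proof.
rewrite /K; under eq_Rintegral do rewrite expr0 mul1r mul0r cos0.
by rewrite Rintegral_cst//= lebesgue_measure_itv /= lte_fin pihalf_gt0 /= mul1r subr0.
Qed.

Let K0_gt0 n : 0 < K n 0.
Proof.
elim: n => [|n IH]; first by rewrite K00 pihalf_gt0.
have : 0 < 2 * n.+1%:R * K n.+1 0.
  by rewrite K0S mulr_gt0// subr_gt0 -natrM ltr1n.
by rewrite pmulr_rgt0// mulr_gt0.
Qed.

Let K0b b : b != 0 -> b * K 0%N b = sin (b * (pi / 2)).
Proof.
move=> b0; rewrite /K -RintegralZl//.
under eq_Rintegral do rewrite expr0 mul1r.
rewrite (Rintegral_FTC pihalf_gt0 _ (is_derive_within (derive_sin1 b)) (fun x _ => derive_sin1 b x)).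
  by rewrite mulr0 sin0 subr0.
apply: (@is_derive_within _ _ (fun x => b * cos (b * x)) (fun x => b * - (b * sin (b * x)))) => x.
by apply: deriveZ1; exact: derive_cos1.
Qed.

(** By [cos (b t) >= 1 - (b t)^2 / 2] and [t cos t <= sin t], the quadratic loss is at most
    [b^2 / 2] times [K n 0 - K n.+1 0], a difference that the recurrence turns into [K n.+1 0]
    divided by [2 n + 1]. *)
Let K_lower n b : 0 <= b -> K n.+1 0 * (1 - b ^+ 2 / 2 / (2 * n.+1%:R - 1)) <= K n.+1 b.
Proof.
move=> b0.
have n0 : 0 < 2 * n.+1%:R - 1 :> R by have : 1 <= n.+1%:R :> R by [rewrite ler1n]; lra.
have -> : K n.+1 0 * (1 - b ^+ 2 / 2 / (2 * n.+1%:R - 1)) = K n.+1 0 - b ^+ 2 / 2 * (K n 0 - K n.+1 0).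
  have -> : K n 0 = 2 * n.+1%:R * K n.+1 0 / (2 * n.+1%:R - 1).
    by rewrite K0S mulrAC mulfV ?mul1r// gt_eqF.
  by field; rewrite gt_eqF.
have iB : leb.-integrable `[0, pi / 2] (EFin \o (fun t : R => cos t ^+ n.*2 * cos (0 * t) - cos t ^+ n.+1.*2 * cos (0 * t))).
  by apply: integrableB1 => //; exact: intK.
have -> : K n.+1 0 - b ^+ 2 / 2 * (K n 0 - K n.+1 0) = \int[leb]_(t in `[0, pi / 2])
   (cos t ^+ n.+1.*2 * cos (0 * t) - b ^+ 2 / 2 * (cos t ^+ n.*2 * cos (0 * t) - cos t ^+ n.+1.*2 * cos (0 * t))).
  rewrite RintegralB//; last exact: integrableZ1.
  by rewrite RintegralZl// RintegralB//; exact: intK.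
rewrite /K; apply: le_Rintegral => //.
  by apply: integrableB1 => //; exact: integrableZ1.
move=> t /=; rewrite in_itv /= => /andP[t0 t1].
rewrite mul0r cos0 !mulr1.
have bt0 : 0 <= b * t by exact: mulr_ge0.
have h1 := cos_ge_quadratic bt0.
have c0 : 0 <= cos t by rewrite cos_ge0_pihalf// t1 (le_trans _ t0)// oppr_le0 ltW// pihalf_gt0.
have h2 : (t * cos t) ^+ 2 <= sin t ^+ 2.
  by rewrite ler_pXn2r ?nnegrE ?mulr_ge0// ?mul_cos_le_sin// (le_trans _ (mul_cos_le_sin t0 t1))// mulr_ge0.
move: h2; rewrite sin2cos2 exprMn => h2.
have C0 : 0 <= cos t ^+ n.*2 by rewrite exprn_ge0.
rewrite doubleS !exprS mulrA -expr2.
have : cos t ^+ 2 * cos t ^+ n.*2 * (1 - (b * t) ^+ 2 / 2) <= cos t ^+ 2 * cos t ^+ n.*2 * cos (b * t).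
  by rewrite ler_wpM2l// mulr_ge0// exprn_ge0.
apply: le_trans.
have : cos t ^+ n.*2 * (b ^+ 2 / 2) * (t ^+ 2 * cos t ^+ 2) <= cos t ^+ n.*2 * (b ^+ 2 / 2) * (1 - cos t ^+ 2).
  by rewrite ler_wpM2l// mulr_ge0// divr_ge0// exprn_ge0.
rewrite exprMn; lra.
Qed.

(** Both sides gain the same factor when [n] grows by one, and they agree at [n = 0]. *)
Let gK th n : 0 < th -> th < 1 ->
  gamma (n%:R + 1 + th) * gamma (n%:R + 1 - th) * K n (2 * th) * K 0%N 0 =
  gamma (1 + th) * gamma (1 - th) * K 0%N (2 * th) * (gamma (n%:R + 1) ^+ 2 * K n 0).
Proof.
move=> h0 h1; elim: n => [|n IH].
  by rewrite !add0r gamma1; ring.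
rewrite -[n.+1%:R]natr1; set N : R := n%:R in IH *.
have N0 : 0 <= N by rewrite ler0n.
have -> : N + 1 + 1 + th = N + 1 + th + 1 by ring.
have -> : N + 1 + 1 - th = N + 1 - th + 1 by ring.
have := KS n (2 * th); have := K0S n; rewrite -[n.+1%:R]natr1 -/N => k0 k1.
rewrite (@gammaS _ (N + 1 + th)); last lra.
rewrite (@gammaS _ (N + 1 - th)); last lra.
rewrite (@gammaS _ (N + 1)); last lra.
have e1 : (N + 1 + th) * (N + 1 - th) * K n.+1 (2 * th) = (N + 1) / 2 * (2 * (N + 1) - 1) * K n (2 * th).
  apply: (@mulfI _ 4) => //; have -> : 4 * ((N + 1) / 2 * (2 * (N + 1) - 1) * K n (2 * th)) = 2 * (N + 1) * (2 * (N + 1) - 1) * K n (2 * th) by field.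
  by rewrite -k1; ring.
have e2 : (N + 1) ^+ 2 * K n.+1 0 = (N + 1) / 2 * (2 * (N + 1) - 1) * K n 0.
  have -> : (N + 1) / 2 * (2 * (N + 1) - 1) * K n 0 = (N + 1) / 2 * ((2 * (N + 1) - 1) * K n 0) by ring.
  by rewrite -k0; field.
move: e1 e2 IH; move: (gamma (N + 1 + th)) (gamma (N + 1 - th)) (gamma (N + 1)) (K n.+1 (2 * th)) (K n.+1 0) (K n 0) (K 0%N 0) (K n (2 * th)) (gamma (1 + th) * _ * _).
move=> a b c k kk k0' k00 kn X e1 e2 IH.
transitivity ((N + 1) / 2 * (2 * (N + 1) - 1) * (a * b * kn * k00)); last rewrite IH.
  by transitivity ((N + 1 + th) * (N + 1 - th) * k * (a * b * k00)); [ring|rewrite e1; ring].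
by transitivity (X * (c ^+ 2 * ((N + 1) ^+ 2 * kk))); [rewrite e2; ring|ring].
Qed.

(** In [gK], log-convexity bounds the quotient of Gamma values from below by one, and [K_lower] the
    quotient of moments by one minus a term of order [1 / n]. Both errors point the same way and
    leave this inequality. *)
Let gamma_reflection0 th : 0 < th -> th < 1 ->
  K 0%N 0 <= gamma (1 + th) * gamma (1 - th) * K 0%N (2 * th).
Proof.
move=> h0 h1; rewrite -subr_le0.
apply: (natmul_bounded_le0 (K := 2 * th ^+ 2 * K 0%N 0)) => -[//|n] _.
have := gK n.+1 h0 h1; set X := gamma (1 + th) * _ * _.
set N : R := n.+1%:R.
have N1 : 1 <= N by rewrite ler1n.
have th2 : 0 <= 2 * th by rewrite mulr_ge0// ltW.
have := K_lower n th2; rewrite -/N => kl e.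
have lc : gamma (N + 1) * gamma (N + 1) <= gamma (N + 1 - th) * gamma (N + 1 + th).
  have := @gamma_log_convex R (N + 1 - th) th th; rewrite subrK; apply => //; [lra|exact: ltW].
have k0 := K0_gt0 n.+1; have k00 := K0_gt0 0.
have g0 : 0 < gamma (N + 1) by apply: gamma_gt0; lra.
have gp : 0 < gamma (N + 1 - th) by apply: gamma_gt0; lra.
have gq : 0 < gamma (N + 1 + th) by apply: gamma_gt0; lra.
have D0 : 0 < 2 * N - 1 by lra.
(* A factor of [K_lower] that is not positive cannot be multiplied with the Gamma inequality. In
   that case [N <= 2 N - 1 <= 2 th ^ 2], and [X >= 0] suffices. *)
have [neg|pos] := leP (1 - (2 * th) ^+ 2 / 2 / (2 * N - 1)) 0.
  have hN : 2 * N - 1 <= 2 * th ^+ 2.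
    move: neg; rewrite subr_le0 ler_pdivlMr// mul1r exprMn; lra.
  have X0 : 0 <= X.
    rewrite /X !mulr_ge0// ?(ltW (gamma_gt0 _))//; [lra|lra|].
    have := K0b (b := 2 * th); rewrite mulf_neq0 ?gt_eqF// => /(_ isT) e0.
    have : 0 <= 2 * th * K 0%N (2 * th).
      rewrite e0 sin_ge0_pi// mulr_ge0 ?(ltW pihalf_gt0)//=.
      have := pi_gt0 R; nra.
    by rewrite pmulr_rge0// mulr_gt0.
  have : N * (K 0%N 0 - X) <= N * K 0%N 0 by rewrite ler_pM2l; lra.
  move/le_trans; apply; rewrite ler_pM2r//; lra.
have step : gamma (N + 1) ^+ 2 * K n.+1 0 * ((1 - (2 * th) ^+ 2 / 2 / (2 * N - 1)) * K 0%N 0) <= gamma (N + 1) ^+ 2 * K n.+1 0 * X.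
  rewrite [leRHS]mulrC -e.
  have -> : gamma (N + 1) ^+ 2 * K n.+1 0 * ((1 - (2 * th) ^+ 2 / 2 / (2 * N - 1)) * K 0%N 0) =
    (gamma (N + 1) * gamma (N + 1)) * (K n.+1 0 * (1 - (2 * th) ^+ 2 / 2 / (2 * N - 1))) * K 0%N 0 by ring.
  rewrite ler_pM2r//; apply: ler_pM => //.
  - by apply/ltW; rewrite mulr_gt0.
  - by apply/ltW; rewrite mulr_gt0.
  - by rewrite [leRHS]mulrC.
have {step} : (1 - (2 * th) ^+ 2 / 2 / (2 * N - 1)) * K 0%N 0 <= X.
  by move: step; rewrite ler_pM2l// mulr_gt0// exprn_gt0.
rewrite mulrBl mul1r lerBlDr -lerBlDl => hh.
have : N * (K 0%N 0 - X) <= N * ((2 * th) ^+ 2 / 2 / (2 * N - 1) * K 0%N 0) by rewrite ler_pM2l//; lra.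
move/le_trans; apply; rewrite mulrA ler_pM2r//.
rewrite mulrA ler_pdivrMr// exprMn.
have : 0 <= th ^+ 2 by rewrite exprn_ge0// ltW.
nra.
Qed.

Lemma gamma_reflection_ge th : 0 < th -> th < 1 ->
  (pi : R) <= gamma th * gamma (1 - th) * sin (pi * th).
Proof.
move=> h0 h1; have := gamma_reflection0 h0 h1.
rewrite K00 [1 + th]addrC gammaS//.
have := K0b (b := 2 * th); rewrite mulf_neq0 ?gt_eqF// => /(_ isT).
have -> : 2 * th * (pi / 2) = pi * th by field.
move=> <-; rewrite ler_pdivrMr//; move/le_trans; apply.
by rewrite le_eqVlt; apply/orP; left; apply/eqP; ring.
Qed.

(** The opposite direction, at [th = 1/2]: in [gK] the moments are now compared by [cos t <= 1], and
    the Gamma values by [gamma (N + 1/2) ^ 2 <= gamma N * gamma (N + 1)]. *)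
Lemma gamma_half_le : gamma (2^-1 : R) ^+ 2 <= pi.
Proof.
have hf : 0 < 2^-1 :> R by rewrite invr_gt0.
have hf1 : 2^-1 < 1 :> R by rewrite invf_lt1// ltr1n.
rewrite -subr_le0.
apply: (natmul_bounded_le0 (K := pi / 2)) => -[//|n] _.
have := gK n.+1 hf hf1; set N : R := n.+1%:R.
have N1 : 1 <= N by rewrite ler1n.
rewrite mulfV//.
have -> : K 0%N 1 = 1.
  by have := @K0b 1 (oner_neq0 _); rewrite !mul1r sin_pihalf.
rewrite [1 + 2^-1]addrC gammaS// (_ : 1 - 2^-1 = 2^-1 :> R); last by field.
have -> : N + 1 - 2^-1 = N + 2^-1 by field.
have -> : N + 1 + 2^-1 = N + 2^-1 + 1 by ring.
have N2 : 0 < N + 2^-1 by lra.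
have N0 : 0 < N by lra.
rewrite (gammaS N2) (gammaS N0) K00 => e.
have k1 : K n.+1 1 <= K n.+1 0.
  apply: le_Rintegral => //; [exact: intK..|].
  move=> t /=; rewrite in_itv /= => /andP[t0 t1].
  have c0 : 0 <= cos t by rewrite cos_ge0_pihalf// t1 (le_trans _ t0)// oppr_le0 ltW// pihalf_gt0.
  by rewrite ler_wpM2l ?exprn_ge0// mul0r cos0 cos_le1.
have lc : gamma (N + 2^-1) * gamma (N + 2^-1) <= gamma N * (N * gamma N).
  have := @gamma_log_convex R N 2^-1 2^-1 N0 hf (ltW hf).
  by rewrite -addrA (_ : 2^-1 + 2^-1 = 1 :> R) ?gammaS//; field.
have k0 := K0_gt0 n.+1.
have g0 : 0 < gamma N by exact: gamma_gt0.
have gp : 0 < gamma (N + 2^-1) by exact: gamma_gt0.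
have p0 := pi_gt0 R.
have : (2^-1 * gamma 2^-1 ^+ 2 * N) * (N * gamma N ^+ 2 * K n.+1 0) <= (N + 2^-1) * (pi / 2) * (N * gamma N ^+ 2 * K n.+1 0).
  have -> : (2^-1 * gamma 2^-1 ^+ 2 * N) * (N * gamma N ^+ 2 * K n.+1 0) = 2^-1 * gamma 2^-1 * gamma 2^-1 * 1 * ((N * gamma N) ^+ 2 * K n.+1 0) by ring.
  rewrite -e.
  have -> : (N + 2^-1) * gamma (N + 2^-1) * gamma (N + 2^-1) * K n.+1 1 * (pi / 2) = (N + 2^-1) * (pi / 2) * ((gamma (N + 2^-1) * gamma (N + 2^-1)) * K n.+1 1) by ring.
  rewrite ler_pM2l ?mulr_gt0 ?pihalf_gt0//.
  apply: (@le_trans _ _ ((gamma (N + 2^-1) * gamma (N + 2^-1)) * K n.+1 0)).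
    by rewrite ler_pM2l// mulr_gt0.
  rewrite ler_pM2r//; apply: (le_trans lc); rewrite le_eqVlt; apply/orP; left; apply/eqP; ring.
rewrite ler_pM2r ?mulr_gt0 ?exprn_gt0//; lra.
Qed.

End GammaReflection.

(** * The reciprocal Gamma function *)

Section ReciprocalGamma.
Context {R : realType}.
Implicit Types w z : R.

(* The entire function [1 / Gamma], through [1 / Gamma z = z (z + 1) .. (z + n - 1) / Gamma (z + n)]. *)
Definition rgamma z : R :=
  let n := (Num.truncn `|z|).+1 in (\prod_(i < n) (z + i%:R)) / gamma (z + n%:R).

Let rgamma_shift z n m : (n <= m)%N -> 0 < z + n%:R ->
  (\prod_(i < m) (z + i%:R)) / gamma (z + m%:R) = (\prod_(i < n) (z + i%:R)) / gamma (z + n%:R).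
Proof.
move=> nm zn; elim: m nm => [|m IH]; first by rewrite leqn0 => /eqP ->.
rewrite leq_eqVlt => /predU1P[->//|]; rewrite ltnS => nm.
have zm : 0 < z + m%:R by rewrite (lt_le_trans zn)// lerD2l ler_nat.
rewrite -IH// big_ord_recr/= -[m.+1%:R]natr1 addrA gammaS// invfM mulrACA.
have : z + m%:R != 0 by rewrite gt_eqF.
have : gamma (z + m%:R) != 0 by rewrite gt_eqF// gamma_gt0.
move: (\prod_(i < m) (z + i%:R)) (gamma (z + m%:R)) (z + m%:R) => p g y g0 y0.
by field; rewrite g0 y0.
Qed.

(** Any shift that reaches the positive axis may serve in the definition; the functional equation
    then compares two such shifts. *)
Lemma rgammaE z n : 0 < z + n%:R -> rgamma z = (\prod_(i < n) (z + i%:R)) / gamma (z + n%:R).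
Proof.
move=> zn; rewrite /rgamma; set k := (Num.truncn _).+1.
have zk : 0 < z + k%:R.
  by rewrite -ltrBlDl sub0r (le_lt_trans (ler_norm _))// normrN Num.Theory.truncnS_gt.
by have [nk|/ltnW kn] := leqP n k; [rewrite (rgamma_shift nk)|rewrite -(rgamma_shift kn)].
Qed.

Lemma rgamma_pos z : 0 < z -> rgamma z = (gamma z)^-1.
Proof. by move=> z0; rewrite (@rgammaE z 0) ?big_ord0 ?mul1r ?addr0. Qed.

Lemma rgammaS z : rgamma z = z * rgamma (z + 1).
Proof.
have [n zn] : exists n : nat, 0 < z + 1 + n%:R.
  exists (Num.truncn `|z|); rewrite -addrA [1 + _]addrC natr1 -ltrBlDl sub0r.
  by rewrite (le_lt_trans (ler_norm _))// normrN Num.Theory.truncnS_gt.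
have e i : z + 1 + i%:R = z + i.+1%:R by rewrite -[i.+1%:R]natr1; ring.
rewrite (rgammaE zn) (@rgammaE z n.+1) -?e// big_ord_recl /= addr0 mulrA.
by congr (_ * _ / _); apply: eq_bigr => i _; rewrite e.
Qed.

(* The half of the reflection formula [1 / Gamma (1 - w) = Gamma w sin (pi w) / pi]
   that bounds the values at [-1] of the fractional integrals of Legendre
   polynomials. *)
Lemma rgamma_reflection_le w : 0 < w -> `|rgamma (1 - w)| <= gamma w * `|sin (pi * w)| / pi.
Proof.
have p0 := pi_gt0 R.
have base x : 0 < x -> x <= 1 -> `|rgamma (1 - x)| <= gamma x * `|sin (pi * x)| / pi.
  move=> x0; rewrite le_eqVlt => /predU1P[->|x1].
    by rewrite subrr rgammaS mul0r normr0 mulr1 sinpi normr0 mulr0 mul0r.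
  have x10 : 0 < 1 - x by rewrite subr_gt0.
  rewrite rgamma_pos// ger0_norm ?invr_ge0 ?(ltW (gamma_gt0 x10))//.
  have h := gamma_reflection_ge x0 x1.
  have s0 : 0 <= sin (pi * x).
    by rewrite sin_ge0_pi// mulr_ge0 ?(ltW p0) ?(ltW x0)//= ger_pMr// ltW.
  rewrite ger0_norm// ler_pdivlMr// mulrC ler_pdivrMr ?gamma_gt0//.
  by rewrite mulrAC.
suff H n : forall x, 0 < x -> x <= n.+1%:R -> `|rgamma (1 - x)| <= gamma x * `|sin (pi * x)| / pi.
  by move=> w0; apply: (H (Num.truncn w)) => //; rewrite ltW// Num.Theory.truncnS_gt.
elim: n => [|n IH] x x0 xn; first exact: base.
have [x1|x1] := leP x 1; first exact: base.
have y0 : 0 < x - 1 by rewrite subr_gt0.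
have yn : x - 1 <= n.+1%:R by rewrite lerBlDr natr1.
have {}IH := IH _ y0 yn.
rewrite rgammaS (_ : 1 - x + 1 = 1 - (x - 1)); last by ring.
have -> : pi * x = pi * (x - 1) + pi by ring.
have -> : gamma x = (x - 1) * gamma (x - 1) by rewrite -gammaS// subrK.
rewrite sinDpi normrN normrM distrC (ger0_norm (ltW y0)).
by rewrite -!mulrA ler_pM2l// !mulrA.
Qed.

End ReciprocalGamma.

(** * Legendre polynomials and their fractional integrals *)

Section Legendre.
Context {R : realType}.
Implicit Types (n : nat) (x : R).
Local Notation P := (@legendre R).
Local Notation leb := (@lebesgue_measure R).

Let hE := (hornerXn, horner_exp, hornerD, hornerN, hornerM, hornerMn, hornerX, hornerC).

Let derivnMX n (p : {poly R}) : derivn n.+1 ('X * p) = 'X * derivn n.+1 p + derivn n p *+ n.+1.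
Proof.
elim: n => [|n IH]; first by rewrite /derivn /= derivM derivX mul1r addrC.
rewrite derivnS IH derivD derivM derivX mul1r derivMn -!derivnS.
by rewrite [in RHS]mulrS; ring.
Qed.

Let w n : {poly R} := ('X ^+ 2 - 1) ^+ n.
Let c n : R := (2 ^+ n * n`!%:R)^-1.

Let PE n : P n = c n *: derivn n (w n). Proof. by []. Qed.

Let dw n : (w n.+1)^`() = 'X * w n *+ (2 * n.+1).
Proof.
rewrite /w deriv_exp derivB derivXn derivC subr0 /=; ring.
Qed.

Let cS n : c n = (2 * n.+1)%:R * c n.+1.
Proof.
rewrite /c factS exprS !natrM.
have : 2 ^+ n != 0 :> R by rewrite expf_neq0// pnatr_eq0.
have : n`!%:R != 0 :> R by rewrite pnatr_eq0 -lt0n fact_gt0.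
have : n.+1%:R != 0 :> R by rewrite pnatr_eq0.
by move: (2 ^+ n) (n`!%:R) (n.+1%:R) => a b d h1 h2 h3; field; rewrite h1 h2 h3.
Qed.

Lemma legendre0 : P 0 = 1.
Proof. by rewrite PE /c /w expr0 derivn0 expr0 fact0 mulr1 invr1 scale1r. Qed.

(** One derivative is taken inside Rodrigues' formula, where [w n.+1] differentiates to
    [2 (n + 1) X w n]; Leibniz' rule for the factor [X] produces the two terms. *)
Lemma legendre_derivS n : (P n.+1)^`() = 'X * (P n)^`() + P n *+ n.+1.
Proof.
transitivity (c n.+1 *: (('X * derivn n.+1 (w n) + derivn n (w n) *+ n.+1) *+ (2 * n.+1))).
  by rewrite PE derivZ -derivnS derivSn dw derivnMn derivnMX.
rewrite -scaler_nat scalerA [c _ * _]mulrC -cS scalerDr !PE derivZ -derivnS.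
by rewrite scalerAr scalerMnr.
Qed.

(** Two derivatives inside Rodrigues' formula, with [X^2 = (X^2 - 1) + 1]. The other recurrences,
    the differential equation and the values at [1] and [-1] follow from this relation and
    [legendre_derivS] by elimination. *)
Lemma legendre_derivSS n : (P n.+2)^`() = (P n)^`() + P n.+1 *+ (2 * n + 3).
Proof.
have d2 : (w n.+2)^`()^`() = (w n.+1 *+ (2 * n + 3) + w n *+ (2 * n.+1)) *+ (2 * n.+2).
  rewrite dw derivMn derivM derivX mul1r dw; congr (_ *+ _).
  by rewrite /w !exprS; ring.
transitivity (c n.+2 *: ((derivn n.+1 (w n.+1) *+ (2 * n + 3) + derivn n.+1 (w n) *+ (2 * n.+1)) *+ (2 * n.+2))).
  by rewrite PE derivZ -derivnS derivSn derivSn d2 derivnMn derivnD !derivnMn.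
rewrite -scaler_nat scalerA [c _ * _]mulrC -cS scalerDr addrC.
congr (_ + _); last by rewrite PE scalerMnr.
by rewrite -scaler_nat scalerA [c _ * _]mulrC -cS PE derivZ -derivnS.
Qed.

Lemma legendre_derivX n : 'X * (P n.+1)^`() = (P n)^`() + P n.+1 *+ n.+1.
Proof.
have := legendre_derivSS n; rewrite legendre_derivS => e.
apply: (addIr (P n.+1 *+ n.+2)); rewrite e; ring.
Qed.

Lemma legendre_deriv_sqr n : (1 - 'X ^+ 2) * (P n.+1)^`() = (P n - 'X * P n.+1) *+ n.+1.
Proof.
have -> : (1 - 'X ^+ 2) * (P n.+1)^`() = (P n.+1)^`() - 'X * ('X * (P n.+1)^`()) by ring.
by rewrite legendre_derivX legendre_derivS; ring.
Qed.

Lemma legendre_ode n : ((1 - 'X ^+ 2) * (P n)^`())^`() = - (P n *+ (n * n.+1)).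
Proof.
case: n => [|n]; first by rewrite legendre0 derivC mulr0 derivC mul0n mulr0n oppr0.
rewrite legendre_deriv_sqr derivMn derivB derivM derivX mul1r legendre_derivX; ring.
Qed.

Lemma legendre_ode2 n : (1 - 'X ^+ 2) * (P n)^`()^`() = 'X * (P n)^`() *+ 2 - P n *+ (n * n.+1).
Proof.
have := legendre_ode n; rewrite derivM derivB derivC derivXn sub0r /= => e.
have -> : (1 - 'X ^+ 2) * (P n)^`()^`() = - ('X *+ 2) * (P n)^`() + (1 - 'X ^+ 2) * (P n)^`()^`() + 'X * (P n)^`() *+ 2 by ring.
rewrite e; ring.
Qed.

Lemma legendre1 : P 1 = 'X.
Proof.
rewrite PE derivn1 dw /w expr0 mulr1 /c (_ : 1`! = 1)%N// expr1 mulr1 muln1 -scalerMnr scalerMnl.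
by rewrite -mulr_natr mulVf ?scale1r// pnatr_eq0.
Qed.

Lemma legendre_bonnet n : P n.+2 *+ n.+2 = 'X * P n.+1 *+ (2 * n + 3) - P n *+ n.+1.
Proof.
(* Multiplied by [X], the identity becomes a combination of the formulas for [(1 - X^2) P'];
   polynomials form an integral domain, so [X] cancels. *)
apply: (@mulfI _ 'X); first by rewrite polyX_eq0.
have e1 := legendre_deriv_sqr n.+1.
have e2 : (1 - 'X ^+ 2) * (P n.+2)^`() = 'X * ((P n - 'X * P n.+1) *+ n.+1) + (1 - 'X ^+ 2) * P n.+1 *+ n.+2.
  by rewrite legendre_derivS -legendre_deriv_sqr; ring.
have -> : 'X * (P n.+2 *+ n.+2) = P n.+1 *+ n.+2 - (P n.+1 - 'X * P n.+2) *+ n.+2 by ring.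
rewrite -e1 e2; ring.
Qed.

Lemma legendre_at1 n : (P n).[1] = 1.
Proof.
elim: n => [|n IH]; first by rewrite legendre0 hornerC.
have := congr1 (fun p => p.[1]) (legendre_deriv_sqr n).
rewrite !hE IH expr1n subrr mul0r => /esym/eqP.
by rewrite mulrn_eq0 /= mul1r subr_eq0 => /eqP <-.
Qed.

Lemma legendre_atN1 n : (P n).[-1] = (-1) ^+ n.
Proof.
elim: n => [|n IH]; first by rewrite legendre0 hornerC.
have := congr1 (fun p => p.[-1]) (legendre_deriv_sqr n).
rewrite !hE IH sqrrN expr1n subrr mul0r => /esym/eqP.
by rewrite mulrn_eq0 /= mulN1r opprK addrC addr_eq0 exprS mulN1r => /eqP.
Qed.

(* Sonin's argument: [n (n + 1) P^2 + (1 - x^2) P'^2] has derivative [2 x P'^2]. *)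
Lemma legendre_le1 n x : -1 <= x -> x <= 1 -> `|(P n).[x]| <= 1.
Proof.
move=> x0 x1; case: n => [|n]; first by rewrite legendre0 hornerC normr1.
pose S := P n.+1 ^+ 2 *+ (n.+1 * n.+2) + (1 - 'X ^+ 2) * (P n.+1)^`() ^+ 2.
have dS : S^`() = 'X * (P n.+1)^`() ^+ 2 *+ 2.
  rewrite /S derivD derivMn deriv_exp derivM derivB derivC derivXn sub0r deriv_exp /= !expr1.
  have -> : (1 - 'X ^+ 2) * ((P n.+1)^`()^`() * (P n.+1)^`() *+ 2) = ((1 - 'X ^+ 2) * (P n.+1)^`()^`()) * (P n.+1)^`() *+ 2 by ring.
  rewrite legendre_ode2; ring.
have dSx (y : R) : is_derive y 1 (horner S) (y * (P n.+1)^`().[y] ^+ 2 *+ 2).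
  by apply: is_derive_eq (is_derive_poly S y) _; rewrite dS !hE.
have cS' (a b : R) : {within `[a, b], continuous (horner S)} by exact: is_derive_within dSx.
have Sval y : S.[y] = (P n.+1).[y] ^+ 2 *+ (n.+1 * n.+2) + (1 - y ^+ 2) * (P n.+1)^`().[y] ^+ 2.
  by rewrite /S hornerD hornerMn horner_exp hornerM horner_exp hornerD hornerN hornerC hornerXn.
have S1 : S.[1] = (n.+1 * n.+2)%:R.
  by rewrite Sval legendre_at1 !expr1n subrr mul0r addr0.
have SN1 : S.[-1] = (n.+1 * n.+2)%:R.
  have -> : S.[-1] = ((-1) ^+ n.+1) ^+ 2 *+ (n.+1 * n.+2).
    by rewrite (Sval (-1)) (legendre_atN1 n.+1) sqrrN expr1n subrr mul0r addr0.
  by rewrite sqrr_sign.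
have Sx : S.[x] <= (n.+1 * n.+2)%:R.
  have [p0|n0] := leP 0 x.
    rewrite -S1; apply: derive_ge0_le x1 (cS' _ _) (fun y _ => dSx y) _ => y.
    rewrite in_itv /= => /andP[xy _].
    by rewrite mulrn_wge0// mulr_ge0 ?sqr_ge0// (le_trans p0)// ltW.
  rewrite -SN1 -lerN2.
  have := @derive_ge0_le _ (fun y => - S.[y]) (fun y => - (y * (P n.+1)^`().[y] ^+ 2 *+ 2)) _ _ x0.
  apply; first by apply: (is_derive_within (fun y => deriveN1 (dSx y))).
  move=> y; rewrite in_itv /= => /andP[_ yx].
  by rewrite oppr_ge0 mulrn_wle0// mulr_le0_ge0 ?sqr_ge0// ltW// (lt_trans yx).
have : (P n.+1).[x] ^+ 2 *+ (n.+1 * n.+2) <= 1 *+ (n.+1 * n.+2).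
  apply: le_trans Sx; rewrite Sval lerDl.
  rewrite mulr_ge0 ?sqr_ge0// subr_ge0.
  by rewrite -[leRHS](expr1n _ 2) -[leLHS]real_normK ?num_real// ler_pXn2r ?nnegrE// ler_norml x0.
rewrite ler_pMn2r// -[X in X <= 1]real_normK ?num_real// => h.
by rewrite -(@ler_pXn2r _ 2) ?nnegrE// expr1n.
Qed.

Definition poly_integral (p : {poly R}) : R := \int[leb]_(x in `]-1, 1[) p.[x].

Lemma poly_cc_integrable (p : {poly R}) a b : leb.-integrable `[a, b] (EFin \o horner p).
Proof.
apply: continuous_compact_integrable; first exact: segment_compact.
exact: is_derive_within (is_derive_poly p).
Qed.

Lemma poly_integrable (p : {poly R}) : leb.-integrable `]-1, 1[ (EFin \o horner p).
Proof.
apply: (integrableS _ _ _ (poly_cc_integrable p (-1) 1)) => //.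
exact: subset_itv_oo_cc.
Qed.

Lemma poly_integralD p q : poly_integral (p + q) = poly_integral p + poly_integral q.
Proof.
rewrite /poly_integral -RintegralD//; [|exact: poly_integrable..].
by apply: eq_Rintegral => x _; rewrite hornerD.
Qed.

Lemma poly_integralZ a p : poly_integral (a *: p) = a * poly_integral p.
Proof.
rewrite /poly_integral -RintegralZl//; last exact: poly_integrable.
by apply: eq_Rintegral => x _; rewrite hornerZ.
Qed.

Lemma poly_integral_deriv (p : {poly R}) : poly_integral p^`() = p.[1] - p.[-1].
Proof.
rewrite /poly_integral Rintegral_itv_bndo_bndc; last first.
  exact: poly_integrable.
rewrite Rintegral_itv_obnd_cbnd; last first.
  by apply: (integrableS _ _ _ (poly_cc_integrable _ (-1) 1)) => //; exact: subset_itv_oc_cc.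
apply: Rintegral_FTC.
- lra.
- exact: is_derive_within (is_derive_poly _).
- exact: is_derive_within (is_derive_poly _).
Qed.

(** Sturm-Liouville argument: the Wronskian [W] weighted by [1 - X^2] vanishes at both ends, and its
    derivative is [m (m + 1) - n (n + 1)] times the product. *)
Lemma legendre_orth n m : n != m -> poly_integral (P n * P m) = 0.
Proof.
move=> nm.
pose W := (1 - 'X ^+ 2) * (P n)^`() * P m - (1 - 'X ^+ 2) * (P m)^`() * P n.
have dW : W^`() = (m * m.+1)%:R *: (P n * P m) - (n * n.+1)%:R *: (P n * P m).
  rewrite /W derivB [in LHS]derivM [X in _ - X]derivM !legendre_ode !scaler_nat; ring.
have := poly_integral_deriv W; rewrite dW -scalerBl poly_integralZ.
have -> : W.[1] - W.[-1] = 0.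
  by rewrite /W !hE sqrrN !expr1n subrr !mul0r subrr.
move/eqP; rewrite mulf_eq0 => /orP[|/eqP //].
rewrite subr_eq0 eqr_nat => /eqP e; exfalso; move/eqP: nm; apply.
have [nm'|mn'|//] := ltngtP n m; [|].
  by have := ltn_mul nm' (nm' : (n.+1 < m.+1)%N); rewrite e ltnn.
by have := ltn_mul mn' (mn' : (m.+1 < n.+1)%N); rewrite e ltnn.
Qed.

(** The induction carries two consecutive degrees because [legendre_derivSS] descends by two. *)
Let orth_deriv n m : (n <= m)%N -> poly_integral ((P n)^`() * P m) = 0 /\ poly_integral ((P n.-1)^`() * P m) = 0.
Proof.
elim: n => [_|n IH nm].
  rewrite legendre0 derivC mul0r; split; by rewrite -(scale0r 0) poly_integralZ mul0r.
have [e1 e2] := IH (ltnW nm); split => //.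
case: n nm e1 e2 {IH} => [nm _ _|n nm e1 e2].
  rewrite legendre1 derivX -legendre0; apply: legendre_orth; by case: m nm.
rewrite legendre_derivSS mulrDl poly_integralD e2 add0r -scaler_nat -scalerAl poly_integralZ.
by rewrite legendre_orth ?mulr0// ltn_eqF.
Qed.

(** The integral of [(X P^2)'] is [2]. Expanding [X P'] by [legendre_derivX] leaves [P_n'],
    orthogonal to [P_(n+1)], and a multiple of [P_(n+1)] itself. *)
Lemma legendre_norm n : poly_integral (P n ^+ 2) = 2 / (2 * n%:R + 1).
Proof.
case: n => [|n].
  rewrite legendre0 expr1n -(derivX R) poly_integral_deriv !hornerX.
  by rewrite mulr0 add0r opprK divr1.
have := poly_integral_deriv ('X * P n.+1 ^+ 2).
rewrite derivM derivX mul1r !hE legendre_at1 legendre_atN1 deriv_exp /= expr1.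
have -> : P n.+1 ^+ 2 + 'X * ((P n.+1)^`() * P n.+1 *+ 2) =
   P n.+1 ^+ 2 + 2%:R *: (('X * (P n.+1)^`()) * P n.+1) by rewrite scaler_nat; ring.
have -> : P n.+1 ^+ 2 + 2%:R *: ('X * (P n.+1)^`() * P n.+1) =
   P n.+1 ^+ 2 + (2%:R *: ((P n)^`() * P n.+1) + (2 * n.+1)%:R *: (P n.+1 ^+ 2)).
  by rewrite legendre_derivX !scaler_nat; ring.
rewrite !(poly_integralD, poly_integralZ) (orth_deriv (leqnSn n)).1 natrM.
rewrite -exprM mulnC exprM sqrrN !expr1n mulr0 add0r.
move=> e; apply: (mulIf (x := 2 * n.+1%:R + 1)).
  by rewrite gt_eqF// ltr_wpDl// mulr_ge0.
rewrite divfK; last by rewrite gt_eqF// ltr_wpDl// mulr_ge0.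
transitivity (poly_integral (P n.+1 ^+ 2) + 2 * n.+1%:R * poly_integral (P n.+1 ^+ 2)); first by ring.
by rewrite e; ring.
Qed.

End Legendre.

(** * Fractional integrals of polynomials *)

Section FractionalIntegralOfPolynomials.
Context {R : realType}.
Implicit Types (s x y : R) (p q : {poly R}).
Local Notation leb := (@lebesgue_measure R).

(** Since [x -> 1 - x] is an involution, these are the coefficients of [p] in powers of [1 - X]. *)
Definition tcoef p (j : nat) : R := (p \Po (1 - 'X))`_j.

(* The right-sided fractional integral of order [s > -1] of a polynomial, based
   at [1] and extended by [0] beyond [1], written out on powers of [1 - X]. *)
Definition rint s p x : R :=
  \sum_(j < size (p \Po (1 - 'X))) tcoef p j * j`!%:R / gamma (j%:R + s + 1) * ppow (j%:R + s) (1 - x).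

Lemma rintE s p x m : (size (p \Po (1 - 'X)%R) <= m)%N ->
  rint s p x = \sum_(j < m) tcoef p j * j`!%:R / gamma (j%:R + s + 1) * ppow (j%:R + s) (1 - x).
Proof.
move=> pm; rewrite /rint (big_ord_widen m (fun j => tcoef p j * j`!%:R / gamma (j%:R + s + 1) * ppow (j%:R + s) (1 - x)))//.
rewrite big_mkcond/=; apply: eq_bigr => j _; case: ltnP => // pj.
by rewrite /tcoef nth_default// !mul0r.
Qed.

Lemma tcoefD p q j : tcoef (p + q) j = tcoef p j + tcoef q j.
Proof. by rewrite /tcoef comp_polyD coefD. Qed.

Lemma tcoefZ a p j : tcoef (a *: p) j = a * tcoef p j.
Proof. by rewrite /tcoef comp_polyZ coefZ. Qed.

Lemma rintD s p q x : rint s (p + q) x = rint s p x + rint s q x.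
Proof.
pose m := maxn (size ((p + q) \Po (1 - 'X))) (maxn (size (p \Po (1 - 'X))) (size (q \Po (1 - 'X)))).
rewrite (@rintE s (p + q) x m) ?leq_maxl// (@rintE s p x m); last first.
  by rewrite (leq_trans _ (leq_maxr _ _))// leq_maxl.
rewrite (@rintE s q x m); last by rewrite (leq_trans _ (leq_maxr _ _))// leq_maxr.
by rewrite -big_split/=; apply: eq_bigr => j _; rewrite tcoefD; ring.
Qed.

Lemma rintZ s a p x : rint s (a *: p) x = a * rint s p x.
Proof.
pose m := maxn (size ((a *: p) \Po (1 - 'X))) (size (p \Po (1 - 'X))).
rewrite (@rintE s (a *: p) x m) ?leq_maxl// (@rintE s p x m) ?leq_maxr//.
by rewrite big_distrr/=; apply: eq_bigr => j _; rewrite tcoefZ; ring.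
Qed.

Lemma rintMn s p x n : rint s (p *+ n) x = rint s p x *+ n.
Proof. by rewrite -scaler_nat rintZ mulr_natl. Qed.

Lemma horner_tcoef p x : p.[x] = \sum_(j < size (p \Po (1 - 'X))) tcoef p j * (1 - x) ^+ j.
Proof.
rewrite /tcoef -horner_coef horner_comp !hornerE; congr (p.[_]); ring.
Qed.

Lemma rint0 p x : x < 1 -> rint 0 p x = p.[x].
Proof.
move=> x1; have x10 : 0 < 1 - x by rewrite subr_gt0.
rewrite horner_tcoef; apply: eq_bigr => j _.
rewrite ppow_gt0E// addr0 powR_mulrn ?(ltW x10)//.
have -> : gamma (j%:R + 1) = j`!%:R :> R.
  elim: (nat_of_ord j) => [|k IH]; first by rewrite add0r gamma1.
  by rewrite -[k.+1%:R]natr1 gammaS ?IH ?factS ?natrM ?natr1// ltr_wpDl.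
by rewrite mulfK// pnatr_eq0 -lt0n fact_gt0.
Qed.

Lemma rint_ge1 s p x : 1 <= x -> rint s p x = 0.
Proof. by move=> x1; rewrite /rint big1// => j _; rewrite ppow_le0E ?mulr0// subr_le0. Qed.

Lemma derive_ppow s x : x < 1 ->
  is_derive x 1 (fun t => ppow s (1 - t)) (- (s * ppow (s - 1) (1 - x))).
Proof.
move=> x1; have x10 : 0 < 1 - x by rewrite subr_gt0.
apply: (@is_derive1_near_eq _ (fun t => (1 - t) `^ s)).
  near=> t; rewrite ppow_gt0E// subr_gt0; near: t.
  by first [exact: lt_nbhsl | exact: nbhs_left_lt | exact: (cvgr_lt x) | exact: (open_lt 1)].
have d1 : is_derive x 1 (fun t : R => 1 - t) (-1).
  by rewrite -[X in is_derive _ _ _ X]sub0r; apply: deriveB1.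
have := @derive_comp1 _ _ (fun t => 1 - t) _ _ _ (is_derive1_powR s x10) d1.
by rewrite ppow_gt0E// mulrN1.
Unshelve. all: by end_near. Qed.

Lemma derive_rint s p x : -1 < s -> x < 1 -> is_derive x 1 (rint (s + 1) p) (- rint s p x).
Proof.
move=> s1 x1; rewrite /rint -sumrN; apply: derive_sum1 => j.
have js : 0 < j%:R + s + 1 by rewrite -addrA ltr_wpDl// -ltrBlDr sub0r.
apply: is_derive_eq (deriveZ1 _ (derive_ppow _ x1)) _.
rewrite addrA gammaS// addrK.
have : gamma (j%:R + s + 1) != 0 by rewrite gt_eqF// gamma_gt0.
have : j%:R + s + 1 != 0 by rewrite gt_eqF.
move: (gamma (j%:R + s + 1)) (ppow (j%:R + s) (1 - x)) (j%:R + s + 1) => g P z z0 g0.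
by field; rewrite g0 z0.
Qed.

Lemma tcoef_deriv p j : tcoef p^`() j = - (j.+1%:R * tcoef p j.+1).
Proof.
have := congr1 (fun q => q`_j) (deriv_comp p (1 - 'X)).
rewrite derivB derivC derivX sub0r mulrN1 coefN coef_deriv => /eqP.
by rewrite eq_sym eqr_oppLR -/(tcoef p^`() j) -/(tcoef p j.+1) => /eqP ->; rewrite mulr_natl.
Qed.

(** Differentiation shifts the expansion in powers of [1 - X] by one index, so the two sums differ
    by the constant term [p.[1]] alone. *)
Lemma rint_deriv s p x : -1 < s -> x < 1 ->
  rint (s + 1) p^`() x = p.[1] / gamma (s + 1) * (1 - x) `^ s - rint s p x.
Proof.
move=> s1 x1; have x10 : 0 < 1 - x by rewrite subr_gt0.
pose m := maxn (size (p^`() \Po (1 - 'X))) (size (p \Po (1 - 'X))).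
rewrite (@rintE _ p^`() x m) ?leq_maxl// (@rintE _ p x m.+1) ?leqW ?leq_maxr//.
rewrite big_ord_recl /= fact0 mulr1 add0r ppow_gt0E//.
have -> : tcoef p 0 = p.[1].
  by rewrite /tcoef -horner_coef0 horner_comp !hornerE; congr (p.[_]); ring.
rewrite opprD addrA subrr add0r -sumrN; apply: eq_bigr => j _.
rewrite tcoef_deriv /bump /= add1n factS natrM -[j.+1%:R]natr1.
have -> : j%:R + 1 + s = j%:R + (s + 1) by ring.
by rewrite -!mulrA; ring.
Qed.

(* Contiguity in the degree: integrate [P_(n+2)' - P_n' = (2n+3) P_(n+1)]. *)
Lemma rint_legendreSS s n x : -1 < s -> x < 1 ->
  rint s (legendre n.+2) x = rint s (legendre n) x - (2 * n + 3)%:R * rint (s + 1) (legendre n.+1) x.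
Proof.
move=> s1 x1; have := rint_deriv (legendre n.+2) s1 x1.
rewrite legendre_derivSS rintD rintMn rint_deriv// !legendre_at1 -mulr_natl => e.
apply: oppr_inj; apply: (addrI (1 / gamma (s + 1) * (1 - x) `^ s)).
by rewrite -e; ring.
Qed.

Lemma rint_legendre0 s x : x < 1 -> rint s (legendre 0) x = (1 - x) `^ s / gamma (s + 1).
Proof.
move=> x1; have x10 : 0 < 1 - x by rewrite subr_gt0.
rewrite legendre0 (@rintE _ _ _ 1); last by rewrite comp_polyC size_polyC leq_b1.
rewrite big_ord1 /tcoef comp_polyC coefC /= fact0 !mul1r add0r ppow_gt0E//; exact: mulrC.
Qed.

Lemma rint_legendre1 s x : x < 1 ->
  rint s (legendre 1) x = (1 - x) `^ s / gamma (s + 1) - (1 - x) `^ (s + 1) / gamma (s + 2).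
Proof.
move=> x1; have x10 : 0 < 1 - x by rewrite subr_gt0.
rewrite legendre1 (@rintE _ _ _ 2); last first.
  by rewrite comp_polyX -size_polyN opprB size_XsubC.
rewrite 2!big_ord_recl big_ord0 /tcoef comp_polyX !coefB !coefC !coefX /= !fact0 (_ : 1`! = 1)%N//.
rewrite !ppow_gt0E// add0r sub0r subr0 [1 + s]addrC (_ : s + 1 + 1 = s + 2); last by ring.
by rewrite !mul1r addr0 !mulr1 mulrC mulN1r mulNr [_^-1 * _]mulrC.
Qed.

(** Induction on two consecutive degrees along [rint_legendreSS], for all orders at once because
    that relation also raises the order. Written with [rgamma], the formula stays valid where
    [s - n] is a pole of Gamma. *)
Lemma rint_legendre_atN1 n s : 0 < s ->
  rint s (legendre n) (-1) = 2 `^ s * gamma s * rgamma (s + n%:R + 1) * rgamma (s - n%:R).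
Proof.
have N1 : -1 < 1 :> R by lra.
have two : 1 - -1 = 2 :> R by ring.
suff H : forall s, 0 < s -> rint s (legendre n) (-1) = 2 `^ s * gamma s * rgamma (s + n%:R + 1) * rgamma (s - n%:R) /\
   rint s (legendre n.+1) (-1) = 2 `^ s * gamma s * rgamma (s + n.+1%:R + 1) * rgamma (s - n.+1%:R).
  by move=> s0; have [] := H s s0.
elim: n => [|n IH] {}s s0.
  have s10 : 0 < s + 1 by rewrite addr_gt0.
  have s20 : 0 < s + 1 + 1 by rewrite addr_gt0.
  have g0 : gamma s != 0 by rewrite gt_eqF// gamma_gt0.
  have sn : s != 0 by rewrite gt_eqF.
  have sn1 : s + 1 != 0 by rewrite gt_eqF.
  have -> : s + 1%:R = s + 1 by [].
  split.
    rewrite rint_legendre0// two subr0 addr0 (rgamma_pos s0) (rgamma_pos s10).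
    by field; rewrite g0 gt_eqF// gamma_gt0.
  rewrite rint_legendre1// two [rgamma (s - 1)]rgammaS subrK (rgamma_pos s0) (rgamma_pos s20).
  rewrite (_ : s + 2 = s + 1 + 1); last by ring.
  rewrite (gammaS s10) (gammaS s0) (powR_addr s 1)// powRr1//.
  move: (2 `^ s) (gamma s) g0 => a g g0.
  by field; rewrite g0 sn sn1.
have [e1 e2] := IH s s0; split => //.
have s10 : 0 < s + 1 by rewrite addr_gt0.
have [_ e3] := IH (s + 1) s10.
rewrite rint_legendreSS ?(lt_trans _ s0)// ?ltrN10// e1 e3.
rewrite natrD natrM -[n.+2%:R]natr1 -[n.+1%:R]natr1; set N : R := n%:R.
rewrite [rgamma (s + N + 1)]rgammaS [rgamma (s - (N + 1 + 1))]rgammaS.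
rewrite [rgamma (s - (N + 1 + 1) + 1)]rgammaS.
rewrite [rgamma (s + N + 1 + 1)]rgammaS gammaS// (powR_addr s 1)// powRr1//.
have -> : s + 1 + (N + 1) + 1 = s + N + 1 + 1 + 1 by ring.
have -> : s + 1 - (N + 1) = s - N by ring.
have -> : s - (N + 1 + 1) + 1 + 1 = s - N by ring.
have -> : s + (N + 1 + 1) + 1 = s + N + 1 + 1 + 1 by ring.
by ring.
Qed.

(** The same induction. The half arguments come from the base cases, where the duplication formula
    rewrites [gamma s]. *)
Lemma rint_legendre_at0 n s : 0 < s ->
  rint s (legendre n) 0 = gamma 2^-1 * 2 `^ (- s) * rgamma ((s - n%:R + 1) / 2) * rgamma ((s + n%:R) / 2 + 1).
Proof.
have N1 : 0 < 1 :> R by [].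
suff H : forall s, 0 < s -> rint s (legendre n) 0 = gamma 2^-1 * 2 `^ (- s) * rgamma ((s - n%:R + 1) / 2) * rgamma ((s + n%:R) / 2 + 1) /\
   rint s (legendre n.+1) 0 = gamma 2^-1 * 2 `^ (- s) * rgamma ((s - n.+1%:R + 1) / 2) * rgamma ((s + n.+1%:R) / 2 + 1).
  by move=> s0; have [] := H s s0.
elim: n => [|n IH] {}s s0.
  have s10 : 0 < s + 1 by rewrite addr_gt0.
  have sh : 0 < s / 2 by rewrite divr_gt0.
  have sh1 : 0 < (s + 1) / 2 by rewrite divr_gt0.
  have sh2 : 0 < s / 2 + 1 by rewrite addr_gt0.
  have g0 : gamma (s / 2) != 0 by rewrite gt_eqF// gamma_gt0.
  have g1 : gamma ((s + 1) / 2) != 0 by rewrite gt_eqF// gamma_gt0.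
  have g2 : gamma 2^-1 != 0 :> R by rewrite gt_eqF// gamma_gt0// invr_gt0.
  have p0 : 2 `^ s != 0 :> R by rewrite gt_eqF// powR_gt0.
  have sn : s != 0 by rewrite gt_eqF.
  have sn1 : s + 1 != 0 by rewrite gt_eqF.
  have D : gamma s = 2 `^ s * gamma (s / 2) * gamma ((s + 1) / 2) / (2 * gamma 2^-1).
    have := gamma_duplication sh.
    have -> : s / 2 + 2^-1 = (s + 1) / 2 by field.
    have -> : 2 * (s / 2) = s by field.
    by move=> <-; rewrite mulrC mulKf// mulf_neq0.
  split.
    rewrite rint_legendre0// !subr0 addr0 powR1 (rgamma_pos sh1) (rgamma_pos sh2) (gammaS s0) (gammaS sh) powRN D.
    by field; rewrite g0 g1 g2 p0 sn.
  rewrite rint_legendre1// !subr0 !powR1 (_ : (s - 1 + 1) / 2 = s / 2); last by field.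
  have sh3 : 0 < (s + 1) / 2 + 1 by rewrite addr_gt0.
  rewrite (_ : s + 2 = s + 1 + 1); last by ring.
  rewrite (rgamma_pos sh) (rgamma_pos sh3) (gammaS sh1) (gammaS s10) (gammaS s0) powRN D.
  by field; rewrite g0 g1 g2 p0 sn sn1.
have [e1 e2] := IH s s0; split => //.
have s10 : 0 < s + 1 by rewrite addr_gt0.
have [_ e3] := IH (s + 1) s10.
rewrite rint_legendreSS ?(lt_trans _ s0)// ?ltrN10// e1 e3.
rewrite natrD natrM -[n.+2%:R]natr1 -[n.+1%:R]natr1; set N : R := n%:R.
have -> : (s + 1 - (N + 1) + 1) / 2 = (s - N + 1) / 2 by field.
rewrite [rgamma ((s - (N + 1 + 1) + 1) / 2)]rgammaS.
have -> : (s - (N + 1 + 1) + 1) / 2 + 1 = (s - N + 1) / 2 by field.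
have -> : (s + 1 + (N + 1)) / 2 + 1 = (s + N) / 2 + 1 + 1 by field.
have -> : (s + (N + 1 + 1)) / 2 + 1 = (s + N) / 2 + 1 + 1 by field.
rewrite [rgamma ((s + N) / 2 + 1)]rgammaS.
have -> : - (s + 1) = - s + - 1 by ring.
rewrite (powR_addr (- s) (-1))// powR_inv1//.
by field.
Qed.

Lemma ppow_continuous s : 0 < s -> continuous (ppow s : R -> R).
Proof.
move=> s0 x; have [x0|x0|x0] := ltgtP x 0.
- apply: (@cvg_near_cst _ _ _ _ _ _); near=> t; rewrite !ppow_le0E ?(ltW x0)//.
  by apply/ltW; near: t; exact: lt_nbhsl.
- suff h : is_derive x 1 (ppow s) (s * x `^ (s - 1)) by exact: is_derive1_continuous h.
  apply: (is_derive1_near_eq _ (is_derive1_powR s x0)).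
  by near=> t; rewrite ppow_gt0E//; near: t; exact: lt_nbhsr.
- rewrite x0; apply/left_right_continuousP; split; rewrite ppow_le0E//.
    apply: cvg_near_cst; near=> t; rewrite ppow_le0E//.
  apply: cvg_trans (powR_cvg0 s0); apply: near_eq_cvg; near=> t.
  by rewrite ppow_gt0E.
Unshelve. all: by end_near. Qed.

Lemma rint_continuous s p : 0 < s -> continuous (rint s p).
Proof.
move=> s0.
have -> : rint s p = \sum_(j < size (p \Po (1 - 'X))) (fun x => tcoef p j * j`!%:R / gamma (j%:R + s + 1) * ppow (j%:R + s) (1 - x)).
  by apply/funext => x; rewrite fct_sumE.
elim/big_ind: _ => [|f g cf cg x|j _ x]; first exact: cst_continuous.
  exact: cvgD (cf x) (cg x).
 apply: cvgM; first exact: cvg_cst.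
apply: (@continuous_comp _ _ _ (fun x => 1 - x) (ppow (j%:R + s))).
  by apply: cvgB; [exact: cvg_cst|].
by apply: ppow_continuous; rewrite ltr_wpDl.
Qed.

Let ppow_ppow_integrable a b y : 0 < a -> 0 < b ->
  leb.-integrable setT (EFin \o (fun t => ppow (a - 1) (t - y) * ppow (b - 1) (1 - t))).
Proof.
move=> a0 b0; apply/integrableP; split.
  apply/measurable_EFinP; apply: measurable_funM; last exact: measurable_ppow_sub.
  apply: measurableT_comp; first exact: measurable_ppow.
  by apply: measurable_funB => //; exact: measurable_cst.
rewrite (_ : (\int[leb]_x _)%E = (gamma a * gamma b / gamma (a + b) * ppow (a + b - 1) (1 - y))%:E) ?ltry//.
apply: (etrans _ (integral_ppow_ppow 1 y a0 b0)); apply: eq_integral => t _.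
by rewrite /= ger0_norm// mulr_ge0 ?ppow_ge0.
Qed.

(** Power by power this is [integral_ppow_ppow]. Both factors vanish where they should, so an
    integral over []y, 1[] is written over the whole line. *)
Lemma rint_semigroup a b p y : 0 < a -> -1 < b ->
  leb.-integrable setT (EFin \o (fun t => ppow (a - 1) (t - y) * rint b p t)) /\
  \int[leb]_t (ppow (a - 1) (t - y) * rint b p t) = gamma a * rint (a + b) p y.
Proof.
move=> a0 b1.
pose F (j : 'I_(size (p \Po (1 - 'X)))) t : R :=
  (tcoef p j * j`!%:R / gamma (j%:R + b + 1)) * (ppow (a - 1) (t - y) * ppow (j%:R + b + 1 - 1) (1 - t)).
have jb j : 0 < (j : nat)%:R + b + 1 by rewrite -addrA ltr_wpDl// -ltrBlDr sub0r.
have iF j : leb.-integrable setT (EFin \o F j).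
  by apply: integrableZ1 => //; exact: ppow_ppow_integrable.
have -> : (fun t => ppow (a - 1) (t - y) * rint b p t) = (fun t => \sum_j F j t).
  apply/funext => t; rewrite /rint big_distrr/=; apply: eq_bigr => j _.
  by rewrite /F addrK; ring.
have [i e] := integrable_sum1 measurableT iF; split => //.
apply: (etrans e); rewrite /rint big_distrr/=; apply: eq_bigr => j _.
rewrite /F RintegralZl//; last exact: ppow_ppow_integrable.
rewrite /Rintegral integral_ppow_ppow//= (_ : a + (j%:R + b + 1) - 1 = j%:R + (a + b)); last by ring.
rewrite (_ : a + (j%:R + b + 1) = j%:R + (a + b) + 1); last by ring.
have h : gamma (j%:R + b + 1) != 0 by rewrite gt_eqF// gamma_gt0.
move: (gamma (j%:R + b + 1)) h => g h.
move: (gamma (j%:R + (a + b) + 1))^-1 (ppow _ _) => k P.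
by field; rewrite h.
Qed.

(** The coefficients are hypergeometric; their ratio is read off from Legendre's differential
    equation. *)
Lemma tcoef_legendreS n j :
  2 * j.+1%:R ^+ 2 * tcoef (legendre n) j.+1 = (j%:R * j.+1%:R - n%:R * n.+1%:R) * tcoef (legendre n) j.
Proof.
have tM p i : tcoef ((1 - 'X ^+ 2) * p) i.+1 = 2 * tcoef p i - (if i == 0%N then 0 else tcoef p i.-1).
  rewrite /tcoef comp_polyM comp_polyB comp_polyC comp_Xn_poly.
  have -> : (1 - (1 - 'X) ^+ 2) * (p \Po (1 - 'X)) = 'X * ((p \Po (1 - 'X)) *+ 2 - 'X * (p \Po (1 - 'X))) by ring.
  by rewrite coefXM /= coefB coefMn coefXM mulr_natl.
have := congr1 (fun p => tcoef p j) (legendre_ode n).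
have -> : tcoef (- (legendre n *+ (n * n.+1))) j = - ((n * n.+1)%:R * tcoef (legendre n) j).
  rewrite /tcoef; move: (legendre n) => p.
  by rewrite -[p *+ _]scaler_nat raddfN /= comp_polyZ coefN coefZ.
rewrite tcoef_deriv tM !tcoef_deriv natrM.
move: (tcoef (legendre n)) => q.
case: j => [|j] /=; first by rewrite -[1%:R]/(1 : R); lra.
move: (q j.+2) (q j.+1) => u v.
by rewrite -[j.+2%:R]natr1; nra.
Qed.

(** A differential equation for [rint s], whose derivatives are [- rint (s - 1)] and [rint (s - 2)].
    Since [1 - x^2 = z (2 - z)] mixes neighbouring powers of [z = 1 - x], the terms cancel only up
    to a telescoping sum. *)
Lemma rint_legendre_ode n s x : 1 < s -> x < 1 ->
  (1 - x ^+ 2) * rint (s - 2) (legendre n) x =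
  2 * (s - 1) * x * rint (s - 1) (legendre n) x - (n%:R - s + 1) * (n%:R + s) * rint s (legendre n) x.
Proof.
move=> s1 x1; set z := 1 - x; have z0 : 0 < z by rewrite subr_gt0.
have ez : x = 1 - z by rewrite /z; ring.
set m := size (@legendre R n \Po (1 - 'X)).
pose e j := tcoef (legendre n) j * j`!%:R.
pose G j := gamma (j%:R + s - 1).
pose w := z `^ (s - 2).
(* The amount carried from index [j] to its neighbour. It vanishes at [0] through the factor [j],
   and at [m] because the coefficients end there. *)
pose a j := e j * w * z ^+ j.+1 * (2 * j%:R) / (G j * (j%:R + s - 1)).
have js (j : nat) : 0 < j%:R + s - 1 by rewrite -addrA ltr_wpDl// subr_gt0.
have G0 j : G j != 0 by rewrite gt_eqF// gamma_gt0.
have GS (j : nat) : gamma (j%:R + s) = (j%:R + s - 1) * G j.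
  by rewrite /G -gammaS ?subrK// -addrA ltr_wpDl// subr_gt0.
have am : a m = 0 by rewrite /a /e /tcoef nth_default// !mul0r.
have a0 : a 0%N = 0 by rewrite /a mulr0n !mulr0 mul0r.
have tel : \sum_(j < m) (a j.+1 - a j) = 0.
  by rewrite -(big_mkord xpredT (fun j => a j.+1 - a j)) telescope_sumr// am a0 subrr.
apply/eqP; rewrite -subr_eq0; apply/eqP.
rewrite -[RHS]oppr0 -tel -sumrN /rint !big_distrr/= -!sumrB.
apply: eq_bigr => j _.
have jn : (j%:R + s - 1 : R) != 0 by rewrite gt_eqF.
have jn2 : (j%:R + s : R) != 0 by rewrite gt_eqF// (lt_trans (js j))// ltrBlDr ltrDl.
have aS : a j.+1 = e j * w * z ^+ j.+2 * (j%:R * j.+1%:R - n%:R * n.+1%:R) / (G j * (j%:R + s) * (j%:R + s - 1)).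
  have e1 : e j.+1 * (2 * j.+1%:R) = (j%:R * j.+1%:R - n%:R * n.+1%:R) * e j.
    rewrite /e factS natrM [RHS]mulrA -tcoef_legendreS; ring.
  rewrite /a (_ : G j.+1 = (j%:R + s - 1) * G j); last first.
    by rewrite -GS /G -[j.+1%:R]natr1; congr gamma; ring.
  have -> : e j.+1 * w * z ^+ j.+2 * (2 * j.+1%:R) = (e j.+1 * (2 * j.+1%:R)) * (w * z ^+ j.+2) by ring.
  rewrite e1 (_ : j.+1%:R + s - 1 = j%:R + s); last by rewrite -[j.+1%:R]natr1; ring.
  by move: (G j) (G0 j) jn jn2 => g g0 h1 h2; field; rewrite g0 h1 h2.
rewrite aS /a -/(e j).
have -> : gamma (j%:R + (s - 2) + 1) = G j by rewrite /G; congr gamma; ring.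
have -> : gamma (j%:R + (s - 1) + 1) = (j%:R + s - 1) * G j by rewrite -GS; congr gamma; ring.
have -> : gamma (j%:R + s + 1) = (j%:R + s) * ((j%:R + s - 1) * G j).
  by rewrite gammaS ?GS// (lt_trans (js j))// ltrBlDr ltrDl.
rewrite !ppow_gt0E//.
have -> : z `^ (j%:R + (s - 2)) = w * z ^+ j.
  by rewrite powR_addr// powR_mulrn ?(ltW z0)// mulrC.
have -> : z `^ (j%:R + (s - 1)) = w * z ^+ j.+1.
  rewrite (_ : j%:R + (s - 1) = j.+1%:R + (s - 2)); last by rewrite -[j.+1%:R]natr1; ring.
  by rewrite powR_addr// powR_mulrn ?(ltW z0)// mulrC.
have -> : z `^ (j%:R + s) = w * z ^+ j.+2.
  rewrite (_ : j%:R + s = j.+2%:R + (s - 2)); last by rewrite -[j.+2%:R]natr1 -[j.+1%:R]natr1; ring.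
  by rewrite powR_addr// powR_mulrn ?(ltW z0)// mulrC.
rewrite -[j.+1%:R]natr1 -[n.+1%:R]natr1 ez !exprS.
move: (j%:R) (n%:R) (G j) (G0 j) jn jn2 (e j) (z ^+ j) => J N g g0 h1 h2 E Z.
by field; rewrite g0 h1 h2.
Qed.

End FractionalIntegralOfPolynomials.

Ltac sign :=
  repeat first
    [ assumption | apply: ltW; assumption
    | match goal with
      | |- is_true (0 <= _ * _) => apply: mulr_ge0
      | |- is_true (0 < _ * _) => apply: mulr_gt0
      | |- is_true (0 <= _ + _) => apply: addr_ge0
      | |- is_true (0 <= _^-1) => rewrite invr_ge0
      | |- is_true (0 < _^-1) => rewrite invr_gt0
      | |- is_true (0 <= `|_|) => exact: normr_ge0
      | |- is_true (0 <= _ ^+ 2) => exact: sqr_ge0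
      | |- is_true (0 <= _ ^+ _) => apply: exprn_ge0
      | |- is_true (0 < _ ^+ _) => apply: exprn_gt0
      | |- is_true (0 <= _ `^ _) => exact: powR_ge0
      | |- is_true (0 < _ `^ _) => apply: powR_gt0
      | |- is_true (0 <= _%:R) => exact: ler0n
      | |- is_true (0 < _.+1%:R) => exact: ltr0Sn
      | |- is_true (0 <= 1) => exact: ler01
      | |- is_true (0 < 1) => exact: ltr01
      end ].

(** * Uniform bounds by Sonin functions *)

Section SoninBound.
Context {R : realType}.
Implicit Types (s x : R) (n : nat).

(* Sonin's argument: [f = rint s P_n] solves
   [(1 - x^2) f'' + 2 (s - 1) x f' + L f = 0], so that [f^2 + (1 - x^2) f'^2 / L]
   has derivative [- 2 (2 s - 1) x f'^2 / L] and is largest at [0]. *)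
Lemma rint_legendre_sonin n s x : 1 < s -> s < n%:R + 1 -> -1 < x -> x < 1 ->
  rint s (legendre n) x ^+ 2 <= rint s (legendre n) 0 ^+ 2 +
    rint (s - 1) (legendre n) 0 ^+ 2 / ((n%:R - s + 1) * (n%:R + s)).
Proof.
move=> s1 sn x0 x1; set L := (n%:R - s + 1) * (n%:R + s).
have L0 : 0 < L by rewrite mulr_gt0//; [lra|rewrite ltr_wpDl//; lra].
pose f := rint s (legendre n); pose g := rint (s - 1) (legendre n); pose h := rint (s - 2) (legendre n).
pose S (y : R) := f y ^+ 2 + L^-1 * ((1 - y ^+ 2) * g y ^+ 2).
have df (y : R) : y < 1 -> is_derive y 1 f (- g y).
  by move=> y1; have := @derive_rint R (s - 1) (legendre n) y; rewrite subrK; apply => //; lra.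
have dg (y : R) : y < 1 -> is_derive y 1 g (- h y).
  move=> y1; have := @derive_rint R (s - 2) (legendre n) y.
  by rewrite (_ : s - 2 + 1 = s - 1); [apply => //; lra|ring].
have dS (y : R) : y < 1 -> is_derive y 1 S (- (2 * (2 * s - 1) / L * y * g y ^+ 2)).
  move=> y1.
  have d2 : is_derive y 1 (fun t : R => 1 - t ^+ 2) (- (2 * y)).
    apply: is_derive_eq (deriveB1 (deriveC1 y 1) (deriveX1 2 (is_derive_id y 1))) _.
    by rewrite /= expr1; ring.
  apply: is_derive_eq (deriveD1 (deriveX1 2 (df y y1)) (deriveZ1 L^-1 (deriveM1 d2 (deriveX1 2 (dg y y1))))) _.
  have e : (1 - y ^+ 2) * h y = 2 * (s - 1) * y * g y - L * f y by exact: rint_legendre_ode.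
  rewrite /= !expr1.
  have -> : (1 - y ^+ 2) * (2 * g y * - h y) = - (2 * g y * ((1 - y ^+ 2) * h y)) by ring.
  by rewrite e; field; rewrite gt_eqF.
have Sx : f x ^+ 2 <= S x.
  rewrite /S lerDl mulr_ge0 ?invr_ge0 ?(ltW L0)// mulr_ge0 ?sqr_ge0// subr_ge0.
  by rewrite -[leRHS](expr1n _ 2) -[leLHS]real_normK ?num_real// ler_pXn2r ?nnegrE// ler_norml !ltW.
apply: (le_trans Sx).
have -> : rint s (legendre n) 0 ^+ 2 + rint (s - 1) (legendre n) 0 ^+ 2 / L = S 0.
  by rewrite /S expr0n /= subr0 mul1r mulrC.
have cS (a b : R) : b < 1 -> {within `[a, b], continuous S}.
  move=> b1; apply: derivable_within_continuous => y; rewrite in_itv /= => /andP[_ yb].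
  by case: (dS y (le_lt_trans yb b1)).
have sg y : 0 <= 2 * (2 * s - 1) / L * g y ^+ 2.
  by rewrite mulr_ge0 ?sqr_ge0// divr_ge0 ?(ltW L0)// mulr_ge0//; lra.
have [xp|xn] := leP 0 x.
  rewrite -lerN2.
  apply: (@derive_ge0_le _ (fun y => - S y) (fun y => 2 * (2 * s - 1) / L * y * g y ^+ 2) _ _ xp).
  - by move=> y; apply: cvgN; exact: cS.
  - move=> y; rewrite in_itv /= => /andP[_ yx].
    by apply: is_derive_eq (deriveN1 (dS y (lt_trans yx x1))) _; rewrite opprK.
  - move=> y; rewrite in_itv /= => /andP[y0 _].
    by rewrite mulrAC mulr_ge0// ltW.
apply: (@derive_ge0_le _ S (fun y => - (2 * (2 * s - 1) / L * y * g y ^+ 2)) _ _ (ltW xn)).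
- exact: cS.
- by move=> y; rewrite in_itv /= => /andP[_ y0]; apply: dS; rewrite (lt_trans y0).
- move=> y; rewrite in_itv /= => /andP[_ y0].
  by rewrite mulrAC -mulrN mulr_ge0// oppr_ge0 ltW.
Qed.

Lemma gamma_half_bound (y : R) : 0 < y -> gamma (y + 2^-1) ^+ 2 <= y * gamma y ^+ 2.
Proof.
move=> y0; have hf : 0 < 2^-1 :> R by rewrite invr_gt0.
have := gamma_log_convex y0 hf (ltW hf).
rewrite -addrA (_ : 2^-1 + 2^-1 = 1 :> R); last by field.
by rewrite gammaS// mulrCA !expr2.
Qed.

(** By reflection the two values at [0] in [rint_legendre_sonin] carry [|sin (pi w)|] and
    [|cos (pi w)|] with nearly equal amplitudes, so their squares recombine to one, up to a factor
    [(b + 1/2) / b] that the weight [(2 n + 1) / 2] leaves room for. *)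
Lemma rint_legendre_bound n (sg x : R) : 0 < sg -> sg < n%:R -> -1 < x -> x < 1 ->
  (2 * n%:R + 1) / 2 * `|rint (sg + 1) (legendre n) x| <=
  (2 `^ sg * Num.sqrt pi)^-1 * (gamma ((n%:R - sg) / 2) / gamma ((n%:R + sg + 1) / 2)).
Proof.
move=> s0 sn x0 x1.
have p0 := pi_gt0 R.
have sp0 : 0 < Num.sqrt pi :> R by rewrite sqrtr_gt0.
set N : R := n%:R in sn *.
pose w := (N - sg) / 2; pose b := (N + sg + 1) / 2.
have w0 : 0 < w by rewrite divr_gt0// subr_gt0.
have N0 : 0 <= N by rewrite ler0n.
have b0 : 1 / 2 < b by rewrite ltr_pM2r ?invr_gt0//; lra.
have bp : 0 < b by lra.
pose c := (2 `^ sg * Num.sqrt pi)^-1.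
have c0 : 0 < c by rewrite invr_gt0 mulr_gt0// powR_gt0.
have gw : 0 < gamma w by exact: gamma_gt0.
have gb : 0 < gamma b by exact: gamma_gt0.
have bh : 0 < b + 2^-1 by rewrite addr_gt0// invr_gt0.
have gbh : 0 < gamma (b + 2^-1) by exact: gamma_gt0.
(* The constant from the value at [0] meets the [pi] of the reflection formula; this is the origin
   of [sqrt pi] in the theorem. *)
have g12 : gamma 2^-1 / pi <= (Num.sqrt pi)^-1 :> R.
  rewrite ler_pdivrMr// -[X in _ * X](sqr_sqrtr (ltW p0)) expr2 mulKf ?gt_eqF//.
  by rewrite -(@ler_pXn2r _ 2) ?nnegrE ?sqrtr_ge0 ?(ltW (gamma_gt0 _)) ?invr_gt0// sqr_sqrtr ?(ltW p0)// gamma_half_le.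
have g120 : 0 < gamma 2^-1 :> R by rewrite gamma_gt0// invr_gt0.
have f0 : `|rint (sg + 1) (legendre n) 0| <= c / 2 * (gamma w / (b * gamma b)) * `|sin (pi * w)|.
  rewrite rint_legendre_at0 ?addr_gt0//.
  have -> : (sg + 1 - n%:R + 1) / 2 = 1 - w by rewrite /w -/N; field.
  have -> : (sg + 1 + n%:R) / 2 = b by rewrite /b -/N; field.
  have bp1 : 0 < b + 1 by rewrite addr_gt0.
  have h := rgamma_reflection_le w0.
  move: (rgamma (1 - w)) h => rw h.
  rewrite (rgamma_pos bp1) (gammaS bp) !normrM (gtr0_norm g120) (ger0_norm (powR_ge0 _ _)).
  have bg : 0 < (b * gamma b)^-1 by rewrite invr_gt0; exact: mulr_gt0.
  rewrite (gtr0_norm bg).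
  rewrite opprD powR_addr// powR_inv1// powRN.
  apply: (@le_trans _ _ (gamma 2^-1 * ((2 `^ sg)^-1 / 2) * (gamma w * `|sin (pi * w)| / pi) / (b * gamma b))).
    apply: ler_wpM2r; first exact: (ltW bg).
    apply: ler_wpM2l => //; apply: mulr_ge0; first exact: (ltW g120).
    by rewrite divr_ge0// invr_ge0 powR_ge0.
  have -> : c / 2 * (gamma w / (b * gamma b)) * `|sin (pi * w)| =
     (Num.sqrt pi)^-1 * ((2 `^ sg)^-1 / 2 * (gamma w / (b * gamma b)) * `|sin (pi * w)|).
    by rewrite /c invfM; ring.
  have -> : gamma 2^-1 * ((2 `^ sg)^-1 / 2) * (gamma w * `|sin (pi * w)| / pi) / (b * gamma b) =
     (gamma 2^-1 / pi) * ((2 `^ sg)^-1 / 2 * (gamma w / (b * gamma b)) * `|sin (pi * w)|) by ring.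
  by apply: ler_wpM2r => //; sign.
have g0 : `|rint sg (legendre n) 0| <= c * (gamma (w + 2^-1) / gamma (b + 2^-1)) * `|cos (pi * w)|.
  rewrite rint_legendre_at0//.
  have -> : (sg - n%:R + 1) / 2 = 1 - (w + 2^-1) by rewrite /w -/N; field.
  have -> : (sg + n%:R) / 2 + 1 = b + 2^-1 by rewrite /b -/N; field.
  have wh : 0 < w + 2^-1 by rewrite addr_gt0// invr_gt0.
  have gwh : 0 < gamma (w + 2^-1) by exact: gamma_gt0.
  have := rgamma_reflection_le wh.
  move: (rgamma (1 - (w + 2^-1))) => rw.
  have -> : sin (pi * (w + 2^-1)) = cos (pi * w) by rewrite mulrDr sinDpihalf.
  move=> h.
  rewrite (rgamma_pos bh) !normrM (gtr0_norm g120) (ger0_norm (powR_ge0 _ _)).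
  rewrite (gtr0_norm (x := (gamma (b + 2^-1))^-1)) ?invr_gt0//.
  rewrite powRN.
  apply: (@le_trans _ _ (gamma 2^-1 * (2 `^ sg)^-1 * (gamma (w + 2^-1) * `|cos (pi * w)| / pi) / gamma (b + 2^-1))).
    apply: ler_wpM2r; first by rewrite invr_ge0 (ltW gbh).
    apply: ler_wpM2l => //; apply: mulr_ge0; first exact: (ltW g120).
    by rewrite invr_ge0 powR_ge0.
  have -> : c * (gamma (w + 2^-1) / gamma (b + 2^-1)) * `|cos (pi * w)| =
     (Num.sqrt pi)^-1 * ((2 `^ sg)^-1 * (gamma (w + 2^-1) / gamma (b + 2^-1)) * `|cos (pi * w)|).
    by rewrite /c invfM; ring.
  have -> : gamma 2^-1 * (2 `^ sg)^-1 * (gamma (w + 2^-1) * `|cos (pi * w)| / pi) / gamma (b + 2^-1) =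
     (gamma 2^-1 / pi) * ((2 `^ sg)^-1 * (gamma (w + 2^-1) / gamma (b + 2^-1)) * `|cos (pi * w)|) by ring.
  by apply: ler_wpM2r => //; sign.
have S := @rint_legendre_sonin n (sg + 1) x.
have {S} : rint (sg + 1) (legendre n) x ^+ 2 <= rint (sg + 1) (legendre n) 0 ^+ 2 + rint sg (legendre n) 0 ^+ 2 / (4 * (w * b)).
  have e : (n%:R - (sg + 1) + 1) * (n%:R + (sg + 1)) = 4 * (w * b) by rewrite /w /b -/N; field.
  by move: S; rewrite e addrK; apply => //; rewrite -/N; lra.
have sq (u v : R) : 0 <= v -> `|u| <= v -> u ^+ 2 <= v ^+ 2.
  by move=> v0 uv; rewrite -real_normK ?num_real// ler_pXn2r ?nnegrE.
have gwh : 0 < gamma (w + 2^-1) by rewrite gamma_gt0// addr_gt0// invr_gt0.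
have {}f0 := sq _ _ _ f0; have {}g0 := sq _ _ _ g0.
have {}f0 : rint (sg + 1) (legendre n) 0 ^+ 2 <= (c / 2 * (gamma w / (b * gamma b)) * `|sin (pi * w)|) ^+ 2.
  by apply: f0; sign.
have {}g0 : rint sg (legendre n) 0 ^+ 2 <= (c * (gamma (w + 2^-1) / gamma (b + 2^-1)) * `|cos (pi * w)|) ^+ 2.
  by apply: g0; sign.
pose Q := (c / 2 * (gamma w / (b * gamma b))) ^+ 2.
have Q0 : 0 < Q by rewrite /Q; sign.
have {}f0 : rint (sg + 1) (legendre n) 0 ^+ 2 <= Q * sin (pi * w) ^+ 2.
  by move: f0; rewrite exprMn real_normK ?num_real.
(* The half-step inequality at [w] cancels the [w] of the denominator; at [b + 1/2] it brings the
   amplitude back to [Q], at the price of [(b + 1/2) / b]. *)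
have {}g0 : rint sg (legendre n) 0 ^+ 2 / (4 * (w * b)) <= Q * ((b + 2^-1) / b) * cos (pi * w) ^+ 2.
  have h1 := gamma_half_bound w0.
  have h2 := gamma_half_bound bh.
  have e1 : b + 2^-1 + 2^-1 = b + 1 by field.
  rewrite e1 gammaS// in h2.
  move: g0; rewrite exprMn real_normK ?num_real// => g0.
  rewrite ler_pdivrMr; last by sign.
  apply: (le_trans g0).
  rewrite [leRHS]mulrAC; apply: ler_wpM2r; first exact: sqr_ge0.
  have bg : 0 < (b * gamma b) ^+ 2 by sign.
  have gh2 : 0 < gamma (b + 2^-1) ^+ 2 by sign.
  have -> : Q * ((b + 2^-1) / b) * (4 * (w * b)) =
     c ^+ 2 * ((w * gamma w ^+ 2) * ((b + 2^-1) / (b * gamma b) ^+ 2)).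
    by rewrite /Q; move: (c) => c'; field; rewrite !gt_eqF.
  have -> : (c * (gamma (w + 2^-1) / gamma (b + 2^-1))) ^+ 2 =
     c ^+ 2 * (gamma (w + 2^-1) ^+ 2 / gamma (b + 2^-1) ^+ 2).
    by move: (c) => c'; field; rewrite !gt_eqF.
  apply: ler_wpM2l; first exact: sqr_ge0.
  apply: ler_pM => //; first exact: sqr_ge0.
  - by rewrite invr_ge0 sqr_ge0.
  - by rewrite ler_pdivlMr// mulrC ler_pdivrMr.
move=> S; have {}S : rint (sg + 1) (legendre n) x ^+ 2 <= Q * ((b + 2^-1) / b).
  apply: (le_trans S); apply: (le_trans (lerD f0 g0)).
  have rb : 1 <= (b + 2^-1) / b by rewrite ler_pdivlMr// mul1r lerDl invr_ge0.
  have : Q * sin (pi * w) ^+ 2 <= Q * ((b + 2^-1) / b) * sin (pi * w) ^+ 2.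
    by rewrite ler_wpM2r ?sqr_ge0// ler_peMr// ltW.
  have := cos2Dsin2 (pi * w).
  move: (Q * ((b + 2^-1) / b)) (sin (pi * w) ^+ 2) (cos (pi * w) ^+ 2) => q si co cs.
  have : q * co + q * si = q by rewrite -mulrDr cs mulr1.
  by lra.
rewrite -(@ler_pXn2r _ 2) ?nnegrE//; last 2 first.
- by apply: mulr_ge0 => //; apply: divr_ge0 => //; apply: addr_ge0 => //; sign.
- by rewrite -/w -/b -/c; sign.
rewrite -/w -/b -/c exprMn real_normK ?num_real//.
apply: (@le_trans _ _ (((2 * N + 1) / 2) ^+ 2 * (Q * ((b + 2^-1) / b)))).
  by rewrite ler_wpM2l ?sqr_ge0.
have -> : ((2 * N + 1) / 2) ^+ 2 * (Q * ((b + 2^-1) / b)) =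
   (c * (gamma w / gamma b)) ^+ 2 * (((2 * N + 1) / 2) ^+ 2 * (b + 2^-1) / (4 * b ^+ 3)).
  by rewrite /Q; field; rewrite !gt_eqF.
apply: ler_piMr; first exact: sqr_ge0.
have b3 : 0 < 4 * b ^+ 3 by apply: mulr_gt0 => //; sign.
rewrite ler_pdivrMr// mul1r.
(* The margin [1/2] makes the cubic inequality true: [(2 b - 1/2)^2 (b + 1/2)] equals
   [4 b^3 - 3 b / 4 + 1/8], which is below [4 b^3] as [b > 1/2]. *)
have : (2 * N + 1) / 2 <= 2 * b - 2^-1 by rewrite /b; lra.
have : 0 <= (2 * N + 1) / 2 by rewrite divr_ge0// addr_ge0// mulr_ge0.
move: ((2 * N + 1) / 2) => k k0 kb.
have k2 : k ^+ 2 <= (2 * b - 2^-1) ^+ 2 by rewrite ler_pXn2r ?nnegrE// (le_trans k0).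
apply: (@le_trans _ _ ((2 * b - 2^-1) ^+ 2 * (b + 2^-1))); first by rewrite ler_pM2r.
have -> : (2 * b - 2^-1) ^+ 2 * (b + 2^-1) = 4 * b ^+ 3 - 3 / 4 * b + 8^-1 by field.
by lra.
Qed.

End SoninBound.

(** * Absolute continuity and integration by parts *)

Section UniformSteps.
Context {R : realType}.
Notation leb := (@lebesgue_measure R).
Variables a b : R.
Hypothesis ab : a < b.

Definition node (K j : nat) : R := a + (b - a) * j%:R / K%:R.

Lemma nodeS K j : node K j.+1 - node K j = (b - a) / K%:R.
Proof. by rewrite /node -[j.+1%:R]natr1; ring. Qed.

Lemma node0 K : node K 0 = a.
Proof. by rewrite /node mulr0 mul0r addr0. Qed.

Lemma nodeK K : (0 < K)%N -> node K K = b.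
Proof. by move=> K0; rewrite /node mulfK ?pnatr_eq0 -?lt0n// addrC subrK. Qed.

Lemma node_le K i j : (i <= j)%N -> node K i <= node K j.
Proof.
move=> ij; rewrite lerD2l ler_wpM2r ?invr_ge0// ler_wpM2l ?ler_nat//.
by rewrite subr_ge0 ltW.
Qed.

Lemma node_ge K j : a <= node K j.
Proof. by rewrite -(node0 K) node_le. Qed.

Lemma node_leb K j : (j <= K)%N -> node K j <= b.
Proof.
case: K => [|K] jK; last by rewrite -(nodeK (ltn0Sn K)) node_le.
by rewrite /node invr0 mulr0 addr0 ltW.
Qed.

Definition step (K : nat) (c : nat -> R) (t : R) : R :=
  \sum_(j < K) c j * \1_(`[node K j, node K j.+1[%classic) t.

Lemma stepP K t : (0 < K)%N -> a < t -> t < b ->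
  exists j : 'I_K, [/\ node K j <= t, t < node K j.+1 & forall c, step K c t = c j].
Proof.
move=> K0 at_ tb; have KR : 0 < K%:R :> R by rewrite ltr0n.
have d0 : 0 < b - a by rewrite subr_gt0.
pose y := (t - a) * K%:R / (b - a).
have y0 : 0 <= y by rewrite /y mulr_ge0 ?invr_ge0 ?(ltW d0)// mulr_ge0// subr_ge0 ltW.
have [yl yu] : (Num.truncn y)%:R <= y /\ y < (Num.truncn y).+1%:R by have /andP[] := truncn_itv y0.
have jK : (Num.truncn y < K)%N.
  rewrite -(ltr_nat R) (le_lt_trans yl)// /y ltr_pdivrMr// mulrC ltr_pM2l// ltrD2r//.
have n1 j : (node K j <= t) = (j%:R <= y).
  rewrite /node -lerBrDl /y ler_pdivrMr// ler_pdivlMr// [(b - a) * _]mulrC //.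
exists (Ordinal jK); split.
- by rewrite n1.
- by rewrite ltNge n1 -ltNge.
- move=> c; rewrite /step (bigD1 (Ordinal jK))//= big1 ?addr0.
    rewrite indicE mem_set ?mulr1//= in_itv/= n1 yl/= ltNge n1 -ltNge //.
  move=> i ij; rewrite indicE memNset ?mulr0//= in_itv/= n1 ltNge n1 -ltNge => /andP[h1 h2].
  move/eqP: ij; apply; apply/val_inj => /=; apply/eqP; rewrite eqn_leq.
  have u1 : (i < (Num.truncn y).+1)%N by rewrite -(ltr_nat R); exact: le_lt_trans h1 yu.
  have u2 : (Num.truncn y < i.+1)%N by rewrite -(ltr_nat R); exact: le_lt_trans yl h2.
  by rewrite ltnS in u1; rewrite ltnS in u2; rewrite u1 u2.
Qed.

(** The null set [N] is removed because the fundamental theorem knows the derivative only off it.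
    The first cell also contains [a], which is not in the open interval. *)
Lemma step_integrable (N : set R) K c : measurable N -> leb N = 0%E -> (0 < K)%N ->
  leb.-integrable (`]a, b[ `\` N) (EFin \o step K c) /\
  \int[leb]_(t in `]a, b[ `\` N) step K c t = \sum_(j < K) c j * ((b - a) / K%:R).
Proof.
move=> mN N0 K0; set D := _ `\` N; have mD : measurable D by exact: measurableD.
have bD : (leb D < +oo)%E.
  apply: (@le_lt_trans _ _ (leb `]a, b[)); last by rewrite lebesgue_measure_itv/= lte_fin ab ltry.
  by apply: le_measure; rewrite ?inE//; exact: subDsetl.
have mI (j : nat) : measurable (`[node K j, node K j.+1[%classic : set R) by [].
have iI j : leb.-integrable D (EFin \o (fun t => \1_(`[node K j, node K j.+1[%classic) t : R)).
  apply: (@integrableS _ _ _ _ setT) => //.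
  exact: (@integrable_indic_itv R (node K j) (node K j.+1) true true).
have eI (j : 'I_K) : \int[leb]_(t in D) \1_(`[node K j, node K j.+1[%classic) t = (b - a) / K%:R.
  rewrite /Rintegral integral_indic// -(nodeS K j).
  have mB : measurable (N `|` [set a]) by exact: measurableU.
  have B0 : leb (`[node K j, node K j.+1[ `&` (N `|` [set a])) = 0%E.
    apply/eqP; rewrite -measure_le0 (le_trans (le_measure _ _ _ (@subIsetr _ _ _)))// ?inE//; first exact: measurableI.
    change (leb (N `|` [set a]) <= 0)%E.
    have a0 : leb [set a] = 0%E by exact: lebesgue_measure_set1.
    have -> : leb (N `|` [set a]) = leb N by exact: (@measureU0 _ _ _ leb N [set a] mN (measurable_set1 a) a0).
    by rewrite N0.
  have -> : `[node K j, node K j.+1[%classic `&` D = `[node K j, node K j.+1[%classic `\` (N `|` [set a]).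
    apply/seteqP; split => t /=.
      by move=> [h [h1 h2]]; split => // -[//|/= ta]; move: h1; rewrite ta /= in_itv/= ltxx.
    move=> [h nB]; split => //; split; last by move=> Nt; apply: nB; left.
    move: h; rewrite /= !in_itv/= => /andP[h1 h2]; rewrite (lt_le_trans h2 (node_leb (ltn_ord j))) andbT.
    rewrite lt_neqAle (le_trans (node_ge K j) h1) andbT; apply/eqP => ta; apply: nB; right.
    by rewrite /= -ta.
  have eY : leb (`[node K j, node K j.+1[ `\` (N `|` [set a])) = leb `[node K j, node K j.+1[.
    transitivity (leb (`[node K j, node K j.+1[ `\` (N `|` [set a])) + leb (`[node K j, node K j.+1[ `&` (N `|` [set a])))%E.
      by rewrite -[LHS]adde0; congr (_ + _)%E; exact: esym B0.
    exact: esym (@measureDI _ _ _ leb _ _ (mI j) mB).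
  transitivity (fine (leb `[node K j, node K j.+1[)); first by congr fine; exact: eY.
  have -> : leb `[node K j, node K j.+1[ = (node K j.+1 - node K j)%:E.
    rewrite lebesgue_measure_itv/= lte_fin ltNge.
    have : node K j < node K j.+1 by rewrite -subr_gt0 nodeS divr_gt0 ?subr_gt0// ltr0n.
    by rewrite ltNge => ->.
  by [].
have [] := @integrable_sum1 _ _ R leb D K (fun j t => c j * \1_(`[node K j, node K j.+1[%classic) t) mD (fun j => @integrableZ1 _ _ R leb D _ (c j) mD (iI j)).
move=> h1 h2; split; first exact: h1.
rewrite [LHS]h2; apply: eq_bigr => j _.
by rewrite RintegralZl// ?eI//; exact: iI.
Qed.

End UniformSteps.

Section AbsolutelyContinuous.
Context {R : realType}.
Notation leb := (@lebesgue_measure R).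
Variables (a b : R) (F : R -> R).
Hypotheses (ab : a < b) (acF : absolutely_continuous a b F).

Let dF K j := F (node a b K j.+1) - F (node a b K j).

(** Absolute continuity for selected cells among [n] consecutive ones: an unselected cell is
    collapsed to its left end, which keeps the family indexed by all [n]. *)
Lemma ac_select e : 0 < e -> exists2 d, 0 < d &
  forall K o n (sel : pred 'I_n), (0 < K)%N -> (o + n <= K)%N ->
    \sum_(j < n | sel j) (b - a) / K%:R < d -> \sum_(j < n | sel j) `|dF K (o + j)| < e.
Proof.
move=> /acF[d d0 h]; exists d => // K o n sel K0 onK sd.
pose lo (j : 'I_n) := node a b K (o + j).
pose hi (j : 'I_n) := if sel j then node a b K (o + j).+1 else node a b K (o + j).
have lohi j : lo j <= hi j by rewrite /lo /hi; case: ifP => // _; exact: node_le.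
have hiS j : hi j <= node a b K (o + j).+1 by rewrite /hi; case: ifP => // _; exact: node_le.
have := h n lo hi; rewrite [X in X < e](_ : _ = \sum_(j < n | sel j) `|dF K (o + j)|); last first.
  rewrite [RHS]big_mkcond; apply: eq_bigr => j _; rewrite /hi /lo.
  by case: ifP => // _; rewrite subrr normr0.
apply.
- move=> j; split; first exact: node_ge.
  split => //; apply: (le_trans (hiS j)); apply: node_leb => //.
  by apply: leq_trans onK; rewrite -addnS leq_add2l.
- apply/trivIsetP => i j _ _.
  wlog ij : i j / (i < j)%N.
    move=> H nij; case: (ltngtP i j) => ij; first exact: H.
      by rewrite setIC; apply: H => //; rewrite eq_sym.
    by move/eqP: nij; case; exact: val_inj.
  move=> _; apply/seteqP; split => t //= [].
  rewrite !in_itv/= => /andP[_ t1] /andP[t2 _].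
  have := lt_trans t2 (lt_le_trans t1 (hiS i)).
  by rewrite ltNge node_le// -addnS leq_add2l.
- apply: le_lt_trans sd; rewrite [leRHS]big_mkcond; apply: ler_sum => j _.
  by rewrite /hi /lo; case: ifP => _; rewrite ?nodeS// subrr.
Qed.

(** A number of cells divisible by [M] splits into [M] blocks, each of length [(b - a) / M < d] and
    hence of variation at most one. *)
Lemma ac_variation : exists M : nat, (0 < M)%N /\
  forall q, \sum_(j < M * q.+1) `|dF (M * q.+1) j| <= M%:R.
Proof.
have [d d0 h] := ac_select ltr01.
pose M := (Num.truncn ((b - a) / d)).+1.
have Md : (b - a) / M%:R < d.
  by rewrite ltr_pdivrMr ?ltr0n// mulrC -ltr_pdivrMr// Num.Theory.truncnS_gt.
exists M; split => // q; set K := (M * q.+1)%N.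
have K0 : (0 < K)%N by rewrite muln_gt0.
rewrite -(big_mkord xpredT (fun j => `|dF K j|)) big_nat_mul.
rewrite -[leRHS]mulr_natr mul1r -[X in _ <= X%:R]card_ord -sumr_const big_mkord.
apply: ler_sum => i _; apply/ltW.
rewrite -{1}[(i * q.+1)%N]add0n big_addn mulSn addnK big_mkord.
rewrite (eq_bigr (fun j : 'I_q.+1 => `|dF K (i * q.+1 + j)|)); last by move=> j _; rewrite addnC.
apply: h => //; first by rewrite addnC -mulSn leq_mul2r ltn_ord orbT.
rewrite sumr_const card_ord -[X in X < _]mulr_natr /K natrM invfM mulrA divfK// pnatr_eq0.
Qed.

End AbsolutelyContinuous.

Section DifferenceQuotients.
Context {R : realType}.

Lemma is_derive1_eps (F : R -> R) (x g e : R) : is_derive x 1 F g -> 0 < e ->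
  exists2 d, 0 < d & forall y, `|y - x| < d -> `|F y - F x - g * (y - x)| <= e * `|y - x|.
Proof.
move=> [dF <-] e0; move/cvg_ex: dF => [l hl].
have -> : 'D_1 F x = l by exact: cvg_lim hl.
move/cvgrPdist_lt : hl => /(_ _ e0) [d /= d0 hd].
exists d => // y yd; have [->|yx] := eqVneq y x; first by rewrite !subrr mulr0 subr0 normr0 mulr0.
have yx0 : y - x != 0 by rewrite subr_eq0.
have := hd (y - x); rewrite /ball_ /= sub0r normrN => /(_ yd yx0) /ltW.
rewrite [_ *: 1](mulr1) subrK => h.
rewrite (_ : F y - F x - l * (y - x) = - ((l - (y - x)^-1 * (F y - F x)) * (y - x))); last by field.
by rewrite normrN normrM ler_wpM2r.
Qed.

(** The straddle lemma: both ends of the interval may move around [x], as they do for the cell that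
    contains [x] when the partition is refined. *)
Lemma is_derive1_straddle (F : R -> R) (x g e : R) : is_derive x 1 F g -> 0 < e ->
  exists2 d, 0 < d & forall y z, y <= x -> x <= z -> y < z -> z - y < d ->
    `|(F z - F y) / (z - y) - g| <= e.
Proof.
move=> dF e0; have [d d0 h] := is_derive1_eps dF e0.
exists d => // y z yx xz yz zyd; have zy0 : 0 < z - y by rewrite subr_gt0.
rewrite -(@ler_pM2r _ (z - y))// -{2}(gtr0_norm zy0) -normrM.
have -> : ((F z - F y) / (z - y) - g) * (z - y) = (F z - F x - g * (z - x)) - (F y - F x - g * (y - x)).
  by field; rewrite gt_eqF.
apply: (le_trans (ler_normB _ _)).
have hz := h z; have hy := h y.
rewrite ger0_norm ?subr_ge0// in hz.
rewrite ler0_norm ?subr_le0// opprB in hy.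
have {}hz := hz (ltac:(lra)); have {}hy := hy (ltac:(lra)).
by lra.
Qed.

End DifferenceQuotients.

(** * The fundamental theorem for absolutely continuous functions *)

Section FundamentalTheorem.
Context {R : realType}.
Notation leb := (@lebesgue_measure R).

Lemma dominated_Rintegral_cvg (D : set R) (f_ : nat -> R -> R) (f g : R -> R) : measurable D ->
  (forall n, measurable_fun D (f_ n)) -> (forall x, D x -> f_ ^~ x @ \oo --> f x) ->
  leb.-integrable D (EFin \o g) -> (forall n x, D x -> `|f_ n x| <= g x) ->
  (fun n => \int[leb]_(x in D) f_ n x) @ \oo --> \int[leb]_(x in D) f x.
Proof.
move=> mD mf ff ig fg; have mfl : measurable_fun D f by exact: measurable_fun_cvg ff.
have ffe : {ae leb, forall x, D x -> (fun n => (f_ n x)%:E) @ \oo --> (f x)%:E}.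
  by apply: aeW => x Dx; apply/fine_cvgP; split; [exact: nearW|exact: ff].
have fge : {ae leb, forall x n, D x -> (`|(f_ n x)%:E| <= (g x)%:E)%E}.
  by apply: aeW => x n Dx; rewrite lee_fin fg.
have mfe n : measurable_fun D (EFin \o f_ n) by apply/measurable_EFinP.
have mfle : measurable_fun D (EFin \o f) by apply/measurable_EFinP.
have [i1 _ h] := @dominated_convergence _ _ _ leb D mD (fun n => EFin \o f_ n) (EFin \o f) (EFin \o g) mfe mfle ffe ig fge.
have := @fine_cvg _ _ \oo _ (fun n => \int[leb]_(x in D) (f_ n x)%:E)%E (\int[leb]_(x in D) f x).
apply; rewrite /Rintegral fineK; first exact: h.
exact: integrable_fin_num i1.
Qed.

(** Truncation is Lipschitz, hence compatible with limits, and it provides the constant bound that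
    dominated convergence asks for. *)
Definition clip (L y : R) : R := Num.max (- L) (Num.min L y).

Implicit Types L y : R.

Lemma clip_cases L y : 0 <= L ->
  [\/ clip L y = L /\ L <= y, clip L y = - L /\ y <= - L | clip L y = y /\ - L <= y <= L].
Proof.
move=> L0; rewrite /clip; have [Ly|yL] := leP L y.
  by apply: Or31; split => //; rewrite max_r//; lra.
have [h|h] := leP y (- L); first by apply: Or32; split => //; rewrite max_l.
by apply: Or33; split; rewrite ?max_r ?(ltW h)// ltW.
Qed.

Lemma clip_le L y : 0 <= L -> `|clip L y| <= L.
Proof. by move=> L0; case: (clip_cases y L0) => -[-> h]; rewrite ler_norml; apply/andP; lra. Qed.

Lemma clip_le_norm L y : 0 <= L -> `|clip L y| <= `|y|.
Proof.
move=> L0; case: (clip_cases y L0) => -[-> h] //.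
- by rewrite ger0_norm// (le_trans h)// ler_norm.
- by rewrite normrN ger0_norm// -normrN (le_trans _ (ler_norm _))//; lra.
Qed.

Lemma clip_lip L x y : 0 <= L -> `|clip L x - clip L y| <= `|x - y|.
Proof.
move=> L0; have := ler_norm (x - y); have := lerNnormlW (lexx `|x - y|) => h1 h2.
by case: (clip_cases x L0) => -[-> h]; case: (clip_cases y L0) => -[-> h'];
  rewrite ler_norml; apply/andP; lra.
Qed.

Lemma clip_id L y : `|y| <= L -> clip L y = y.
Proof. by rewrite ler_norml => /andP[h1 h2]; rewrite /clip min_r// max_r. Qed.

Lemma clip_sub_le L y : 0 <= L -> `|clip L y - y| <= if L < `|y| then `|y| else 0.
Proof.
move=> L0; case: ltP => [_|]; last first.
  rewrite ler_norml => h; case: (clip_cases y L0) => -[-> h']; rewrite normr_le0; apply/eqP; lra.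
have := ler_norm y; have := lerNnormlW (lexx `|y|) => h1 h2.
by case: (clip_cases y L0) => -[-> h']; rewrite ler_norml; apply/andP; lra.
Qed.

Lemma measurable_clip (D : set R) L (f : R -> R) : measurable_fun D f -> measurable_fun D (fun x => clip L (f x)).
Proof.
move=> mf; apply: measurable_maxr; first exact: measurable_cst.
by apply: measurable_minr => //; exact: measurable_cst.
Qed.

Lemma cvg_clip L (u : nat -> R) l : 0 <= L -> u @ \oo --> l -> (fun n => clip L (u n)) @ \oo --> clip L l.
Proof.
move=> L0 ul; apply/cvgrPdist_lt => e e0; near=> n.
apply: le_lt_trans (clip_lip _ _ L0) _.
by near: n; move/cvgrPdist_lt : ul; apply.
Unshelve. all: by end_near. Qed.

Lemma cvg_dist_le (u : nat -> R) l c e : u @ \oo --> l -> (\forall n \near \oo, `|u n - c| <= e) -> `|l - c| <= e.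
Proof.
move=> ul h; have : (fun n => `|u n - c|) @ \oo --> `|l - c| by apply: cvg_norm; apply: cvgB => //; exact: cvg_cst.
by move=> {}ul; apply: (cvgr_to_le ul h).
Qed.

(** The difference quotients of [F] on uniform partitions form step functions [g q] that converge to
    [G] off the null set, while their integrals telescope to [F b - F a]. Absolute continuity makes
    them uniformly integrable, which allows the passage to the limit. *)
Lemma ac_FTC (a b : R) (F G : R -> R) : a < b -> absolutely_continuous a b F ->
  {ae leb, forall x, `]a, b[%classic x -> is_derive x 1 F (G x)} ->
  exists G', [/\ leb.-integrable `]a, b[ (EFin \o G'),
    {ae leb, forall x, `]a, b[%classic x -> G x = G' x} &
    \int[leb]_(x in `]a, b[) G' x = F b - F a].
Proof.
move=> ab acF [N [mN N0 hN]].
set D := `]a, b[%classic `\` N; have mD : measurable D by exact: measurableD.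
have dG x : D x -> is_derive x 1 F (G x).
  by move=> [xab Nx]; apply: contrapT => h; apply: Nx; apply: hN => /= /(_ xab).
have ba : 0 < b - a by rewrite subr_gt0.
have [M [M0 hM]] := ac_variation ab acF.
pose K q := (M * q.+1)%N; have K0 q : (0 < K q)%N by rewrite muln_gt0 M0.
pose w q := (b - a) / (K q)%:R.
have w0 q : 0 < w q by rewrite divr_gt0// ltr0n.
pose dF q j := F (node a b (K q) j.+1) - F (node a b (K q) j).
pose c q j := dF q j / w q.
have cw q j : c q j * w q = dF q j by rewrite /c divfK// gt_eqF.
pose g q := step a b (K q) (c q).
have sti q c' := step_integrable ab c' mN N0 (K0 q).
have Dab x : D x -> a < x /\ x < b by move=> [/=]; rewrite in_itv/= => /andP[].
have gcvg x : D x -> g ^~ x @ \oo --> G x.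
  move=> Dx; have [ax xb] := Dab x Dx.
  apply/cvgrPdist_le => e e0; have [d d0 hd] := is_derive1_straddle (dG x Dx) e0.
  near=> q; have [j [h1 h2 h3]] := stepP ab (K0 q) ax xb.
  rewrite /g h3 distrC /c /dF /w -(nodeS a b (K q) j).
  apply: hd => //; [exact: ltW|exact: le_lt_trans h1 h2|].
  rewrite nodeS ltr_pdivrMr ?ltr0n// mulrC -ltr_pdivrMr//.
  apply: (@le_lt_trans _ _ q%:R); last by rewrite ltr_nat /K leq_pmull.
  by near: q; exact: nbhs_infty_ger.
have mg q : measurable_fun D (g q).
  by have [/integrableP[/measurable_EFinP + _] _] := sti q (c q).
have mG : measurable_fun D G by exact: measurable_fun_cvg gcvg.
have sumg q : \int[leb]_(x in D) g q x = F b - F a.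
  have [_ ->] := sti q (c q); rewrite (eq_bigr (fun j : 'I_(K q) => dF q j)); last by move=> j _; exact: cw.
  by rewrite -(big_mkord xpredT (dF q)) telescope_sumr// node0 nodeK.
have absg q x : D x -> `|g q x| = step a b (K q) (fun j => `|c q j|) x.
  by move=> Dx; have [ax xb] := Dab x Dx; have [j [_ _ h3]] := stepP ab (K0 q) ax xb; rewrite /g !h3.
have varg q : (\int[leb]_(x in D) `|g q x|%:E <= M%:R%:E)%E.
  rewrite (@eq_integral _ _ _ leb D (fun x => (step a b (K q) (fun j => `|c q j|) x)%:E)); last first.
    by move=> x /set_mem Dx; rewrite absg.
  have [i1 i2] := sti q (fun j => `|c q j|).
  rewrite -[leLHS]fineK; last exact: integrable_fin_num.
  rewrite lee_fin; apply: (le_trans _ (hM q)).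
  rewrite [leLHS]i2 le_eqVlt; apply/orP; left; apply/eqP; apply: eq_bigr => j _.
  by rewrite -/(w q) -{1}(gtr0_norm (w0 q)) -normrM cw.
(* Fatou's lemma, with the variation bound [varg] that is uniform in [q]. *)
have iG : leb.-integrable D (EFin \o G).
  apply/integrableP; split; first exact/measurable_EFinP.
  apply: (@le_lt_trans _ _ M%:R%:E); last exact: ltry.
  have mag q : measurable_fun D (fun x => `|g q x|%:E).
    by apply/measurable_EFinP; exact: measurableT_comp (mg q).
  have := fatou leb mD mag (fun _ _ _ => normr_ge0 _).
  rewrite (@eq_integral _ _ _ leb D (fun x => `|G x|%:E)); last first.
    move=> x /set_mem Dx; apply: (cvg_limn_einf_sup _).1.
    by apply/fine_cvgP; split; [exact: nearW|apply: cvg_norm; exact: gcvg].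
  move=> /le_trans; apply; rewrite limn_einf_lim; apply: lime_le; first exact: is_cvg_einfs.
  apply: nearW => n; apply: le_trans (varg n).
  by apply: ereal_inf_lbound; exists n => /=.
(* Uniform integrability in the form needed: truncation at a high level changes the telescoping sums
   by at most [e], whatever [q]. *)
have key e : 0 < e -> exists2 L0, 0 < L0 & forall L, L0 <= L ->
    `|\int[leb]_(x in D) clip L (G x) - (F b - F a)| <= e.
  move=> e0; have [d d0 hd] := ac_select ab acF e0.
  exists (M%:R / d + 1) => [|L LL]; first by rewrite ltr_wpDl// divr_ge0// ltW.
  have L0 : 0 < L by rewrite (lt_le_trans _ LL)// ltr_wpDl// divr_ge0// ltW.
  have MLd : M%:R / L < d.
    rewrite ltr_pdivrMr// mulrC -ltr_pdivrMr// (lt_le_trans _ LL)// ltrDl//.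
  have bD : leb.-integrable D (EFin \o cst L).
    apply: (@measurable_bounded_integrable _ _ _ leb (cst L) D mD); [|exact: measurable_cst|exact: bounded_cst].
    apply: (@le_lt_trans _ _ (leb `]a, b[)); last by rewrite lebesgue_measure_itv/= lte_fin ab ltry.
    by apply: le_measure; rewrite ?inE//; exact: subDsetl.
  have C : (fun q => \int[leb]_(x in D) clip L (g q x)) @ \oo --> \int[leb]_(x in D) clip L (G x).
    apply: (@dominated_Rintegral_cvg D (fun q x => clip L (g q x)) (fun x => clip L (G x)) (cst L)) => //.
    - by move=> q; exact: measurable_clip.
    - by move=> x Dx; apply: cvg_clip; [exact: ltW|exact: gcvg].
    - by move=> q x _; apply: clip_le; exact: ltW.
  apply: (cvg_dist_le C); apply: nearW => q.
  have -> : \int[leb]_(x in D) clip L (g q x) = \sum_(j < K q) clip L (c q j) * w q.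
    have [_ <-] := sti q (fun j => clip L (c q j)).
    apply: eq_Rintegral => x /set_mem Dx; have [ax xb] := Dab x Dx.
    by have [j [_ _ h3]] := stepP ab (K0 q) ax xb; rewrite /g !h3.
  rewrite -(sumg q); have [_ ->] := sti q (c q); rewrite -sumrB.
  apply: (le_trans (ler_norm_sum _ _ _)).
  (* Cells steeper than [L] have total length at most [M / L < d], because the variation is at most
     [M]; absolute continuity then makes the sum of their increments small. *)
  pose sel (j : 'I_(K q)) := L < `|c q j|.
  apply: (@le_trans _ _ (\sum_(j < K q | sel j) `|dF q (0 + j)%N|)).
    rewrite [leRHS]big_mkcond; apply: ler_sum => j _.
    rewrite -/(w q) -mulrBl normrM (gtr0_norm (w0 q)).
    apply: (le_trans (ler_wpM2r (ltW (w0 q)) (clip_sub_le _ (ltW L0)))).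
    rewrite /sel add0n; case: ifP => _; last by rewrite mul0r.
    by rewrite -{1}(gtr0_norm (w0 q)) -normrM cw.
  apply/ltW; apply: hd => //; apply: le_lt_trans MLd.
  rewrite ler_pdivlMr// mulr_suml; apply: le_trans (hM q).
  rewrite big_mkcond; apply: ler_sum => j _; case: ifP => // hj.
  by rewrite -/(w q) -/(dF q j) -cw normrM (gtr0_norm (w0 q)) mulrC ler_pM2r// ltW.
have intG : \int[leb]_(x in D) G x = F b - F a.
  have cL : (fun n : nat => \int[leb]_(x in D) clip n%:R (G x)) @ \oo --> \int[leb]_(x in D) G x.
    apply: (@dominated_Rintegral_cvg _ _ _ (fun x => `|G x|) mD).
    - by move=> n; exact: measurable_clip.
    - move=> x Dx; apply: (@cvg_near_cst _ _ _ _ _ _); near=> n; apply: clip_id.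
      by near: n; exact: nbhs_infty_ger.
    - exact: (integrable_abse iG).
    - by move=> n x _; exact: clip_le_norm.
  apply/eqP; rewrite -subr_eq0 -normr_eq0 eq_le normr_ge0 andbT.
  apply/ler_addgt0Pl => e e0; rewrite addr0; have [L0 L00 hL] := key e e0.
  apply: (cvg_dist_le cL); near=> n; apply: hL.
  by near: n; exact: nbhs_infty_ger.
(* On the null set [G] is arbitrary, so it is replaced by [0] there. *)
exists (G \_ D); split.
- have h : leb.-integrable setT (EFin \o (G \_ D)).
    by rewrite -restrict_EFin; apply: (@integrable_mkcond _ _ R leb D (EFin \o G) mD).1; exact: iG.
  exact: (@integrableS _ _ R leb setT `]a, b[%classic _ measurableT _ _ h).
- exists N; split => // x /= h; apply: contrapT => Nx; apply: h => xab.
  by rewrite patchE mem_set.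
- by rewrite -Rintegral_mkcondr (_ : _ `&` D = D)//; apply/setIidr; exact: subDsetl.
Unshelve. all: by end_near. Qed.

End FundamentalTheorem.

Section BoundedMeasurable.
Context {R : realType}.
Notation leb := (@lebesgue_measure R).

Lemma ae_leb_filter : Filter (nbhs (almost_everywhere leb)).
Proof. exact: (@ae_filter_ringOfSetsType _ _ R leb). Qed.

Lemma fun_boundedP (D : set R) (h : R -> R) C : (forall x, D x -> `|h x| <= C) -> [bounded h x | x in D].
Proof.
move=> hC; exists C; split; first exact: num_real.
by move=> M CM x Dx; exact: le_trans (hC x Dx) (ltW CM).
Qed.

Lemma integrable_mul_bounded (D : set R) (f h : R -> R) C : measurable D ->
  leb.-integrable D (EFin \o f) -> measurable_fun D h -> (forall x, D x -> `|h x| <= C) ->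
  leb.-integrable D (EFin \o (fun x => f x * h x)).
Proof.
by move=> mD i mh hC; exact: (@integrableMl _ _ R leb D mD _ _ i mh (fun_boundedP hC)).
Qed.

Lemma itv_integrable_bounded (a b : R) (h : R -> R) C : measurable_fun `]a, b[ h ->
  (forall x, a < x -> x < b -> `|h x| <= C) -> leb.-integrable `]a, b[ (EFin \o h).
Proof.
move=> mh hC; apply: (@measurable_bounded_integrable _ _ R leb h `]a, b[%classic) => //.
  change (leb `]a, b[%classic < +oo)%E.
  by rewrite lebesgue_measure_itv/=; case: ifP; rewrite ?ltry// -EFinB ltry.
by apply: (@fun_boundedP _ _ C) => x; rewrite /= in_itv/= => /andP[]; exact: hC.
Qed.

End BoundedMeasurable.

(** * Products with absolutely continuous functions *)

Section AbsolutelyContinuousProduct.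
Context {R : realType}.
Variables (a b : R) (F : R -> R).
Hypothesis acF : absolutely_continuous a b F.

Lemma ac_uniformly_continuous e : 0 < e -> exists2 d, 0 < d &
  forall x y, a <= x -> x <= y -> y <= b -> y - x < d -> `|F y - F x| < e.
Proof.
move=> /acF[d d0 h]; exists d => // x y ax xy yb yxd.
have := h 1%N (fun=> x) (fun=> y); rewrite !big_ord1; apply => //.
by apply/trivIsetP => i j _ _; rewrite !ord1 eqxx.
Qed.

Lemma ac_bounded : exists2 C : R, 0 <= C & forall x, a <= x -> x <= b -> `|F x| <= C.
Proof.
have [d d0 h] := ac_uniformly_continuous ltr01.
have hn n : forall x, a <= x -> x <= b -> x - a <= n%:R * (d / 2) -> `|F x - F a| <= n%:R.
  elim: n => [|n IH] x ax xb.
    rewrite mul0r subr_le0 => xa; have -> : x = a by apply/eqP; rewrite eq_le ax xa.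
    by rewrite subrr normr0.
  rewrite -natr1 mulrDl mul1r => xn; have [xd|dx] := ltP (x - a) d.
    by rewrite ltW// (lt_le_trans (h _ _ _ _ _ xd))// lerDr.
  have -> : F x - F a = (F x - F (x - d / 2)) + (F (x - d / 2) - F a) by ring.
  rewrite addrC (le_trans (ler_normD _ _))// lerD//; first by apply: IH; lra.
  by apply/ltW/h; lra.
pose n := (Num.truncn ((b - a) / (d / 2))).+1.
exists (n%:R + `|F a|) => [|x ax xb]; first by rewrite addr_ge0.
rewrite -[F x](subrK (F a)) (le_trans (ler_normD _ _))// lerD2r hn//.
rewrite (@le_trans _ _ (b - a))// ?lerD2r//.
by rewrite -ler_pdivrMr ?divr_gt0// ltW// Num.Theory.truncnS_gt.
Qed.

(** Meant for [h = rint (s + 1) p] with [s >= 0], which is Lipschitz; it makes the product in the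
    integration by parts absolutely continuous. *)
Lemma ac_mul_lipschitz (h : R -> R) H L : 0 <= H -> 0 <= L ->
  (forall x, a <= x -> x <= b -> `|h x| <= H) ->
  (forall x y, a <= x -> x <= y -> y <= b -> `|h y - h x| <= L * (y - x)) ->
  absolutely_continuous a b (fun x => F x * h x).
Proof.
move=> H0 L0 hH hL e e0; have [C C0 hC] := ac_bounded.
have H1 : 0 < 2 * (H + 1) by rewrite mulr_gt0// ltr_wpDl.
have B1 : 0 < 2 * (C * L + 1) by rewrite mulr_gt0// ltr_wpDl// mulr_ge0.
have [d d0 hd] := acF (divr_gt0 e0 H1).
exists (Num.min d (e / (2 * (C * L + 1)))); first by rewrite lt_min d0 divr_gt0.
move=> n lo hi lohi tr; rewrite lt_min => /andP[sd se].
have {}hd := hd n lo hi lohi tr sd.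
apply: (@le_lt_trans _ _ (\sum_(i < n) ((H + 1) * `|F (hi i) - F (lo i)| + C * L * (hi i - lo i)))).
  apply: ler_sum => i _; have [l1 [l2 l3]] := lohi i.
  have -> : F (hi i) * h (hi i) - F (lo i) * h (lo i) =
     h (hi i) * (F (hi i) - F (lo i)) + F (lo i) * (h (hi i) - h (lo i)) by ring.
  rewrite (le_trans (ler_normD _ _))// !normrM lerD//.
    by rewrite ler_wpM2r// (le_trans (hH _ _ _))// ?(le_trans l1)// lerDl.
  by rewrite -mulrA ler_pM// ?hC// ?hL// (le_trans l2).
rewrite big_split/= -!mulr_sumr.
have h1 : (H + 1) * \sum_(i < n) `|F (hi i) - F (lo i)| < e / 2.
  by rewrite mulrC -ltr_pdivlMr ?ltr_wpDl// -mulrA -invfM.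
have h2 : C * L * \sum_(i < n) (hi i - lo i) <= e / 2.
  apply: (@le_trans _ _ ((C * L + 1) * (e / (2 * (C * L + 1))))).
    by apply: ler_pM; [exact: mulr_ge0| | |exact: ltW]; [apply: sumr_ge0 => i _; rewrite subr_ge0; case: (lohi i) => _ []|rewrite lerDl].
  by rewrite le_eqVlt; apply/orP; left; apply/eqP; field; rewrite gt_eqF// ltr_wpDl// mulr_ge0.
by rewrite [e]splitr ltr_leD.
Qed.

Lemma ac_measurable : measurable_fun `]a, b[ F.
Proof.
apply: open_continuous_measurable_fun; first exact: interval_open.
move=> x /set_mem/=; rewrite in_itv/= => /andP[ax xb].
apply/cvgrPdist_lt => e e0; have [d d0 h] := ac_uniformly_continuous e0.
near=> t.
have ta : a <= t by apply/ltW; near: t; exact: lt_nbhsr.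
have tb : t <= b by apply/ltW; near: t; exact: lt_nbhsl.
have td : `|x - t| < d by near: t; apply: cvgr_dist_lt.
have [tx|xt] := leP t x.
  by apply: h => //; [exact: ltW|move: td; rewrite ger0_norm// subr_ge0].
rewrite distrC; apply: h => //; [exact: ltW..|].
by move: td; rewrite distrC ger0_norm// subr_ge0 ltW.
Unshelve. all: by end_near. Qed.

End AbsolutelyContinuousProduct.

(** * Integration by parts against fractional integrals *)

Section IntegrationByParts.
Context {R : realType}.
Notation leb := (@lebesgue_measure R).
Implicit Types (s : R) (p : {poly R}).

Lemma rint_bounded s p : 0 <= s -> exists2 C : R, 0 <= C & forall x, -1 <= x -> x <= 1 -> `|rint s p x| <= C.
Proof.
move=> s0; exists (\sum_(j < size (p \Po (1 - 'X))) `|tcoef p j * j`!%:R / gamma (j%:R + s + 1)| * 2 `^ (j%:R + s)).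
  by apply: sumr_ge0 => j _; rewrite mulr_ge0 ?powR_ge0.
move=> x x0 x1; rewrite (le_trans (ler_norm_sum _ _ _))//; apply: ler_sum => j _.
rewrite normrM ler_wpM2l// ger0_norm ?ppow_ge0// /ppow; case: ifP => x10; last exact: powR_ge0.
by apply: ge0_ler_powR; [exact: addr_ge0|rewrite nnegrE ltW|rewrite nnegrE|lra].
Qed.

(** With [L] a bound on the derivative, both [L t - rint (s + 1) p t] and [L t + rint (s + 1) p t]
    are nondecreasing. *)
Lemma rint_lipschitz s p : 0 <= s -> exists2 L : R, 0 <= L &
  forall x y, -1 <= x -> x <= y -> y <= 1 -> `|rint (s + 1) p y - rint (s + 1) p x| <= L * (y - x).
Proof.
move=> s0; have [L L0 hL] := rint_bounded p s0; exists L => // x y x0 xy y1.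
have cr : continuous (rint (s + 1) p) by apply: rint_continuous; lra.
have dr (t : R) : t < 1 -> is_derive t 1 (rint (s + 1) p) (- rint s p t) by move=> t1; apply: derive_rint => //; lra.
have dL (t : R) : is_derive t 1 (fun u : R => L * u) (L * 1) by exact: (@deriveZ1 R (fun u => u) t 1 L (is_derive_id t 1)).
have bnd (t : R) : t \in `]x, y[ -> `|rint s p t| <= L.
  by rewrite in_itv/= => /andP[xt ty]; apply: hL; lra.
have h1 : L * x - rint (s + 1) p x <= L * y - rint (s + 1) p y.
  apply: (@derive_ge0_le _ (fun t : R => L * t - rint (s + 1) p t) (fun t => L * 1 - - rint s p t) _ _ xy).
  - apply: continuous_subspaceT => t; apply: cvgB; last exact: cr.
    exact: is_derive1_continuous (dL t).
  - by move=> t; rewrite in_itv/= => /andP[_ ty]; apply: deriveB1 => //; apply: dr; exact: lt_le_trans ty y1.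
  - by move=> t /bnd; rewrite ler_norml => /andP[h1 h2]; lra.
have h2 : L * x + rint (s + 1) p x <= L * y + rint (s + 1) p y.
  apply: (@derive_ge0_le _ (fun t : R => L * t + rint (s + 1) p t) (fun t => L * 1 + - rint s p t) _ _ xy).
  - apply: continuous_subspaceT => t; apply: cvgD; last exact: cr.
    exact: is_derive1_continuous (dL t).
  - by move=> t; rewrite in_itv/= => /andP[_ ty]; apply: deriveD1 => //; apply: dr; exact: lt_le_trans ty y1.
  - by move=> t /bnd; rewrite ler_norml => /andP[h3 h2]; lra.
by rewrite ler_norml mulrBr; apply/andP; split; lra.
Qed.

Lemma measurable_rint s p (D : set R) : measurable_fun D (rint s p).
Proof.
apply: measurable_sum => j; apply: measurable_funM; first exact: measurable_cst.
exact: measurable_ppow_sub.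
Qed.

Lemma ac_derivative_integrable (F G : R -> R) : absolutely_continuous (-1) 1 F -> ae_derivative F G ->
  exists2 G', leb.-integrable `]-1, 1[ (EFin \o G') & {ae leb, forall x, `]-1, 1[%classic x -> G x = G' x}.
Proof.
move=> acF dF; have N11 : -1 < 1 :> R by lra.
by have [G' [iG' GG' _]] := ac_FTC N11 acF dF; exists G'.
Qed.

(** The boundary term at [1] vanishes with [rint (s + 1) p], and the minus sign in the derivative of
    [rint (s + 1) p] turns the usual difference into a sum. *)
Lemma ac_parts s p (F G : R -> R) : 0 <= s -> absolutely_continuous (-1) 1 F -> ae_derivative F G ->
  \int[leb]_(x in `]-1, 1[) (F x * rint s p x) =
  F (-1) * rint (s + 1) p (-1) + \int[leb]_(x in `]-1, 1[) (G x * rint (s + 1) p x).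
Proof.
move=> s0 acF dF; have N11 : -1 < 1 :> R by lra.
have mO : measurable (`]-1, 1[%classic : set R) by [].
have [G' iG' GG'] := ac_derivative_integrable acF dF.
have [C C0 hC] := ac_bounded acF.
have s10 : 0 <= s + 1 by lra.
have [H H0 hH] := rint_bounded p s10.
have [B B0 hB] := rint_bounded p s0.
have [L L0 hL] := rint_lipschitz p s0.
have acP := ac_mul_lipschitz acF H0 L0 hH hL.
pose Q x := G x * rint (s + 1) p x + F x * - rint s p x.
have dP : {ae leb, forall x : R, `]-1, 1[%classic x -> is_derive x 1 (fun x : R => F x * rint (s + 1) p x) (Q x)}.
  apply: (@filterS _ _ (@ae_leb_filter R) _ _ _ dF) => x h xO; apply: deriveM1; first exact: h.
  by apply: derive_rint; [lra|move: xO; rewrite /= in_itv/= => /andP[]].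
have [Q' [iQ' QQ' eQ']] := ac_FTC N11 acP dP.
have iGr : leb.-integrable `]-1, 1[ (EFin \o (fun x => G' x * rint (s + 1) p x)).
  apply: (@integrable_mul_bounded _ _ _ _ H mO iG'); first exact: measurable_rint.
  by move=> x; rewrite /= in_itv/= => /andP[x0 x1]; apply: hH; exact: ltW.
have iFr : leb.-integrable `]-1, 1[ (EFin \o (fun x => F x * rint s p x)).
  apply: (@itv_integrable_bounded _ _ _ _ (C * B)).
    by apply: measurable_funM; [exact: ac_measurable acF|exact: measurable_rint].
  by move=> x x0 x1; rewrite normrM ler_pM// ?hC ?hB// ltW.
have e1 : \int[leb]_(x in `]-1, 1[) Q' x = \int[leb]_(x in `]-1, 1[) (G' x * rint (s + 1) p x) - \int[leb]_(x in `]-1, 1[) (F x * rint s p x).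
  apply: etrans; last exact: (@RintegralB _ _ R leb _ _ _ mO iGr iFr).
  apply: eq_Rintegral_ae => //; apply: (@filterS2 _ _ (@ae_leb_filter R) _ _ _ _ QQ' GG') => x h1 h2 xO.
  by rewrite -h1// /Q h2// mulrN.
have e2 : \int[leb]_(x in `]-1, 1[) (G x * rint (s + 1) p x) = \int[leb]_(x in `]-1, 1[) (G' x * rint (s + 1) p x).
  by apply: eq_Rintegral_ae => //; apply: (@filterS _ _ (@ae_leb_filter R) _ _ _ GG') => x h xO; rewrite h.
have fin : forall x y z t u v : R, x = z - y -> t = z -> x = u - v -> u = 0 -> y = v + t by clear; intros; lra.
by apply: (fin _ _ _ _ _ _ e1 e2 eQ'); rewrite rint_ge1// mulr0.
Qed.

End IntegrationByParts.

(** * Functions of bounded variation *)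

Section BoundedVariation.
Context {R : realType}.
Notation leb := (@lebesgue_measure R).
Variables (a b : R) (v : R -> R).
Hypotheses (ab : a <= b) (bv : bounded_variation a b v).

Let V x := fine (total_variation a x v).

Let V_fin x : a <= x -> x <= b -> total_variation a x v \is a fin_num.
Proof. by move=> ax xb; apply/(bounded_variationP v ax); exact: (bounded_variationl ax xb bv). Qed.

Lemma bv_increment x y : a <= x -> x <= y -> y <= b -> `|v y - v x| <= V y - V x.
Proof.
move=> ax xy yb; have ay := le_trans ax xy; have xb := le_trans xy yb.
have := total_variation_ge v xy; have := total_variationD v ax xy.
rewrite -(fineK (V_fin ay yb)) -(fineK (V_fin ax xb)) -/(V x) -/(V y).
case: (total_variation x y v) => [r| |] //.
by rewrite -EFinD => -[->]; rewrite lee_fin => h; rewrite addrAC subrr add0r.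
Qed.

Lemma bv_variation_nondecreasing x y : a <= x -> x <= y -> y <= b -> V x <= V y.
Proof.
move=> ax xy yb; have := bv_increment ax xy yb; have := normr_ge0 (v y - v x).
by move=> h1 h2; rewrite -subr_ge0 (le_trans h1).
Qed.

Lemma bv_sum_nondecreasing x y : a <= x -> x <= y -> y <= b -> v x + V x <= v y + V y.
Proof.
move=> ax xy yb; have := bv_increment ax xy yb; have := ler_norm (v x - v y).
by rewrite distrC => h1 h2; lra.
Qed.

Lemma bv_variation0 : V a = 0.
Proof. by rewrite /V total_variationxx. Qed.

Lemma bv_variation_ge0 x : a <= x -> x <= b -> 0 <= V x.
Proof. by move=> ax xb; rewrite -bv_variation0 bv_variation_nondecreasing. Qed.

Lemma bv_bounded x : a <= x -> x <= b -> `|v x| <= `|v a| + V b.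
Proof.
move=> ax xb; rewrite -[v x](subrK (v a)) (le_trans (ler_normD _ _))// addrC lerD2l.
rewrite (le_trans (bv_increment (lexx a) ax xb))// bv_variation0 subr0.
exact: bv_variation_nondecreasing.
Qed.

(** Extends the two monotone parts [v + V] and [V] of [v] from [[a, b]] to monotone functions on the
    line. *)
Let clamp (x : R) : R := Num.max a (Num.min b x).

Let clamp_nd x y : x <= y -> [/\ a <= clamp x, clamp x <= clamp y & clamp y <= b].
Proof.
move=> xy; rewrite /clamp le_max lexx; split => //.
  by rewrite ge_max le_max lexx/= le_max; apply/orP; right; rewrite le_min !ge_min lexx xy/= orbT.
by rewrite ge_max ab ge_min lexx.
Qed.

Lemma bv_measurable : measurable_fun `]a, b[ v.
Proof.
have m1 : measurable_fun (`]a, b[%classic : set R) (fun x => v (clamp x) + V (clamp x)).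
  apply: nondecreasing_measurable => // x y xy; have [h1 h2 h3] := clamp_nd xy.
  exact: bv_sum_nondecreasing.
have m2 : measurable_fun (`]a, b[%classic : set R) (fun x => V (clamp x)).
  apply: nondecreasing_measurable => // x y xy; have [h1 h2 h3] := clamp_nd xy.
  exact: bv_variation_nondecreasing.
have := measurable_funB m1 m2; apply: eq_measurable_fun => x /set_mem/=.
rewrite in_itv/= => /andP[ax xb]; rewrite addrK /clamp min_r ?(ltW xb)//.
by rewrite max_r// ltW.
Qed.

(** Again [v = (v + V) - V]: a monotone function that is bounded below near [a] has a right limit
    there. *)
Lemma bv_right_limit : a < b -> cvg (v x @[x --> a^'+]).
Proof.
move=> lab.
have c1 : cvg (V x @[x --> a^'+]).
  apply: nondecreasing_at_right_is_cvgr.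
    near=> c; have cb : c <= b by apply/ltW; near: c; exact: nbhs_right_lt.
    move=> x y; rewrite !in_itv/= => /andP[ax _] /andP[ay yc] xy.
    by apply: bv_variation_nondecreasing => //; [exact: ltW|exact: le_trans (ltW yc) cb].
  near=> c; have cb : c <= b by apply/ltW; near: c; exact: nbhs_right_lt.
  exists 0 => _ /= [x + <-]; rewrite in_itv/= => /andP[ax xc].
  by apply: bv_variation_ge0; [exact: ltW|exact: le_trans (ltW xc) cb].
have c2 : cvg ((v x + V x) @[x --> a^'+]).
  apply: nondecreasing_at_right_is_cvgr.
    near=> c; have cb : c <= b by apply/ltW; near: c; exact: nbhs_right_lt.
    move=> x y; rewrite !in_itv/= => /andP[ax _] /andP[ay yc] xy.
    by apply: bv_sum_nondecreasing => //; [exact: ltW|exact: le_trans (ltW yc) cb].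
  near=> c; have cb : c <= b by apply/ltW; near: c; exact: nbhs_right_lt.
  exists (v a + V a) => _ /= [x + <-]; rewrite in_itv/= => /andP[ax xc].
  by apply: bv_sum_nondecreasing; [exact: lexx|exact: ltW|exact: le_trans (ltW xc) cb].
have h : cvg ((v x + V x - V x) @[x --> a^'+]) by exact: is_cvgB.
have e : (fun x => v x + V x - V x) = v by apply/funext => x; rewrite addrK.
by rewrite e in h.
Unshelve. all: by end_near. Qed.

End BoundedVariation.

Section Abel.
Context {R : realType}.

Lemma abel_sum (c F : nat -> R) n :
  \sum_(j < n.+1) c j.+1 * (F j - F j.+1) =
  c 1%N * F 0%N + \sum_(j < n) (c j.+2 - c j.+1) * F j.+1 - c n.+1 * F n.+1.
Proof.
elim: n => [|n IH]; first by rewrite big_ord1 big_ord0; ring.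
by rewrite big_ord_recr IH [in RHS]big_ord_recr /=; ring.
Qed.

End Abel.

(** * Integration by parts for functions of bounded variation *)

Section BoundedVariationParts.
Context {R : realType}.
Notation leb := (@lebesgue_measure R).
Implicit Types (s : R) (p : {poly R}).

Lemma rint_integral_itv s p (x y : R) : 0 < s -> x < y -> y <= 1 ->
  \int[leb]_(t in `]x, y[) rint s p t = rint (s + 1) p x - rint (s + 1) p y.
Proof.
move=> s0 xy y1.
have s10 : 0 < s + 1 by lra.
have cr : continuous (rint s p) by exact: rint_continuous.
have cR : continuous (rint (s + 1) p) by exact: rint_continuous.
have i : leb.-integrable `[x, y] (EFin \o rint s p).
  apply: continuous_compact_integrable; first exact: segment_compact.
  exact: continuous_subspaceT.
have io : leb.-integrable `]x, y[ (EFin \o rint s p).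
  by apply: (integrableS _ _ _ i) => //; exact: subset_itv_oo_cc.
have ioc : leb.-integrable `]x, y] (EFin \o rint s p).
  by apply: (integrableS _ _ _ i) => //; exact: subset_itv_oc_cc.
rewrite Rintegral_itv_bndo_bndc// Rintegral_itv_obnd_cbnd//.
apply: (etrans (Rintegral_FTC (F := fun t => - rint (s + 1) p t) xy _ _ _)); last by rewrite opprK addrC.
- exact: continuous_subspaceT.
- by apply: continuous_subspaceT => t; apply: cvgN; exact: cR.
- move=> t; rewrite in_itv/= => /andP[_ ty].
  have dr : is_derive t 1 (rint (s + 1) p) (- rint s p t).
    by apply: derive_rint; [lra|exact: lt_le_trans ty y1].
  by apply: is_derive_eq (deriveN1 dr) _; rewrite opprK.
Qed.

Let itv_indic s p (x y : R) : 0 < s -> -1 <= x -> x < y -> y <= 1 ->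
  \int[leb]_(t in `]-1, 1[) (\1_(`[x, y[%classic) t * rint s p t) = rint (s + 1) p x - rint (s + 1) p y.
Proof.
move=> s0 x0 xy y1; rewrite -rint_integral_itv//.
transitivity (\int[leb]_(t in `]-1, 1[) ((rint s p) \_ `]x, y[) t).
  apply: eq_Rintegral_ae => //; exists [set x]; split => //; first exact: lebesgue_measure_set1.
  move=> t /= h; apply: contrapT => tx; apply: h => _; rewrite patchE indicE.
  case: ifPn => [/set_mem|/negP h].
    by rewrite /= in_itv/= => /andP[xt ty]; rewrite mem_set ?mul1r//= in_itv/= (ltW xt).
  rewrite memNset ?mul0r//= in_itv/= => /andP[xt ty]; apply: h.
  by rewrite mem_set//= in_itv/= ty lt_neqAle xt !andbT; apply/eqP => e; apply: tx.
rewrite -Rintegral_mkcondr; congr Rintegral; apply/setIidr.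
by apply: subset_itv; rewrite bnd_simp.
Qed.

(** Stieltjes integration by parts carried out on finite sums. The function [v] is sampled at the
    right end of each cell, so the boundary term is the value at the first interior node, which
    tends to the right limit [l] and not to [v (-1)]. *)
Lemma bv_parts s p (v : R -> R) (l B : R) : 0 < s -> bounded_variation (-1) 1 v ->
  v x @[x --> (-1)^'+] --> l -> (forall x : R, -1 < x -> x < 1 -> `|rint (s + 1) p x| <= B) ->
  `|\int[leb]_(x in `]-1, 1[) (v x * rint s p x)| <=
  `|l| * `|rint (s + 1) p (-1)| + B * fine (total_variation (-1) 1 v).
Proof.
move=> s0 bv vl hB; have N11 : -1 < 1 :> R by lra.
have N1 := ltW N11.
pose V x := fine (total_variation (-1) x v).
have [C C0 hC] := rint_bounded p (ltW s0).
have V0 : 0 <= V 1 by exact: (bv_variation_ge0 bv N1 (lexx 1)).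
have B0 : 0 <= B by apply: le_trans (hB 0 _ _); rewrite ?normr_ge0//; lra.
set F := rint (s + 1) p; pose M : R := `|v (-1)| + V 1.
have vM x : -1 <= x -> x <= 1 -> `|v x| <= M by exact: bv_bounded.
have est q : `|\int[leb]_(x in `]-1, 1[) (v x * rint s p x)| <=
    `|v (node (-1) 1 q.+1 1)| * `|F (-1)| + B * V 1 + C * (V 1 * ((1 - -1) / q.+1%:R)).
  pose x_ (j : nat) : R := node (-1) 1 q.+1 j.
  have x_lt (j : nat) : x_ j < x_ j.+1 by rewrite -subr_gt0 /x_ nodeS divr_gt0//; lra.
  have x_ge (j : nat) : -1 <= x_ j by exact: node_ge.
  have x_le (j : nat) : (j <= q.+1)%N -> x_ j <= 1 by exact: node_leb.
  pose st := step (-1) 1 q.+1 (fun j => v (x_ j.+1)).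
  pose dV := step (-1) 1 q.+1 (fun j => V (x_ j.+1) - V (x_ j)).
  have ist c : leb.-integrable `]-1, 1[ (EFin \o step (-1) 1 q.+1 c) /\
     \int[leb]_(t in `]-1, 1[) step (-1) 1 q.+1 c t = \sum_(j < q.+1) c j * ((1 - -1) / q.+1%:R).
    by have := step_integrable N11 c (@measurable0 _ R) (measure0 leb) (ltn0Sn q); rewrite setD0.
  have mO : measurable (`]-1, 1[%classic : set R) by [].
  have mr D : measurable_fun D (rint s p) by exact: measurable_rint.
  have ivr : leb.-integrable `]-1, 1[ (EFin \o (fun x => v x * rint s p x)).
    apply: (@itv_integrable_bounded _ _ _ _ (M * C)).
      by apply: measurable_funM => //; exact: bv_measurable.
    by move=> x x0 x1; rewrite normrM ler_pM ?vM ?hC// ltW.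
  have isr c : leb.-integrable `]-1, 1[ (EFin \o (fun x => step (-1) 1 q.+1 c x * rint s p x)).
    apply: (@integrable_mul_bounded _ _ _ _ C mO (ist c).1 (mr _)).
    by move=> x; rewrite /= in_itv/= => /andP[x0 x1]; rewrite hC ?ltW.
  have e1 : \int[leb]_(x in `]-1, 1[) (st x * rint s p x) = \sum_(j < q.+1) v (x_ j.+1) * (F (x_ j) - F (x_ j.+1)).
    have ij (j : 'I_q.+1) : leb.-integrable `]-1, 1[ (EFin \o (fun t : R => \1_(`[x_ j, x_ j.+1[%classic) t * rint s p t)).
      apply: (@itv_integrable_bounded _ _ _ _ C).
        by apply: measurable_funM => //; exact: measurable_indic.
      move=> x x0 x1; rewrite normrM -[leRHS]mul1r; apply: ler_pM => //; last by apply: hC; exact: ltW.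
      rewrite indicE; by case: (x \in _); rewrite ?normr1// normr0.
    transitivity (\int[leb]_(x in `]-1, 1[) \sum_(j < q.+1) v (x_ j.+1) * (\1_(`[x_ j, x_ j.+1[%classic) x * rint s p x)).
      by apply: eq_Rintegral => x _; rewrite /st /step mulr_suml; apply: eq_bigr => j _; rewrite mulrA.
    have [_ h] := @integrable_sum1 _ _ R leb `]-1, 1[%classic q.+1
      (fun j x => v (x_ j.+1) * (\1_(`[x_ j, x_ j.+1[%classic) x * rint s p x)) mO (fun j => @integrableZ1 _ _ R leb _ _ _ mO (ij j)).
    apply: (etrans h); apply: eq_bigr => j _.
    apply: (etrans (@RintegralZl _ _ R leb _ _ _ mO (ij j))).
    by rewrite itv_indic// x_le.
  (* On a cell, [v] differs from its sampled value by at most the variation over that cell; summed,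
     this is the total variation times the mesh. *)
  have e2 : `|\int[leb]_(x in `]-1, 1[) (v x * rint s p x) - \int[leb]_(x in `]-1, 1[) (st x * rint s p x)| <=
      C * (V 1 * ((1 - -1) / q.+1%:R)).
    have -> : C * (V 1 * ((1 - -1) / q.+1%:R)) = \int[leb]_(x in `]-1, 1[) (C * dV x).
      apply: esym; apply: (etrans (@RintegralZl _ _ R leb _ _ _ mO (ist _).1)); congr (_ * _).
      apply: (etrans (ist _).2); rewrite -mulr_suml; congr (_ * _).
      rewrite -(big_mkord xpredT (fun j => V (x_ j.+1) - V (x_ j))) telescope_sumr//.
      by rewrite /x_ node0 nodeK// [V (-1)]bv_variation0 subr0.
    have := @RintegralB _ _ R leb _ _ _ mO ivr (isr (fun j => v (x_ j.+1))).
    move=> /esym h; apply: (le_trans (y := `|\int[leb]_(x in `]-1, 1[) (v x * rint s p x - st x * rint s p x)|)).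
      by rewrite le_eqVlt; apply/orP; left; apply/eqP; congr `|_|; exact: h.
    have iB := @integrableB1 _ _ R leb _ _ _ mO ivr (isr (fun j => v (x_ j.+1))).
    apply: (le_trans (@le_normr_Rintegral _ _ R leb _ _ mO iB)).
    apply: (@le_Rintegral _ _ R leb _ _ _ mO).
    - exact: (integrable_abse iB).
    - exact: (@integrableZ1 _ _ R leb _ _ _ mO (ist _).1).
    move=> x; rewrite /= in_itv/= => /andP[x0 x1].
    rewrite -mulrBl normrM mulrC ler_pM//; first by rewrite hC// ltW.
    have [j [h1 h2 h3]] := stepP N11 (ltn0Sn q) x0 x1.
    rewrite /st /dV !h3 distrC; have xj1 := x_le _ (ltn_ord j).
    apply: (le_trans (bv_increment bv (ltW x0) (ltW h2) xj1)).
    rewrite lerD2l lerN2; exact: (bv_variation_nondecreasing bv (x_ge j) h1 (ltW x1)).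
  apply: (@le_trans _ _ (`|\int[leb]_(x in `]-1, 1[) (st x * rint s p x)| + C * (V 1 * ((1 - -1) / q.+1%:R)))).
    have tri : forall x y z : R, `|x - y| <= z -> `|x| <= `|y| + z.
      clear => x y z h; rewrite -[x](subrK y) addrC (le_trans (ler_normD _ _))// lerD2l//.
    exact: tri e2.
  (* Summation by parts moves the increments to [v]. The term at [1] vanishes with [F], and the
     remaining values of [F], apart from the one at [-1], lie at interior nodes, where [B]
     applies. *)
  rewrite lerD2r e1 (abel_sum (fun j => v (x_ j)) (fun j => F (x_ j))).
  have -> : F (x_ q.+1) = 0 by rewrite /F rint_ge1// /x_ nodeK.
  rewrite mulr0 subr0 (le_trans (ler_normD _ _))// {1}/x_ {1}/x_ node0 normrM lerD2l.
  apply: (le_trans (ler_norm_sum _ _ _)).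
  apply: (@le_trans _ _ (\sum_(j < q) (V (x_ j.+2) - V (x_ j.+1)) * B)).
    apply: ler_sum => j _; rewrite normrM ler_pM//.
      by apply: (bv_increment bv (x_ge _) (ltW (x_lt _)) (x_le _ _)); rewrite ltnS; exact: ltn_ord.
    apply: hB; first exact: le_lt_trans (x_ge j) _.
    by apply: (lt_le_trans (x_lt j.+1)); apply: x_le; rewrite ltnS.
  rewrite -mulr_suml mulrC ler_wpM2l//.
  rewrite -(big_mkord xpredT (fun j => V (x_ j.+2) - V (x_ j.+1))) telescope_sumr//.
  rewrite {1}/x_ nodeK// lerBlDr lerDl; exact: (bv_variation_ge0 bv (x_ge 1%N) (x_le 1%N isT)).
apply/ler_addgt0Pl => e e0.
pose e1 := e / (2 * (`|F (-1)| + 1)).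
have f1 : 0 < 2 * (`|F (-1)| + 1) by rewrite mulr_gt0// ltr_wpDl.
have e10 : 0 < e1 by rewrite divr_gt0.
have [d /= d0 hd] : \forall x \near (-1 : R)^'+, `|l - v x| < e1 by move/cvgrPdist_lt : vl; apply.
(* More than [A] cells make the sampling error at most [e / 2] and put the first node within [d] of
   [-1]. *)
pose A := 2 * C * V 1 * 2 / e + 2 / d + 1.
pose q := Num.truncn A.
have qA : A < q.+1%:R by exact: Num.Theory.truncnS_gt.
apply: (le_trans (est q)).
have x1 : node (-1) 1 q.+1 1 = -1 + 2 / q.+1%:R :> R by rewrite /node; ring.
have vx1 : `|v (node (-1) 1 q.+1 1)| <= `|l| + e1.
  have : `|l - v (node (-1) 1 q.+1 1)| < e1.
    apply: hd; rewrite x1 ?ltrDl ?divr_gt0//= opprD addNKr normrN gtr0_norm ?divr_gt0//.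
    rewrite ltr_pdivrMr// mulrC -ltr_pdivrMr// (le_lt_trans _ qA)// /A.
    by rewrite addrAC lerDr; apply: addr_ge0 => //; apply: divr_ge0; last exact: ltW; rewrite !mulr_ge0.
  move=> h; rewrite -[v _](subrK l) (le_trans (ler_normD _ _))// addrC lerD2l distrC; exact: ltW.
have h2 : C * (V 1 * ((1 - -1) / q.+1%:R)) <= e / 2.
  have -> : C * (V 1 * ((1 - -1) / q.+1%:R)) = 2 * C * V 1 / q.+1%:R by ring.
  rewrite ler_pdivrMr// -ler_pdivrMl ?divr_gt0//.
  apply: (le_trans _ (ltW qA)); rewrite /A invf_div.
  have -> : 2 / e * (2 * C * V 1) = 2 * C * V 1 * 2 / e by ring.
  by rewrite -addrA lerDl; apply: addr_ge0 => //; apply: divr_ge0 => //; exact: ltW.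
have h1 : `|v (node (-1) 1 q.+1 1)| * `|F (-1)| <= `|l| * `|F (-1)| + e / 2.
  apply: (le_trans (ler_wpM2r (normr_ge0 _) vx1)); rewrite mulrDl lerD2l /e1.
  rewrite mulrAC ler_pdivrMr//.
  have -> : e / 2 * (2 * (`|F (-1)| + 1)) = e * `|F (-1)| + e by field.
  by rewrite lerDl ltW.
rewrite -/(V 1) -/F.
move: h1 h2; move: (`|v _| * _) (C * _) (`|l| * _) (B * V 1) => t1 t2 t3 t4; clear; lra.
Qed.

End BoundedVariationParts.

(** * Bounds on the Legendre coefficients *)

Section FubiniReal.
Context d1 d2 (T1 : measurableType d1) (T2 : measurableType d2) (R : realType).
Variables (m1 : {sigma_finite_measure set T1 -> \bar R}) (m2 : {sigma_finite_measure set T2 -> \bar R}).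

(** The function [k] supplies Tonelli's condition. Real-valued inner integrals agree with the
    extended ones only for almost every section, which suffices under the outer integral. *)
Lemma fubini_Rintegral (f : T1 * T2 -> R) (k : T2 -> R) : measurable_fun setT f ->
  m2.-integrable setT (EFin \o k) -> (forall y, \int[m1]_x `|f (x, y)|%:E <= (k y)%:E)%E ->
  \int[m1]_x \int[m2]_y f (x, y) = \int[m2]_y \int[m1]_x f (x, y) /\
  {ae m1, forall x, m2.-integrable setT (EFin \o (fun y => f (x, y)))}.
Proof.
move=> mf ik fk.
have mfe : measurable_fun setT (EFin \o f) by apply/measurable_EFinP.
have mfa : measurable_fun setT (fun z => `|f z|%:E) by apply/measurable_EFinP; exact: measurableT_comp.
have fi : (\int[m2]_y \int[m1]_x `|f (x, y)|%:E < +oo)%E.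
  have /integrableP[mk] := ik; apply: le_lt_trans; apply: ge0_le_integral => //.
  - by move=> y _; exact: integral_ge0.
  - exact: (measurable_fun_fubini_tonelli_G (fun z => `|f z|%:E)%E).
  - exact: measurableT_comp.
  - by move=> y _; apply: (le_trans (fk y)); rewrite lee_fin ler_norm.
have [_ /(_ fi) i] := @integrable21ltyP _ _ _ _ _ m1 m2 _ mfe.
have a1 := ae_integrable1 i; have a2 := ae_integrable2 i; split; last exact: a1.
have h := Fubini i.
transitivity (fine (\int[m1]_x \int[m2]_y (f (x, y))%:E)%E).
  congr fine; apply: eq_integral_ae => //; apply: filterS a1 => x ix _.
  by rewrite /Rintegral fineK//; exact: integrable_fin_num ix.
transitivity (fine (\int[m2]_y \int[m1]_x (f (x, y))%:E)%E); first by congr fine; exact: h.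
congr fine; apply: eq_integral_ae => //; apply: filterS a2 => y iy _.
by rewrite /Rintegral fineK//; exact: integrable_fin_num iy.
Qed.

End FubiniReal.

(** * Adjointness of the two fractional integrals *)

Section FractionalIntegrationByParts.
Context {R : realType}.
Notation leb := (@lebesgue_measure R).
Implicit Types (s : R) (p : {poly R}).

(** After the exchange, the inner integral is the semigroup law for [p]. Absolute integrability is
    the same law for the constant polynomial, since [rint 0 1] is the indicator of the half line
    below [1]. *)
Lemma frac_int_parts (a b : R) p (w G : R -> R) : 0 < a -> 0 <= b ->
  leb.-integrable `]-1, 1[ (EFin \o G) -> {ae leb, forall x, `]-1, 1[%classic x -> w x = G x} ->
  \int[leb]_(x in `]-1, 1[) (frac_int a w x * rint b p x) =
  \int[leb]_(x in `]-1, 1[) (w x * rint (a + b) p x).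
Proof.
move=> a0 b0 iG wG.
have mO : measurable (`]-1, 1[%classic : set R) by [].
have [B B0 hB] := rint_bounded p b0.
have [A A0 hA] := rint_bounded (1 : {poly R}) (ltW a0).
pose g := G \_ `]-1, 1[.
have gO x : -1 < x -> x < 1 -> g x = G x by move=> x0 x1; rewrite /g patchE mem_set//= in_itv/= x0.
have gN x : x <= -1 \/ 1 <= x -> g x = 0.
  move=> h; rewrite /g patchE memNset//= in_itv/= => /andP[x0 x1].
  by case: h; rewrite leNgt ?x0 ?x1.
have ig : leb.-integrable setT (EFin \o g).
  by rewrite /g -restrict_EFin; apply: (@integrable_mkcond _ _ R leb _ (EFin \o G) mO).1; exact: iG.
have mg : measurable_fun setT (g : measurableTypeR R -> R).
  by have /integrableP[/measurable_EFinP] := ig.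
have G0 := gamma_gt0 a0.
pose c := (gamma a)^-1.
have c0 : c != 0 by apply: invr_neq0; rewrite (gt_eqF G0).
pose f (z : R * R) : R := c * (rint b p z.1 * (g z.2 * ppow (a - 1) (z.1 - z.2))).
have mf : measurable_fun setT (f : measurableTypeR R * measurableTypeR R -> R).
  apply: measurable_funM; first exact: measurable_cst.
  apply: measurable_funM.
    by apply: (@measurableT_comp _ _ _ _ _ _ (rint b p)) => //; exact: measurable_rint.
  apply: measurable_funM; first exact: measurableT_comp.
  by apply: measurableT_comp; [exact: measurable_ppow|exact: measurable_funB].
have r01 x : x < 1 -> rint 0 (1 : {poly R}) x = 1 by move=> x1; rewrite rint0// hornerC.
have fle x y : `|f (x, y)| <= `|g y| * `|c| * B * (ppow (a - 1) (x - y) * rint 0 (1 : {poly R}) x).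
  have [y1|y1] := leP y (-1); first by rewrite /f /= gN ?normr0 ?mul0r ?mulr0 ?normr0 ?mul0r//; left.
  rewrite /f /= !normrM (ger0_norm (ppow_ge0 _ _)).
  have [x1|x1] := ltP x 1; last by rewrite !rint_ge1// normr0 mul0r !mulr0.
  rewrite r01// mulr1; have [yx|xy] := leP x y.
    by rewrite [ppow _ _]ppow_le0E ?mulr0// subr_le0.
  have -> : `|c| * (`|rint b p x| * (`|g y| * ppow (a - 1) (x - y))) =
    `|g y| * `|c| * `|rint b p x| * ppow (a - 1) (x - y) by ring.
  apply: ler_wpM2r; first exact: ppow_ge0.
  apply: ler_wpM2l; first exact: mulr_ge0.
  by apply: hB; [exact: ltW (lt_trans y1 xy)|exact: ltW].
have mfx y : measurable_fun setT (fun x : measurableTypeR R => `|f (x, y)|%:E).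
  apply/measurable_EFinP; apply: measurableT_comp => //.
  change (measurable_fun setT (fun x : measurableTypeR R => c * (rint b p x * (g y * ppow (a - 1) (x - y))))).
  apply: measurable_funM; first exact: measurable_cst.
  apply: measurable_funM; first exact: measurable_rint.
  apply: measurable_funM; first exact: measurable_cst.
  apply: measurableT_comp; first exact: measurable_ppow.
  by apply: measurable_funB => //; exact: measurable_cst.
have N10 : -1 < 0 :> R by lra.
have semi y := rint_semigroup (1 : {poly R}) y a0 N10.
pose k y := `|c| * B * gamma a * A * `|g y|.
have ik : leb.-integrable setT (EFin \o k).
  by apply: (@integrableZ1 _ _ R leb) => //; exact: (integrable_abse ig).
have bound y : (\int[leb]_x `|f (x, y)|%:E <= (k y)%:E)%E.
  have ih := @integrableZ1 _ _ R leb _ _ (`|g y| * `|c| * B) measurableT (semi y).1.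
  have ev : \int[leb]_x (`|g y| * `|c| * B * (ppow (a - 1) (x - y) * rint 0 (1 : {poly R}) x)) =
     `|g y| * `|c| * B * (gamma a * rint (a + 0) 1 y).
    by apply: (etrans (@RintegralZl _ _ R leb _ _ _ measurableT (semi y).1)); congr (_ * _); exact: (semi y).2.
  apply: (@le_trans _ _ (\int[leb]_x (`|g y| * `|c| * B * (ppow (a - 1) (x - y) * rint 0 (1 : {poly R}) x))%:E)%E).
    apply: ge0_le_integral => //.
    - by have /integrableP[] := ih.
    - by move=> x _; rewrite lee_fin fle.
  rewrite -[leLHS]fineK; last exact: integrable_fin_num ih.
  rewrite lee_fin [leLHS]ev addr0 /k.
  have [y0|y0] := leP y (-1); first by rewrite gN ?normr0 ?mul0r ?mulr0//; left.
  have [y1|y1] := leP 1 y; first by rewrite gN ?normr0 ?mul0r ?mulr0//; right.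
  have -> : `|c| * B * gamma a * A * `|g y| = `|g y| * `|c| * B * (gamma a * A) by ring.
  apply: ler_wpM2l; first by rewrite !mulr_ge0.
  apply: ler_wpM2l; first exact: ltW.
  by apply: le_trans (ler_norm _) _; apply: hA; exact: ltW.
have [e ai] := @fubini_Rintegral _ _ _ _ R leb leb f k mf ik bound.
have wG' : {ae leb, forall x, -1 < x -> x < 1 -> w x = G x}.
  by apply: (@filterS _ _ (@ae_leb_filter R) _ _ _ wG) => x h x0 x1; apply: h; rewrite /= in_itv/= x0.
have GE : Gamma a = gamma a by rewrite gamma.unlock.
have fE x : frac_int a w x = (Gamma a)^-1 * \int[leb]_(y in `]-1, x[) (w y / (x - y) `^ (1 - a)).
  by rewrite /frac_int (gt_eqF a0); reflexivity.
transitivity (\int[leb]_(x in `]-1, 1[) ((Gamma a)^-1 * \int[leb]_(y in `]-1, x[) (w y / (x - y) `^ (1 - a)) * rint b p x)).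
  by apply: eq_Rintegral => x _; rewrite fE.
have E1 : \int[leb]_(x in `]-1, 1[) ((Gamma a)^-1 * \int[leb]_(y in `]-1, x[) (w y / (x - y) `^ (1 - a)) * rint b p x) =
   \int[leb]_x \int[leb]_y f (x, y).
  rewrite Rintegral_mkcond; apply: eq_Rintegral_ae; first exact: measurableT.
  apply: (@filterS _ _ (@ae_leb_filter R) _ _ _ ai) => x ix _; rewrite patchE; case: ifPn => [/set_mem|/negP xO].
    rewrite /= in_itv/= => /andP[x0 x1].
    have E2 : \int[leb]_(y in `]-1, x[) (w y / (x - y) `^ (1 - a)) = \int[leb]_y (g y * ppow (a - 1) (x - y)).
      rewrite Rintegral_mkcond; apply: eq_Rintegral_ae; first exact: measurableT.
      apply: (@filterS _ _ (@ae_leb_filter R) _ _ _ wG') => y wy _; rewrite patchE; case: ifPn => [/set_mem|/negP yO].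
        rewrite /= in_itv/= => /andP[y0 yx]; rewrite (wy y0 (lt_trans yx x1)) (gO y y0 (lt_trans yx x1)).
        have xy0 : 0 < x - y by rewrite subr_gt0.
        by rewrite (ppow_gt0E _ xy0) -[a - 1]opprB powRN.
      have [y0|y0] := leP y (-1); first by rewrite (gN y (or_introl y0)) mul0r.
      have [xy|yx] := leP x y.
        have xy0 : x - y <= 0 by rewrite subr_le0.
        by rewrite (ppow_le0E _ xy0) mulr0.
      by exfalso; apply: yO; apply/mem_set; rewrite /= in_itv/= y0.
    rewrite E2 GE -/c.
    (* Where [rint b p x] vanishes, integrability of the section of [f] says nothing about the inner
       integrand, but both sides are zero. *)
    have [r0|r0] := eqVneq (rint b p x) 0.
      have -> : (fun y => f (x, y)) = (fun=> 0) by apply/funext => y; rewrite /f /= r0 mul0r mulr0.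
      by rewrite r0 mulr0 (Rintegral_cst leb measurableT) mul0r.
    have ig2 : leb.-integrable setT (EFin \o (fun y => g y * ppow (a - 1) (x - y))).
      have := @integrableZ1 _ _ R leb _ _ ((c * rint b p x)^-1) measurableT ix.
      congr (integrable _ _ _); apply/funext => y /=; congr EFin; rewrite /f /=.
      by rewrite [c * (_ * _)]mulrA (mulKf (mulf_neq0 c0 r0)).
    rewrite mulrAC; apply: (etrans (esym (@RintegralZl _ _ R leb _ _ _ measurableT ig2))).
    apply: eq_Rintegral => y _.
    exact: esym (mulrA c _ _).
  have -> : (fun y => f (x, y)) = (fun=> 0).
    apply/funext => y; rewrite /f /=.
    have [x1|x1] := leP 1 x; first by rewrite (rint_ge1 _ _ x1) mul0r mulr0.
    have [y0|y0] := leP y (-1); first by rewrite (gN y (or_introl y0)) mul0r !mulr0.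
    have [xy|yx] := leP x y.
      have xy0 : x - y <= 0 by rewrite subr_le0.
      by rewrite (ppow_le0E _ xy0) !mulr0.
    by exfalso; apply: xO; apply/mem_set; rewrite /= in_itv/= x1 (lt_trans y0 yx).
  by rewrite (Rintegral_cst leb measurableT) mul0r.
apply: (etrans E1); apply: (etrans e); rewrite [RHS]Rintegral_mkcond.
apply: eq_Rintegral_ae; first exact: measurableT.
apply: (@filterS _ _ (@ae_leb_filter R) _ _ _ wG') => y wy _.
have N1b : -1 < b by apply: lt_le_trans b0; exact: N10.
have [i2 e2] := rint_semigroup p y a0 N1b.
have -> : \int[leb]_x f (x, y) = g y * rint (a + b) p y.
  transitivity (\int[leb]_x (c * g y * (ppow (a - 1) (x - y) * rint b p x))).
    apply: eq_Rintegral => x _; rewrite /f /=.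
    have alg : forall t1 t2 t3 t4 : R, t1 * (t3 * (t2 * t4)) = t1 * t2 * (t4 * t3) by clear; intros; ring.
    exact: alg.
  apply: (etrans (@RintegralZl _ _ R leb _ _ _ measurableT i2)).
  apply: (etrans (congr1 (fun u => c * g y * u) e2)).
  have alg : forall t u1 u2 : R, t != 0 -> t^-1 * u1 * (t * u2) = u1 * u2.
    by clear => t u1 u2 t0; rewrite mulrACA mulVf// mul1r.
  by apply: alg; rewrite (gt_eqF G0).
rewrite patchE; case: ifPn => [/set_mem|/negP yO].
  by rewrite /= in_itv/= => /andP[y0 y1]; rewrite (wy y0 y1) (gO y y0 y1).
have [y0|y0] := leP y (-1); first by rewrite (gN y (or_introl y0)) mul0r.
have [y1|y1] := leP 1 y; first by rewrite (gN y (or_intror y1)) mul0r.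
by exfalso; apply: yO; apply/mem_set; rewrite /= in_itv/= y0.
Qed.

End FractionalIntegrationByParts.

(** * A bound on one Legendre coefficient *)

Section CoefficientBound.
Context {R : realType}.
Notation leb := (@lebesgue_measure R).

Lemma rgamma_npos (j : nat) : rgamma (- j%:R : R) = 0.
Proof.
elim: j => [|j IH]; first by rewrite rgammaS oppr0 mul0r.
by rewrite rgammaS -natr1 opprD addrNK IH mulr0.
Qed.

(** The reciprocal Gamma function vanishes at [i - n]; hence the integrations by parts on [u] itself
    leave no terms at [-1]. *)
Lemma rint_legendre_atN1_nat (n i : nat) : (0 < i)%N -> (i <= n)%N -> rint i%:R (legendre n) (-1) = 0 :> R.
Proof.
move=> i0 ni; rewrite rint_legendre_atN1 ?ltr0n//.
by rewrite (_ : i%:R - n%:R = - (n - i)%:R) ?rgamma_npos ?mulr0// natrB// opprB.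
Qed.

Lemma ac_right_limit (a b : R) (F : R -> R) : a < b -> absolutely_continuous a b F ->
  F x @[x --> a^'+] --> F a.
Proof.
move=> ab acF; apply/cvgrPdist_lt => e e0.
have [d d0 h] := ac_uniformly_continuous acF e0; near=> x.
have xa : a < x by near: x; exact: nbhs_right_gt.
have xb : x <= b by apply/ltW; near: x; exact: nbhs_right_lt.
have xd : x < a + d by near: x; apply: nbhs_right_lt; rewrite ltrDl.
by rewrite distrC; apply: (h a x (lexx a) (ltW xa) xb); rewrite ltrBlDl.
Unshelve. all: by end_near. Qed.

Lemma legendre_coef_bound (k m : nat) (mu B : R) (u : R -> R) (v : nat -> R -> R) (n : nat) :
  (1 <= k)%N -> k%:R - 1 < mu <= k%:R -> AC_BV_regular mu k m u v -> mu < n%:R ->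
  (forall x : R, -1 < x -> x < 1 -> `|rint (mu + m%:R + 1) (legendre n) x| <= B) ->
  `|legendre_coef u n| <= (2 * n%:R + 1) / 2 *
    (B * fine (total_variation (-1) 1 (v m)) +
     \sum_(l < m.+1) `|lim (v l x @[x --> (-1 : R)^'+])| * `|rint (mu + l%:R + 1) (legendre n) (-1)|).
Proof.
move=> k1 /andP[kmu muk] [ud [[ud0 cud acud] [v0E bv0 cv acv bvm]]] mun hB.
have N11 : -1 < 1 :> R by lra.
have mO : measurable (`]-1, 1[%classic : set R) by [].
have mu0 : 0 < mu by apply: le_lt_trans kmu; rewrite subr_ge0 ler1n.
(* From [k - 1 < mu < n]; it brings every integer order up to [k] within reach of
   [rint_legendre_atN1_nat]. *)
have kn : (k <= n)%N.
  by rewrite -ltnS -(ltr_nat R) -[n.+1%:R]natr1 -ltrBlDr (lt_trans kmu).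
pose P := @legendre R n.
have s1 i : (i <= k)%N -> \int[leb]_(x in `]-1, 1[) (u x * P.[x]) = \int[leb]_(x in `]-1, 1[) (ud i x * rint i%:R P x).
  elim: i => [|i IH] ik.
    apply: eq_Rintegral => x /set_mem /=; rewrite in_itv/= => /andP[_ x1].
    by rewrite rint0// ud0.
  rewrite IH; last exact: ltnW.
  apply: (etrans (ac_parts P (ler0n _ i) (acud i ik) (cud i ik))).
  have e : i%:R + 1 = i.+1%:R :> R by rewrite natr1.
  rewrite e (rint_legendre_atN1_nat _ (leq_trans ik kn))// mulr0 add0r.
  reflexivity.
have s2 : \int[leb]_(x in `]-1, 1[) (u x * P.[x]) = \int[leb]_(x in `]-1, 1[) (v 0%N x * rint mu P x).
  rewrite (s1 k (leqnn k)).
  transitivity (\int[leb]_(x in `]-1, 1[) (caputo mu k (ud k) x * rint mu P x)); last first.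
    apply: eq_Rintegral_ae; first exact: mO.
    apply: (@filterS _ _ (@ae_leb_filter R) _ _ _ v0E) => x h xO.
    by rewrite h.
  (* For [mu = k] the Caputo derivative is [ud k] itself and there is no kernel to exchange. *)
  have [muk'|muk'] := eqVneq (k%:R - mu) 0.
    apply: eq_Rintegral => x _; rewrite /caputo /frac_int muk' eqxx.
    by have -> : mu = k%:R by apply/eqP; rewrite eq_sym -subr_eq0 muk'.
  have a0 : 0 < k%:R - mu by rewrite lt_neqAle eq_sym muk' subr_ge0.
  have kk : k = k.-1.+1 by rewrite prednK.
  have kl : (k.-1 < k)%N by rewrite -kk.
  have := cud k.-1 kl; rewrite -kk => ch.
  have [G iG udG] := ac_derivative_integrable (acud k.-1 kl) ch.
  apply: esym; apply: (etrans (frac_int_parts P a0 (ltW mu0) iG udG)).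
  by apply: eq_Rintegral => x _; rewrite subrK.
have s3 l : (l <= m)%N -> `|\int[leb]_(x in `]-1, 1[) (u x * P.[x])| <=
   `|\int[leb]_(x in `]-1, 1[) (v l x * rint (mu + l%:R) P x)| +
   \sum_(i < l) `|lim (v i x @[x --> (-1 : R)^'+])| * `|rint (mu + i%:R + 1) P (-1)|.
  elim: l => [|l IH] lm; first by rewrite big_ord0 addr0 addr0 s2.
  apply: (le_trans (IH (ltnW lm))).
  have ml0 : 0 <= mu + l%:R by rewrite addr_ge0// ltW.
  have -> : \int[leb]_(x in `]-1, 1[) (v l x * rint (mu + l%:R) P x) =
     v l (-1) * rint (mu + l%:R + 1) P (-1) + \int[leb]_(x in `]-1, 1[) (v l.+1 x * rint (mu + l%:R + 1) P x).
    exact: (ac_parts P ml0 (acv l lm) (cv l lm)).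
  have -> : mu + l.+1%:R = mu + l%:R + 1 by rewrite -natr1 addrA.
  have -> : v l (-1) = lim (v l x @[x --> (-1 : R)^'+]).
    by apply/esym/cvg_lim => //; exact: ac_right_limit (acv l lm).
  rewrite big_ord_recr/= addrA addrAC lerD2r addrC -normrM.
  exact: ler_normD.
have mm0 : 0 < mu + m%:R by rewrite ltr_pwDl.
have last := bv_parts mm0 bvm (bv_right_limit bvm N11) hB.
have n0 : 0 <= (2 * n%:R + 1) / 2 :> R by rewrite divr_ge0// addr_ge0// mulr_ge0.
rewrite /legendre_coef normrM ger0_norm//; apply: ler_wpM2l => //.
apply: (le_trans (s3 m (leqnn m))); rewrite big_ord_recr/= [in leRHS]addrCA [in leLHS]addrC.
by rewrite lerD2l addrC; exact: last.
Qed.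

End CoefficientBound.

(** * Convergence of the Legendre expansion *)

Section Bernstein.
Context {R : realType}.
Implicit Types (F G : nat -> R) (n : nat) (x a : R).

(* [(bernstein n F).[x]] is the mean of [F] under the binomial law with parameters [n] and [x]. *)
Fixpoint bernstein n F : {poly R} :=
  if n is n'.+1 then (1 - 'X) * bernstein n' F + 'X * bernstein n' (F \o succn) else (F 0%N)%:P.

Lemma bernsteinS n F x : (bernstein n.+1 F).[x] = (1 - x) * (bernstein n F).[x] + x * (bernstein n (F \o succn)).[x].
Proof. by rewrite /= hornerD !hornerM hornerD hornerN hornerC hornerX. Qed.

Lemma bernstein_le n F G x : 0 <= x -> x <= 1 -> (forall j, (j <= n)%N -> F j <= G j) ->
  (bernstein n F).[x] <= (bernstein n G).[x].
Proof.
move=> x0 x1; elim: n F G => [|n IH] F G FG; first by rewrite /= !hornerC FG.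
rewrite !bernsteinS; apply: lerD; apply: ler_wpM2l; rewrite ?subr_ge0//; apply: IH => j jn.
  by apply: FG; exact: leqW.
exact: FG.
Qed.

Lemma bernstein_affine n F a b x : (bernstein n (fun j => a * F j + b)).[x] = a * (bernstein n F).[x] + b.
Proof.
elim: n F => [|n IH] F; first by rewrite /= !hornerC.
rewrite !bernsteinS (IH F) (_ : _ \o succn = fun j => a * (F \o succn) j + b)// IH; ring.
Qed.

(** The free shift [a] closes the induction on the first trial: failure turns it into [a - x],
    success into [a + 1 - x]. *)
Lemma bernstein_variance n a x : (bernstein n (fun j => (a + j%:R - n%:R * x) ^+ 2)).[x] = a ^+ 2 + n%:R * x * (1 - x).
Proof.
elim: n a => [|n IH] a; first by rewrite /= hornerC; ring.
rewrite bernsteinS.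
have -> : (fun j => (a + j%:R - n.+1%:R * x) ^+ 2) = (fun j : nat => ((a - x) + j%:R - n%:R * x) ^+ 2).
  by apply/funext => j; rewrite -[n.+1%:R]natr1; ring.
have -> : (fun j : nat => ((a - x) + j%:R - n%:R * x) ^+ 2) \o succn = (fun j : nat => ((a + 1 - x) + j%:R - n%:R * x) ^+ 2).
  by apply/funext => j; rewrite /= -[j.+1%:R]natr1; ring.
by rewrite !IH -[n.+1%:R]natr1; ring.
Qed.

(** Chebyshev's estimate for Bernstein polynomials, carried from [[0, 1]] to [[-1, 1]]: one [e] for
    the nodes near the point, one for the variance. *)
Lemma weierstrass (u : R -> R) C e : 0 < e ->
  (forall x, -1 <= x -> x <= 1 -> `|u x| <= C) ->
  (exists2 d, 0 < d & forall x y, -1 <= x -> x <= y -> y <= 1 -> y - x < d -> `|u y - u x| < e) ->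
  exists p : {poly R}, forall x, -1 <= x -> x <= 1 -> `|u x - p.[x]| <= e + e.
Proof.
move=> e0 uC [d d0 ud].
have C0 : 0 <= C by apply: le_trans (uC 0 _ _); rewrite ?normr_ge0//; lra.
have uc x y : -1 <= x -> x <= 1 -> -1 <= y -> y <= 1 -> `|y - x| < d -> `|u x - u y| < e.
  move=> x0 x1 y0 y1; have [xy|yx] := leP x y.
    by rewrite ger0_norm ?subr_ge0// distrC => h; apply: ud.
  by rewrite distrC gtr0_norm ?subr_gt0// => h; apply: ud => //; exact: ltW.
have [n n0 nA] : exists2 n : nat, 0 < n%:R :> R & 8 * C / (d ^+ 2 * e) < n%:R.
  exists (Num.truncn (8 * C / (d ^+ 2 * e))).+1; first by rewrite ltr0n.
  exact: Num.Theory.truncnS_gt.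
pose F (j : nat) := u (-1 + 2 * j%:R / n%:R).
exists (bernstein n F \Po ((1 + 'X) * (2^-1)%:P)) => t t0 t1.
have sE : ((1 + 'X) * (2^-1)%:P : {poly R}).[t] = (1 + t) / 2 by rewrite hornerM hornerD !hornerC hornerX.
rewrite horner_comp sE; set x := (1 + t) / 2.
have x0 : 0 <= x by rewrite divr_ge0//; lra.
have x1 : x <= 1 by rewrite ler_pdivrMr//; lra.
have tE : t = -1 + 2 * x by rewrite /x; field.
(* At nodes farther than [d] the difference is at most [2 C], hence at most [2 C] times the squared
   distance over [d^2]; the distance is [2 |j - n x| / n], which gives the factor [8]. *)
pose K := 8 * C / (d ^+ 2 * n%:R ^+ 2).
have K0 : 0 <= K by rewrite /K; sign.
have key j : (j <= n)%N -> `|u t - F j| <= K * (0 + j%:R - n%:R * x) ^+ 2 + e.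
  move=> jn; have jn1 : j%:R <= n%:R :> R by rewrite ler_nat.
  have q0 : 0 <= j%:R / n%:R :> R by rewrite divr_ge0.
  have q1 : j%:R / n%:R <= 1 :> R by rewrite ler_pdivrMr// mul1r.
  have [h|h] := ltP `|-1 + 2 * j%:R / n%:R - t| d.
    apply: (@le_trans _ _ e); last by rewrite lerDr; sign.
    by apply/ltW; apply: uc => //; rewrite -mulrA; lra.
  apply: (@le_trans _ _ (2 * C)).
    rewrite (le_trans (ler_normB _ _))// mulr_natl mulr2n lerD// ?uC// /F -mulrA; lra.
  have e1 : K * (0 + j%:R - n%:R * x) ^+ 2 = 2 * C * ((-1 + 2 * j%:R / n%:R - t) ^+ 2 / d ^+ 2).
    by rewrite tE /K; field; rewrite !gt_eqF.
  rewrite e1 (@le_trans _ _ (2 * C * ((-1 + 2 * j%:R / n%:R - t) ^+ 2 / d ^+ 2)))//; last by rewrite lerDl ltW.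
  have d2 : 0 < d ^+ 2 by sign.
  rewrite ler_peMr ?mulr_ge0// ler_pdivlMr// mul1r -[leRHS]real_normK ?num_real//.
  by rewrite ler_pXn2r ?nnegrE ?(ltW d0).
have sum1 : K * (n%:R * x * (1 - x)) + e <= e + e.
  rewrite lerD2r /K; apply: (@le_trans _ _ (8 * C / (d ^+ 2 * n%:R))).
    have -> : 8 * C / (d ^+ 2 * n%:R ^+ 2) * (n%:R * x * (1 - x)) = 8 * C / (d ^+ 2 * n%:R) * (x * (1 - x)).
      by field; rewrite !gt_eqF.
    rewrite ler_piMr//; first by sign.
    by nra.
  have p1 : 0 < d ^+ 2 * n%:R by sign.
  have p2 : 0 < d ^+ 2 * e by sign.
  rewrite ler_pdivrMr//; move: nA; rewrite ltr_pdivrMr// => /ltW.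
  have alg : forall p q r : R, p * (q * r) = r * (q * p) by clear; intros; ring.
  by rewrite alg.
have bv := bernstein_variance n 0 x; rewrite expr0n /= add0r in bv.
have up : u t - (bernstein n F).[x] <= e + e.
  apply: le_trans sum1; rewrite -bv -bernstein_affine.
  have -> : u t - (bernstein n F).[x] = -1 * (bernstein n F).[x] + u t by ring.
  rewrite -bernstein_affine; apply: bernstein_le => // j jn.
  by apply: le_trans (key j jn); rewrite mulN1r addrC ler_norm.
have dn : (bernstein n F).[x] - u t <= e + e.
  apply: le_trans sum1; rewrite -bv -bernstein_affine.
  have -> : (bernstein n F).[x] - u t = 1 * (bernstein n F).[x] + - u t by ring.
  rewrite -bernstein_affine; apply: bernstein_le => // j jn.
  by apply: le_trans (key j jn); rewrite mul1r distrC ler_norm.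
by rewrite ler_norml; apply/andP; split; lra.
Qed.

End Bernstein.

(** * Legendre polynomials span all polynomials *)

Section LegendreSpan.
Context {R : realType}.
Notation P := (@legendre R).

Definition legendre_span (p : {poly R}) := exists M : nat, exists c : nat -> R, p = \sum_(n < M) c n *: P n.

Lemma legendre_span_pad M (c : nat -> R) N : (M <= N)%N ->
  \sum_(n < M) c n *: P n = \sum_(n < N) (if (n < M)%N then c n else 0) *: P n.
Proof.
move=> MN; rewrite (big_ord_widen N (fun n => c n *: P n))// big_mkcond/=.
by apply: eq_bigr => n _; case: ifP => // _; rewrite scale0r.
Qed.

Lemma legendre_spanD p q : legendre_span p -> legendre_span q -> legendre_span (p + q).
Proof.
move=> [M [c ->]] [N [d ->]]; pose K := maxn M N.
rewrite (legendre_span_pad c (leq_maxl M N)) (legendre_span_pad d (leq_maxr M N)) -big_split/=.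
exists K; exists (fun n => (if (n < M)%N then c n else 0) + (if (n < N)%N then d n else 0)).
by apply: eq_bigr => n _; rewrite scalerDl.
Qed.

Lemma legendre_spanZ a p : legendre_span p -> legendre_span (a *: p).
Proof.
move=> [M [c ->]]; exists M; exists (fun n => a * c n).
by rewrite scaler_sumr; apply: eq_bigr => n _; rewrite scalerA.
Qed.

Lemma legendre_spanP n : legendre_span (P n).
Proof.
exists n.+1; exists (fun j => (j == n)%:R); rewrite big_ord_recr/= eqxx scale1r big1 ?add0r// => j _.
by rewrite (ltn_eqF (ltn_ord j)) scale0r.
Qed.

(** Bonnet's recurrence, solved for [X P_(n+1)]. *)
Lemma legendre_spanX p : legendre_span p -> legendre_span ('X * p).
Proof.
have base n : legendre_span ('X * P n).
  case: n => [|n]; first by rewrite legendre0 mulr1 -legendre1; exact: legendre_spanP.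
  have k0 : (2 * n + 3)%:R != 0 :> R by rewrite pnatr_eq0 addn3.
  have -> : 'X * P n.+1 = (2 * n + 3)%:R^-1 *: (n.+2%:R *: P n.+2 + n.+1%:R *: P n).
    have e := @legendre_bonnet R n.
    rewrite [n.+2%:R *: _]scaler_nat [n.+1%:R *: _]scaler_nat e subrK.
    by set q := 'X * P n.+1; rewrite -[q *+ _]scaler_nat scalerA mulVf// scale1r.
  by apply: legendre_spanZ; apply: legendre_spanD; apply: legendre_spanZ; exact: legendre_spanP.
move=> [M [c ->]]; rewrite mulr_sumr; elim/big_ind: _ => [|p1 p2|n _].
- by exists 0%N; exists (fun=> 0); rewrite big_ord0.
- exact: legendre_spanD.
- by rewrite -scalerAr; exact: legendre_spanZ.
Qed.

Lemma legendre_span_poly p : legendre_span p.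
Proof.
elim/poly_ind: p => [|p c IH]; first by exists 0%N; exists (fun=> 0); rewrite big_ord0.
apply: legendre_spanD; first by rewrite mulrC; exact: legendre_spanX.
by rewrite -[c%:P]mulr1 mul_polyC -legendre0; apply: legendre_spanZ; exact: legendre_spanP.
Qed.

End LegendreSpan.

(** * Error of the Legendre projection in mean square and pointwise *)

Section LegendreExpansion.
Context {R : realType}.
Notation leb := (@lebesgue_measure R).
Notation P := (@legendre R).
Variables (u : R -> R) (C : R).
Hypotheses (measu : measurable_fun (`]-1, 1[%classic : set R) u) (uC : forall x : R, -1 < x -> x < 1 -> `|u x| <= C).

Let mO : measurable (`]-1, 1[%classic : set R). Proof. by []. Qed.

Definition legendre_weight n : R := 2 / (2 * n%:R + 1).
Local Notation w := legendre_weight.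

Lemma legendre_weight_gt0 n : 0 < w n.
Proof. by rewrite divr_gt0// ltr_wpDl// mulr_ge0. Qed.

Let J (p : {poly R}) := \int[leb]_(x in `]-1, 1[) (u x * p.[x]).

Let uO x : `]-1, 1[%classic x -> `|u x| <= C.
Proof. by rewrite /= in_itv/= => /andP[]; exact: uC. Qed.

Let int_up (p : {poly R}) : leb.-integrable `]-1, 1[ (EFin \o (fun x => u x * p.[x])).
Proof.
have := @integrable_mul_bounded R `]-1, 1[%classic (horner p) u C mO (poly_integrable p) measu uO.
by congr (integrable _ _ _); apply/funext => x /=; rewrite mulrC.
Qed.

Let JD p q : J (p + q) = J p + J q.
Proof.
rewrite /J; apply: (etrans _ (@RintegralD _ _ R leb _ _ _ mO (int_up p) (int_up q))).
by apply: eq_Rintegral => x _; rewrite hornerD mulrDr.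
Qed.

Let JZ a p : J (a *: p) = a * J p.
Proof.
rewrite /J; apply: (etrans _ (@RintegralZl _ _ R leb _ _ _ mO (int_up p))).
by apply: eq_Rintegral => x _; rewrite hornerZ mulrCA.
Qed.

Let JP n : J (P n) = w n * legendre_coef u n.
Proof.
rewrite /legendre_coef /w; have n0 : 2 * n%:R + 1 != 0 :> R by rewrite gt_eqF// ltr_wpDl// mulr_ge0.
by rewrite mulrA (_ : 2 / (2 * n%:R + 1) * ((2 * n%:R + 1) / 2) = 1) ?mul1r//; field; rewrite n0.
Qed.

Let int_uu : leb.-integrable `]-1, 1[ (EFin \o (fun x => u x * u x)).
Proof.
apply: (@itv_integrable_bounded _ _ _ _ (C * C)); first exact: measurable_funM.
by move=> x x0 x1; rewrite normrM ler_pM// uC.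
Qed.

Let U2 := \int[leb]_(x in `]-1, 1[) (u x * u x).

Let sq_dist (p : {poly R}) :
  \int[leb]_(x in `]-1, 1[) (u x - p.[x]) ^+ 2 = U2 - 2 * J p + poly_integral (p ^+ 2).
Proof.
have i1 := @integrableZ1 _ _ R leb _ _ 2 mO (int_up p).
have i2 := @integrableB1 _ _ R leb _ _ _ mO int_uu i1.
rewrite /J /U2 /poly_integral.
have <- := @RintegralZl _ _ R leb _ _ 2 mO (int_up p).
have <- := @RintegralB _ _ R leb _ _ _ mO int_uu i1.
have <- := @RintegralD _ _ R leb _ _ _ mO i2 (poly_integrable (p ^+ 2)).
by apply: eq_Rintegral => x _; rewrite horner_exp; move: (u x) (p.[x]) => s t; ring.
Qed.

Let orth_sum M (c : nat -> R) :
  poly_integral ((\sum_(n < M) c n *: P n) ^+ 2) = \sum_(n < M) w n * c n ^+ 2 /\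
  forall j, (M <= j)%N -> poly_integral ((\sum_(n < M) c n *: P n) * P j) = 0.
Proof.
have PI0 : poly_integral (0 : {poly R}) = 0.
  by have := poly_integralZ 0 (0 : {poly R}); rewrite scaler0 mul0r.
elim: M => [|M [IH1 IH2]]; first by rewrite !big_ord0; split=> [|j _]; rewrite ?expr0n /= ?mul0r PI0.
rewrite !big_ord_recr /=; set q := \sum_(n < M) _ in IH1 IH2 *; split; last first.
  move=> j Mj; rewrite mulrDl poly_integralD IH2 ?(ltnW Mj)// add0r -scalerAl poly_integralZ.
  by rewrite legendre_orth ?mulr0// ltn_eqF.
have -> : (q + c M *: P M) ^+ 2 = q ^+ 2 + ((2 * c M) *: (q * P M) + (c M ^+ 2) *: (P M ^+ 2)).
  by rewrite -!mul_polyC !rmorphM/= polyC_natr; move: (c M)%:P => t; ring.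
by rewrite !poly_integralD !poly_integralZ IH1 IH2// mulr0 add0r legendre_norm mulrC.
Qed.

Let J_sum M (c : nat -> R) : J (\sum_(n < M) c n *: P n) = \sum_(n < M) w n * c n * legendre_coef u n.
Proof.
elim: M => [|M IH]; first by rewrite !big_ord0 -(scale0r 0) JZ mul0r.
by rewrite !big_ord_recr/= JD JZ IH JP; congr (_ + _); ring.
Qed.

Let defect M := U2 - \sum_(n < M) w n * legendre_coef u n ^+ 2.

(** Pythagoras, by completing the square in each coefficient: the Legendre coefficients give the
    best approximation, and [defect] is its squared error. *)
Let dist_sum M (c : nat -> R) :
  \int[leb]_(x in `]-1, 1[) (u x - (\sum_(n < M) c n *: P n).[x]) ^+ 2 =
  defect M + \sum_(n < M) w n * (c n - legendre_coef u n) ^+ 2.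
Proof.
rewrite sq_dist (orth_sum M c).1 J_sum /defect -!addrA; congr (_ + _).
rewrite -sumrN -big_split/= mulr_sumr -sumrN -big_split/=.
by apply: eq_bigr => n _; ring.
Qed.

Lemma legendre_projE N x : legendre_proj N u x = (\sum_(n < N.+1) legendre_coef u n *: P n).[x].
Proof.
rewrite /legendre_proj horner_sum; apply: eq_bigr => n _.
by rewrite (hornerZ (legendre_coef u n) (P n) x).
Qed.

Let defect_proj N : \int[leb]_(x in `]-1, 1[) (u x - legendre_proj N u x) ^+ 2 = defect N.+1.
Proof.
transitivity (\int[leb]_(x in `]-1, 1[) (u x - (\sum_(n < N.+1) legendre_coef u n *: P n).[x]) ^+ 2).
  by apply: eq_Rintegral => x _; rewrite legendre_projE.
by rewrite dist_sum big1 ?addr0// => n _; rewrite subrr expr0n mulr0.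
Qed.

Hypothesis uc : forall e : R, 0 < e -> exists2 d : R, 0 < d & forall x y : R, -1 <= x -> x <= y -> y <= 1 -> y - x < d -> `|u y - u x| < e.
Hypothesis uC1 : forall x : R, -1 <= x -> x <= 1 -> `|u x| <= C.

Lemma legendre_proj_cvg e : 0 < e -> exists M, forall N, (M <= N)%N ->
  \int[leb]_(x in `]-1, 1[) (u x - legendre_proj N u x) ^+ 2 <= e.
Proof.
(* A uniform error [2 s] on an interval of length [2] costs [8 s^2 <= 8 s <= e]. *)
move=> e0; pose s := Num.min 1 (e / 8).
have s0 : 0 < s by rewrite lt_min ltr01 divr_gt0.
have s1 : s <= 1 by rewrite ge_min lexx.
have s2 : s <= e / 8 by rewrite ge_min lexx orbT.
have [p hp] := weierstrass s0 uC1 (uc s0).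
have [M [c pE]] := legendre_span_poly p.
exists M => N MN; rewrite defect_proj.
apply: (@le_trans _ _ (\int[leb]_(x in `]-1, 1[) (u x - p.[x]) ^+ 2)).
  rewrite pE (legendre_span_pad c (leqW MN)) (dist_sum N.+1 (fun n => if (n < M)%N then c n else 0)).
  by rewrite lerDl; apply: sumr_ge0 => n _; rewrite mulr_ge0 ?sqr_ge0// ltW// legendre_weight_gt0.
have bO x : `]-1, 1[%classic x -> (u x - p.[x]) ^+ 2 <= 4 * s ^+ 2.
  rewrite /= in_itv/= => /andP[x0 x1]; rewrite -real_normK ?num_real//.
  have -> : 4 * s ^+ 2 = (s + s) ^+ 2 by ring.
  by rewrite ler_pXn2r ?nnegrE ?addr_ge0 ?(ltW s0)// hp// ltW.
have ms : measurable_fun (`]-1, 1[%classic : set R) (fun x => (u x - p.[x]) ^+ 2).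
  apply: measurable_funX; apply: measurable_funB => //.
  by have /integrableP[/measurable_EFinP] := poly_integrable p.
apply: (@le_trans _ _ (\int[leb]_(x in `]-1, 1[) (4 * s ^+ 2))).
  apply: (@le_Rintegral _ _ R leb _ _ _ mO) => //.
  - apply: (@itv_integrable_bounded _ _ _ _ (4 * s ^+ 2)) => // x x0 x1.
    by rewrite ger0_norm ?sqr_ge0// bO//= in_itv/= x0.
  - apply: (@itv_integrable_bounded _ _ _ _ (4 * s ^+ 2)) => [|x _ _]; first exact: measurable_cst.
    by rewrite ger0_norm// mulr_ge0// sqr_ge0.
have lO : fine (leb `]-1, 1[) = 2.
  have N11 : -1 < 1 :> R by lra.
  by rewrite lebesgue_measure_itv/= lte_fin N11/= opprK.
apply: (le_trans (y := 4 * s ^+ 2 * 2)).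
  rewrite le_eqVlt; apply/orP; left; apply/eqP; apply: (etrans (@Rintegral_cst _ _ R leb _ mO (4 * s ^+ 2))).
  by congr (_ * _); exact: lO.
have : s ^+ 2 <= s by rewrite expr2 ler_piMr// ltW.
by lra.
Qed.

Lemma legendre_proj_tail N M : (N <= M)%N ->
  \int[leb]_(x in `]-1, 1[) (u x - legendre_proj N u x) ^+ 2 =
  \int[leb]_(x in `]-1, 1[) (u x - legendre_proj M u x) ^+ 2 +
  \sum_(N.+1 <= n < M.+1) w n * legendre_coef u n ^+ 2.
Proof.
move=> NM; rewrite !defect_proj /defect -!(big_mkord xpredT (fun n => w n * legendre_coef u n ^+ 2)).
by rewrite [X in _ = _ - X + _](big_cat_nat (n := N.+1))//= opprD addrA addrNK.
Qed.

Lemma legendre_L2_error N T : (forall M, (N <= M)%N -> \sum_(N.+1 <= n < M.+1) w n * legendre_coef u n ^+ 2 <= T) ->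
  \int[leb]_(x in `]-1, 1[) (u x - legendre_proj N u x) ^+ 2 <= T.
Proof.
move=> hT; apply/ler_addgt0Pl => e e0; have [M hM] := legendre_proj_cvg e0.
pose K := maxn N M; rewrite (legendre_proj_tail (leq_maxl N M)); apply: lerD; first exact: hM (leq_maxr N M).
exact: hT (leq_maxl N M).
Qed.

Lemma legendre_proj_diff N M x : (N <= M)%N -> -1 <= x -> x <= 1 ->
  `|legendre_proj M u x - legendre_proj N u x| <= \sum_(N.+1 <= n < M.+1) `|legendre_coef u n|.
Proof.
move=> NM x0 x1; rewrite /legendre_proj -!(big_mkord xpredT (fun n => legendre_coef u n * (P n).[x])).
rewrite [X in `|X - _|](big_cat_nat (n := N.+1))//= addrAC subrr add0r (le_trans (ler_norm_sum _ _ _))//.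
apply: ler_sum => n _; rewrite normrM ler_piMr//; exact: legendre_le1.
Qed.

Lemma legendre_proj_le N x : -1 <= x -> x <= 1 ->
  `|legendre_proj N u x| <= \sum_(n < N.+1) `|legendre_coef u n|.
Proof.
move=> x0 x1; rewrite (le_trans (ler_norm_sum _ _ _))//; apply: ler_sum => n _.
by rewrite normrM ler_piMr//; exact: legendre_le1.
Qed.

(** Mean square convergence alone says nothing at a point. But an excess over [S] at [x] persists on
    an interval by continuity, and since [|P_n| <= 1] every later projection differs from the [N]-th
    by at most [S]; the excess would remain in the mean square error of all of them. *)
Lemma legendre_sup_error N S : (forall M, (N <= M)%N -> \sum_(N.+1 <= n < M.+1) `|legendre_coef u n| <= S) ->
  forall x : R, -1 < x -> x < 1 -> `|u x - legendre_proj N u x| <= S.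
Proof.
move=> hS x x0 x1; apply/ler_addgt0Pl => e' e'0; rewrite leNgt; apply/negP => bad.
pose e := e' / 4; have e0 : 0 < e by rewrite divr_gt0.
have [d1 d10 hd1] := uc e0.
have cp : {for x, continuous (legendre_proj N u)}.
  have -> : legendre_proj N u = horner (\sum_(n < N.+1) legendre_coef u n *: P n).
    by apply/funext => y; rewrite legendre_projE.
  exact: is_derive1_continuous (is_derive_poly _ x).
have [d2 /= d20 hd2] : \forall y \near x, `|legendre_proj N u x - legendre_proj N u y| < e.
  by move/cvgrPdist_lt : cp; apply.
pose d := Num.min (Num.min d1 d2) (Num.min (x + 1) (1 - x)).
have d0 : 0 < d by rewrite !lt_min d10 d20 !subr_gt0 -ltrBlDr sub0r x0 x1.
have [dd1 [dd2 [dx1 dx2]]] : d <= d1 /\ d <= d2 /\ d <= x + 1 /\ d <= 1 - x.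
  by rewrite !ge_min !lexx !orbT.
pose A : set R := `]x - d, x + d[%classic.
have AO y : A y -> -1 < y /\ y < 1 by rewrite /A /= in_itv/= => /andP[y1 y2]; split; lra.
have low y : A y -> S + e <= `|u y - legendre_proj N u y|.
  move=> Ay; have [y0 y1] := AO y Ay.
  have yx : `|x - y| < d by move: Ay; rewrite /A /= in_itv/= ltr_norml => /andP[? ?]; apply/andP; split; lra.
  have h1 : `|u x - u y| < e.
    have [xy|yx'] := leP x y.
      rewrite distrC; apply: hd1; [exact: ltW|exact: xy|exact: ltW|].
      by move: yx; rewrite distrC ger0_norm ?subr_ge0// => h; exact: lt_le_trans h dd1.
    apply: hd1; [exact: ltW|exact: ltW|exact: ltW|].
    by move: yx; rewrite gtr0_norm ?subr_gt0// => h; exact: lt_le_trans h dd1.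
  have h2 : `|legendre_proj N u x - legendre_proj N u y| < e by apply: hd2; exact: lt_le_trans yx dd2.
  have h3 : `|u x - legendre_proj N u x| <= `|u y - legendre_proj N u y| + (`|u x - u y| + `|legendre_proj N u x - legendre_proj N u y|).
    have -> : u x - legendre_proj N u x = (u y - legendre_proj N u y) + ((u x - u y) - (legendre_proj N u x - legendre_proj N u y)) by ring.
    by rewrite (le_trans (ler_normD _ _))// lerD2l ler_normB.
  move: bad h1 h2 h3; rewrite /e; move: (`|_|) (`|_|) (`|_|) (`|_|) => t1 t2 t3 t4; lra.
(* Half of [2 d e^2], a lower bound for the squared error on the interval [A] of length [2 d]. *)
have t0 : 0 < d * e ^+ 2 by rewrite mulr_gt0// exprn_gt0.
have [M0 hM0] := legendre_proj_cvg t0.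
pose M := maxn N M0; have NM : (N <= M)%N by exact: leq_maxl.
have := hM0 M (leq_maxr N M0); apply/negP; rewrite -ltNge.
have mA : measurable A by rewrite /A; exact: measurable_itv.
have sA : A `<=` `]-1, 1[%classic by move=> y /AO[y0 y1]; rewrite /= in_itv/= y0.
have low2 y : A y -> e ^+ 2 <= (u y - legendre_proj M u y) ^+ 2.
  move=> Ay; have [y0 y1] := AO y Ay; have := low y Ay.
  have := legendre_proj_diff NM (ltW y0) (ltW y1); have := hS M NM.
  rewrite -[(u y - _) ^+ 2]real_normK ?num_real//.
  have := ler_normD (u y - legendre_proj M u y) (legendre_proj M u y - legendre_proj N u y).
  rewrite addrA subrK => h1 h2 h3 h4.
  rewrite ler_pXn2r ?nnegrE ?(ltW e0)//.
  by move: h1 h2 h3 h4; move: (`|_|) (`|_|) (`|_|) (\sum_(_ <= _ < _) _) => t1 t2 t3 t4; lra.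
have ms : measurable_fun (`]-1, 1[%classic : set R) (fun x => (u x - legendre_proj M u x) ^+ 2).
  apply: measurable_funX; apply: measurable_funB => //.
  rewrite (_ : legendre_proj M u = horner (\sum_(n < M.+1) legendre_coef u n *: P n)); last first.
    by apply/funext => y; rewrite legendre_projE.
  by have /integrableP[/measurable_EFinP] := poly_integrable (\sum_(n < M.+1) legendre_coef u n *: P n).
pose K1 := C + \sum_(n < M.+1) `|legendre_coef u n|.
have iO : leb.-integrable `]-1, 1[ (EFin \o (fun x => (u x - legendre_proj M u x) ^+ 2)).
  apply: (@itv_integrable_bounded _ _ _ _ (K1 ^+ 2)) => // y y0 y1.
  have hK : `|u y - legendre_proj M u y| <= K1.
    by rewrite (le_trans (ler_normB _ _))// lerD ?uC// legendre_proj_le// ltW.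
  by rewrite normrX lerXn2r// nnegrE// (le_trans _ hK).
have iA : leb.-integrable `]-1, 1[ (EFin \o (fun x : R => \1_A x)).
  apply: (@itv_integrable_bounded _ _ _ _ 1); first exact: measurable_indic.
  by move=> y _ _; rewrite indicE; case: (y \in _); rewrite ?normr1// normr0.
have eA : \int[leb]_(x in `]-1, 1[) \1_A x = 2 * d.
  rewrite /Rintegral integral_indic//.
  have -> : A `&` `]-1, 1[%classic = A by exact/setIidl.
  have dd : x - d < x + d by lra.
  have lA : leb A = ((x + d) - (x - d))%:E by rewrite /A lebesgue_measure_itv/= lte_fin dd.
  apply: (etrans (congr1 fine lA)); rewrite /=; ring.
apply: (@lt_le_trans _ _ (\int[leb]_(x in `]-1, 1[) (e ^+ 2 * \1_A x))).
  apply: (lt_le_trans (y := e ^+ 2 * (2 * d))).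
    by rewrite mulrC ltr_pM2l ?exprn_gt0//; lra.
  rewrite le_eqVlt; apply/orP; left; apply/eqP/esym.
  by apply: (etrans (@RintegralZl _ _ R leb _ _ (e ^+ 2) mO iA)); congr (_ * _); exact: eA.
apply: (@le_Rintegral _ _ R leb _ _ _ mO) => //.
  exact: (@integrableZ1 _ _ R leb _ _ (e ^+ 2) mO iA).
move=> y _; rewrite indicE.
case: (boolP (y \in A)) => [/set_mem Ay|_]; last by rewrite mulr0 sqr_ge0.
by rewrite mulr1 low2.
Qed.

End LegendreExpansion.

(** * Summation of the coefficient bounds *)

Section Telescoping.
Context {R : realType}.
Variables (f T : nat -> R) (N : nat).
Hypothesis T0 : forall n, (N <= n)%N -> 0 <= T n.

Lemma telescope_one M : (forall n, (N <= n)%N -> f n.+1 <= T n - T n.+1) -> (N <= M)%N ->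
  \sum_(N.+1 <= n < M.+1) f n <= T N.
Proof.
move=> fT NM; suff h : \sum_(N.+1 <= n < M.+1) f n <= T N - T M.
  by rewrite (le_trans h)// gerBl T0.
move: NM; elim: M => [|M IH] NM; first by move: NM; rewrite leqn0 => /eqP ->; rewrite big_geq// subrr.
move: NM; rewrite leq_eqVlt => /predU1P[<-|NM]; first by rewrite big_geq// subrr.
rewrite big_nat_recr//=; have h1 := IH NM; have h2 := fT M NM; lra.
Qed.

(** Steps of two leave the two boundary terms [T N] and [T N.+1], merged by monotonicity at [N] into
    the factor [2]. *)
Lemma telescope_two M : (forall n, (N <= n)%N -> f n.+1 <= T n - T n.+2) -> T N.+1 <= T N -> (N <= M)%N ->
  \sum_(N.+1 <= n < M.+1) f n <= 2 * T N.
Proof.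
move=> fT TN NM; suff h : \sum_(N.+1 <= n < M.+1) f n <= T N + T N.+1 - T M - T M.+1.
  by have h1 := T0 NM; have h2 := T0 (leqW NM); lra.
move: NM; elim: M => [|M IH] NM; first by move: NM; rewrite leqn0 => /eqP ->; rewrite big_geq//; lra.
move: NM; rewrite leq_eqVlt => /predU1P[<-|NM]; first by rewrite big_geq//; lra.
rewrite big_nat_recr//=; have h1 := IH NM; have h2 := fT M NM; lra.
Qed.

End Telescoping.

(** * Sums of Gamma quotients *)

Section GammaQuotientSums.
Context {R : realType}.
Implicit Types (s x : R) (n N M : nat).

Lemma abs_sin_shift x n : `|sin (x + n%:R * pi)| = `|sin x|.
Proof.
elim: n => [|n IH]; first by rewrite mul0r addr0.
by rewrite -natr1 mulrDl mul1r addrA sinDpi normrN.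
Qed.

(** For [x = (n - s + 1) / 2] and [y = (n + s) / 2], the difference of [gamma x / gamma y] over two
    degrees is [(y - x) * gamma x / gamma (y + 1)] with [y - x = s - 1/2]; this is where [1/2]
    enters. Monotonicity of [T] at [N] is log-convexity. *)
Lemma sonin_sum s N M : 1 / 2 < s -> s <= N%:R -> (N <= M)%N ->
  \sum_(N.+1 <= n < M.+1) gamma ((n%:R - s) / 2) / gamma ((n%:R + s + 1) / 2) <=
  2 / (s - 1 / 2) * (gamma ((N%:R - s + 1) / 2) / gamma ((N%:R + s) / 2)).
Proof.
move=> s2 sN NM; have s12 : 0 < s - 1 / 2 by rewrite subr_gt0.
pose T n := (s - 1 / 2)^-1 * (gamma ((n%:R - s + 1) / 2) / gamma ((n%:R + s) / 2)).
have pos n : (N <= n)%N -> 0 < (n%:R - s + 1) / 2 /\ 0 < (n%:R + s) / 2.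
  rewrite -(ler_nat R) => Nn; have n0 : 0 <= n%:R :> R by [].
  by split; rewrite divr_gt0//; lra.
have T0 n : (N <= n)%N -> 0 <= T n.
  move=> /pos[p1 p2]; have g1 := gamma_gt0 p1; have g2 := gamma_gt0 p2; rewrite /T; sign.
have -> : 2 / (s - 1 / 2) * (gamma ((N%:R - s + 1) / 2) / gamma ((N%:R + s) / 2)) = 2 * T N by rewrite /T mulrA.
apply: telescope_two => // [n Nn|].
- have [p1 p2] := pos n Nn; have g1 := gamma_gt0 p1; have g2 := gamma_gt0 p2.
  rewrite /T -[n.+2%:R]natr1 -[n.+1%:R]natr1.
  have -> : (n%:R + 1 + 1 - s + 1) / 2 = (n%:R - s + 1) / 2 + 1 by field.
  have -> : (n%:R + 1 + 1 + s) / 2 = (n%:R + s) / 2 + 1 by field.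
  have -> : (n%:R + 1 - s) / 2 = (n%:R - s + 1) / 2 by field.
  have -> : (n%:R + 1 + s + 1) / 2 = (n%:R + s) / 2 + 1 by field.
  rewrite !gammaS//.
  have e : s - 1 / 2 = (n%:R + s) / 2 - (n%:R - s + 1) / 2 by field.
  rewrite e in s12 *; move: ((n%:R + s) / 2) ((n%:R - s + 1) / 2) p1 p2 s12 g1 g2 => y x p1 p2 xy.
  move: (gamma x) (gamma y) => gx gy g1 g2.
  rewrite le_eqVlt; apply/orP; left; apply/eqP; field.
  by rewrite !gt_eqF.
- have [p1 p2] := pos N (leqnn N); have [p3 p4] := pos N.+1 (leqnSn N).
  rewrite /T ler_pM2l ?invr_gt0// ler_pdivrMr ?gamma_gt0// mulrAC ler_pdivlMr ?gamma_gt0//.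
  have h : 0 < 2^-1 :> R by rewrite invr_gt0.
  have := gamma_log_convex p1 h (ltW s12).
  have -> : (N%:R - s + 1) / 2 + 2^-1 = (N.+1%:R - s + 1) / 2 by rewrite -[N.+1%:R]natr1; field.
  have -> : (N%:R - s + 1) / 2 + (s - 1 / 2) = (N%:R + s) / 2 by field.
  by have -> : (N.+1%:R - s + 1) / 2 + (s - 1 / 2) = (N.+1%:R + s) / 2 by field.
Qed.

(** What remains beside [|sin (s * pi)|] when the reflection formula bounds the weighted value at
    [-1]. *)
Definition endpoint_term s n : R := (2 * n%:R + 1) * 2 `^ s * gamma (s + 1) / pi * (gamma (n%:R - s) / gamma (n%:R + s + 2)).

Lemma endpoint_term_ge0 s n : 0 < s -> s < n%:R -> 0 <= endpoint_term s n.
Proof.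
move=> s0 sn; have p0 := pi_gt0 R; have n0 : 0 <= n%:R :> R by [].
have a1 : 0 < s + 1 by lra. have a2 : 0 < n%:R - s by rewrite subr_gt0. have a3 : 0 < n%:R + s + 2 by lra.
have g1 := gamma_gt0 a1; have g2 := gamma_gt0 a2; have g3 := gamma_gt0 a3.
by rewrite /endpoint_term; sign.
Qed.

Lemma rint_legendre_endpoint s n : 0 < s -> s < n%:R ->
  (2 * n%:R + 1) / 2 * `|rint (s + 1) (legendre n) (-1)| <= `|sin (s * pi)| * endpoint_term s n.
Proof.
move=> s0 sn; have n0 : 0 <= n%:R :> R by []; have p0 := pi_gt0 R.
have a1 : 0 < s + 1 by lra. have a2 : 0 < n%:R - s by rewrite subr_gt0. have a3 : 0 < n%:R + s + 2 by lra.
have g1 := gamma_gt0 a1; have g2 := gamma_gt0 a2; have g3 := gamma_gt0 a3.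
rewrite rint_legendre_atN1//.
have -> : s + 1 + n%:R + 1 = n%:R + s + 2 by ring.
have -> : s + 1 - n%:R = 1 - (n%:R - s) by ring.
have := rgamma_reflection_le a2; rewrite (rgamma_pos a3).
have -> : pi * (n%:R - s) = - (s * pi) + n%:R * pi by ring.
rewrite abs_sin_shift sinN normrN.
move: (rgamma (1 - _)) => r hr.
have t0 : 0 < 2 `^ (s + 1) :> R by rewrite powR_gt0.
have q0 : 0 < (gamma (n%:R + s + 2))^-1 by rewrite invr_gt0.
rewrite !normrM (gtr0_norm t0) (gtr0_norm g1) (gtr0_norm q0).
rewrite powR_addr// powRr1// /endpoint_term.
have -> : `|sin (s * pi)| * ((2 * n%:R + 1) * 2 `^ s * gamma (s + 1) / pi * (gamma (n%:R - s) / gamma (n%:R + s + 2))) =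
   ((2 * n%:R + 1) / 2 * (2 `^ s * 2 * gamma (s + 1) / gamma (n%:R + s + 2))) * (gamma (n%:R - s) * `|sin (s * pi)| / pi).
  move: (gamma _) (gamma _) (gamma _) (`|_|) (2 `^ s) g3 => u1 u2 u3 u4 u5 g3'.
  by move: (pi : R) p0 => pp p0; field; rewrite !gt_eqF.
rewrite mulrA; apply: ler_wpM2l => //; have k0 : 0 <= 2 * n%:R + 1 :> R by lra.
by sign.
Qed.

(** With [x = n - s + 1] and [y = n + s + 1], two steps produce
    [y (y + 1) - x (x + 1) = 2 s (2 n + 3)], exactly the weight of degree [n + 1], so the sum
    telescopes without loss. *)
Lemma endpoint_sum s N M : 0 < s -> s <= N%:R -> (N <= M)%N ->
  \sum_(N.+1 <= n < M.+1) endpoint_term s n <=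
  2 `^ s * gamma (s + 1) / (pi * s) * (gamma (N%:R - s + 1) / gamma (N%:R + s + 1)).
Proof.
move=> s0 sN NM; have p0 := pi_gt0 R.
pose A n := 2^-1 * (2 `^ s * gamma (s + 1) / (pi * s) * (gamma (n%:R - s + 1) / gamma (n%:R + s + 1))).
have t0 : 0 < 2 `^ s :> R by rewrite powR_gt0.
have a1 : 0 < s + 1 by lra. have g1 := gamma_gt0 a1.
have pos n : (N <= n)%N -> 0 < n%:R - s + 1 /\ 0 < n%:R + s + 1.
  rewrite -(ler_nat R) => Nn; have n0 : 0 <= n%:R :> R by [].
  by split; lra.
have A0 n : (N <= n)%N -> 0 <= A n.
  move=> /pos[p1 p2]; have g2 := gamma_gt0 p1; have g3 := gamma_gt0 p2; rewrite /A; sign.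
have -> : 2 `^ s * gamma (s + 1) / (pi * s) * (gamma (N%:R - s + 1) / gamma (N%:R + s + 1)) = 2 * A N.
  by rewrite /A mulVKf.
apply: telescope_two => // [n Nn|].
- have [p1 p2] := pos n Nn; have g2 := gamma_gt0 p1; have g3 := gamma_gt0 p2.
  have [p3 p4] := pos n.+1 (leqW Nn).
  rewrite /A /endpoint_term -[n.+2%:R]natr1; rewrite -[n.+1%:R]natr1 in p3 p4 *.
  have -> : n%:R + 1 + 1 - s + 1 = (n%:R - s + 1) + 1 + 1 by ring.
  have -> : n%:R + 1 + 1 + s + 1 = (n%:R + s + 1) + 1 + 1 by ring.
  have -> : n%:R + 1 - s = n%:R - s + 1 by ring.
  have -> : n%:R + 1 + s + 2 = (n%:R + s + 1) + 1 + 1 by ring.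
  have p5 : 0 < n%:R - s + 1 + 1 by lra. have p6 : 0 < n%:R + s + 1 + 1 by lra.
  rewrite (gammaS p5) (gammaS p6) (gammaS p1) (gammaS p2).
  move: (gamma (n%:R - s + 1)) (gamma (n%:R + s + 1)) (gamma (s + 1)) (2 `^ s) g1 g2 g3 t0 => u1 u2 u3 u4 g1 g2 g3 t0.
  move: (pi : R) p0 => pp p0.
  rewrite le_eqVlt; apply/orP; left; apply/eqP; field.
  by rewrite !gt_eqF.
- have [p1 p2] := pos N (leqnn N); have g2 := gamma_gt0 p1; have g3 := gamma_gt0 p2.
  rewrite /A; apply: ler_wpM2l; first by sign.
  apply: ler_wpM2l; first by sign.
  rewrite -natr1.
  have -> : N%:R + 1 - s + 1 = (N%:R - s + 1) + 1 by ring.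
  have -> : N%:R + 1 + s + 1 = (N%:R + s + 1) + 1 by ring.
  rewrite (gammaS p1) (gammaS p2) -mulf_div ler_piMl//; first by sign.
  by rewrite ler_pdivrMr// mul1r; lra.
Qed.

(** Raising [s] by one multiplies the term by [2 (s + 1)] over [(n + s + 2) (n - s - 1)]. It serves
    to absorb all the endpoint terms of (ii) in the first. *)
Lemma endpoint_term_decreasing s n : 0 < s -> s + 2 < n%:R -> endpoint_term (s + 1) n <= endpoint_term s n.
Proof.
move=> s0 sn; have p0 := pi_gt0 R; have n0 : 0 <= n%:R :> R by [].
rewrite /endpoint_term.
have a1 : 0 < s + 1 by lra. have a2 : 0 < n%:R - (s + 1) by lra. have a3 : 0 < n%:R + s + 2 by lra.
have -> : n%:R - s = n%:R - (s + 1) + 1 by ring.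
have -> : n%:R + (s + 1) + 2 = n%:R + s + 2 + 1 by ring.
rewrite (gammaS a1) (gammaS a2) (gammaS a3) powR_addr// powRr1//.
have g1 := gamma_gt0 a1; have g2 := gamma_gt0 a2; have g3 := gamma_gt0 a3.
have t0 : 0 < 2 `^ s :> R by rewrite powR_gt0.
have -> : (2 * n%:R + 1) * (2 `^ s * 2) * ((s + 1) * gamma (s + 1)) / pi * (gamma (n%:R - (s + 1)) / ((n%:R + s + 2) * gamma (n%:R + s + 2))) =
  ((2 * n%:R + 1) * 2 `^ s * gamma (s + 1) / pi * (gamma (n%:R - (s + 1)) / gamma (n%:R + s + 2))) * (2 * (s + 1) / (n%:R + s + 2)).
  move: (gamma _) (gamma _) (gamma _) (2 `^ s) g1 g2 g3 => u1 u2 u3 u4 g1 g2 g3.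
  by move: (pi : R) p0 => pp p0; field; rewrite !gt_eqF.
have -> : (2 * n%:R + 1) * 2 `^ s * gamma (s + 1) / pi * ((n%:R - (s + 1)) * gamma (n%:R - (s + 1)) / gamma (n%:R + s + 2)) =
  ((2 * n%:R + 1) * 2 `^ s * gamma (s + 1) / pi * (gamma (n%:R - (s + 1)) / gamma (n%:R + s + 2))) * (n%:R - (s + 1)) by ring.
have k0 : 0 <= 2 * n%:R + 1 :> R by lra.
apply: ler_wpM2l; first by sign.
by rewrite ler_pdivrMr//; nra.
Qed.

(** [b d] is at most [a c] times the geometric mean of [p] and [q], hence at most [a c] times their
    arithmetic mean; squaring avoids the roots. *)
Lemma sqrt_product_le (p q a b c d : R) : 0 < a -> 0 < b -> 0 < c -> 0 < d -> 0 < p -> 0 < q ->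
  b ^+ 2 <= p * a ^+ 2 -> d ^+ 2 <= q * c ^+ 2 -> 2 * (b * d) <= (p + q) * (a * c).
Proof.
move=> a0 b0 c0 d0 p0 q0 ba dc.
have e1 : 0 <= 2 * (b * d) by apply: mulr_ge0 => //; sign.
have e2 : 0 <= (p + q) * (a * c) by sign.
rewrite -(@ler_pXn2r _ 2) ?nnegrE// !exprMn.
have h : b ^+ 2 * d ^+ 2 <= p * a ^+ 2 * (q * c ^+ 2) by apply: ler_pM => //; exact: sqr_ge0.
apply: (le_trans (ler_wpM2l _ h)); first exact: sqr_ge0.
have -> : 2 ^+ 2 * (p * a ^+ 2 * (q * c ^+ 2)) = (4 * (p * q)) * (a ^+ 2 * c ^+ 2) by ring.
apply: ler_wpM2r; first by sign.
rewrite -subr_ge0; have -> : (p + q) ^+ 2 - 4 * (p * q) = (p - q) ^+ 2 by ring.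
exact: sqr_ge0.
Qed.

(** The squares telescope only as an inequality. The duplication formula rewrites [T n - T n.+1] at
    the half arguments [p] and [q], and the claim becomes [2 b d <= (2 n + 3) a c], while
    [sqrt_product_le] gives it with [p + q = n + 1]. *)
Lemma sonin_sum_L2 s N M : 0 < s -> s < N%:R -> (N <= M)%N ->
  \sum_(N.+1 <= n < M.+1) legendre_weight n *
     ((2 `^ s * Num.sqrt pi)^-1 * (gamma ((n%:R - s) / 2) / gamma ((n%:R + s + 1) / 2))) ^+ 2 <=
  4 / ((2 * s + 1) * pi) * (gamma (N%:R - s) / gamma (N%:R + s + 1)).
Proof.
move=> s0 sN NM; have pi0 := pi_gt0 R.
pose T n := 4 / ((2 * s + 1) * pi) * (gamma (n%:R - s) / gamma (n%:R + s + 1)).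
have s21 : 0 < 2 * s + 1 by lra.
have pos n : (N <= n)%N -> 0 < n%:R - s /\ 0 < n%:R + s + 1.
  rewrite -(ler_nat R) => Nn; have n0 : 0 <= n%:R :> R by [].
  by split; lra.
apply: (@telescope_one _ _ T) => // [n Nn|n Nn].
  have [p1 p2] := pos n Nn; have g1 := gamma_gt0 p1; have g2 := gamma_gt0 p2; rewrite /T.
  by rewrite mulr_ge0// divr_ge0// ltW// mulr_gt0.
have [p1 p2] := pos n Nn; have g1 := gamma_gt0 p1; have g2 := gamma_gt0 p2.
have n0 : 0 <= n%:R :> R by [].
rewrite /T /legendre_weight -[n.+1%:R]natr1.
pose p := (n%:R - s) / 2; pose q := (n%:R + 1 + s + 1) / 2.
have p0 : 0 < p by rewrite divr_gt0. have q0 : 0 < q by rewrite /q; lra.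
have h0 : 0 < 2^-1 :> R by rewrite invr_gt0.
have ph : 0 < p + 2^-1 by rewrite addr_gt0. have qh : 0 < q + 2^-1 by rewrite addr_gt0.
have -> : (n%:R + 1 - s) / 2 = p + 2^-1 by rewrite /p; field.
have -> : (n%:R + 1 + s + 1) / 2 = q by [].
have -> : n%:R + 1 - s = n%:R - s + 1 by ring.
have -> : n%:R + 1 + s + 1 = n%:R + s + 1 + 1 by ring.
have d1 := gamma_duplication p0; have d2 := gamma_duplication q0.
have e1 : 2 * p = n%:R - s by rewrite /p; field.
have e2 : 2 * q = n%:R + s + 1 + 1 by rewrite /q; field.
have pq : p + q = n%:R + 1 by rewrite /p /q; field.
rewrite e1 in d1; rewrite e2 in d2.
have key := sqrt_product_le (gamma_gt0 p0) (gamma_gt0 ph) (gamma_gt0 q0) (gamma_gt0 qh) p0 q0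
  (gamma_half_bound p0) (gamma_half_bound q0).
rewrite pq in key.
have t0 : 0 < 2 `^ s :> R by rewrite powR_gt0.
have tt0 : 0 < 2 `^ (n%:R - s) :> R by rewrite powR_gt0.
have e3 : 2 `^ (n%:R + s + 1 + 1) = 2 `^ (n%:R - s) * 2 `^ s ^+ 2 * 4 :> R.
  have -> : n%:R + s + 1 + 1 = (n%:R - s) + s + s + 1 + 1 by ring.
  by rewrite !(powR_addr _ _ (ltr0Sn R 1)) powRr1//; ring.
rewrite e3 in d2; rewrite (gammaS p1); rewrite (gammaS p2) in d2 *.
have g0 : 0 < gamma 2^-1 :> R by exact: gamma_gt0.
move: d1 d2 key g1 g2 g0 (gamma_gt0 p0) (gamma_gt0 ph) (gamma_gt0 q0) (gamma_gt0 qh) t0 tt0.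
rewrite [(_ * Num.sqrt pi)^-1]invfM [(_ / _ * _) ^+ 2]exprMn [(_^-1 / _) ^+ 2]exprMn.
rewrite [(Num.sqrt pi)^-1 ^+ 2]exprVn sqr_sqrtr ?(ltW pi0)//.
move: (gamma (p + 2^-1)) (gamma p) (gamma (q + 2^-1)) (gamma q) (gamma (n%:R - s)) (gamma (n%:R + s + 1)) (gamma 2^-1) (2 `^ (n%:R - s)) (2 `^ s) (pi : R) pi0.
move=> b a d c u v G t k P P0 d1 d2 key u0 v0 G0 a0 b0 c0 d0 k0 t0.
have -> : 4 / ((2 * s + 1) * P) * (u / v) - 4 / ((2 * s + 1) * P) * ((n%:R - s) * u / ((n%:R + s + 1) * v)) =
   4 / P * (2 * G * u) / (2 * G * ((n%:R + s + 1) * v)).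
  by field; rewrite !gt_eqF.
rewrite d1 d2.
have -> : 4 / P * (t * a * b) / (t * k ^+ 2 * 4 * c * d) = (k^-1 ^+ 2 / P * (b / (c ^+ 2 * d))) * (a * c).
  by field; rewrite !gt_eqF.
have n3 : 0 < 2 * (n%:R + 1) + 1 :> R by lra.
have -> : 2 / (2 * (n%:R + 1) + 1) * (k^-1 ^+ 2 / P * (b / c) ^+ 2) = (k^-1 ^+ 2 / P * (b / (c ^+ 2 * d))) * (2 * (b * d) / (2 * (n%:R + 1) + 1)).
  by field; rewrite !gt_eqF.
apply: ler_wpM2l; first by sign.
rewrite ler_pdivrMr//; apply: (le_trans key); rewrite mulrC; apply: ler_wpM2l; first by sign.
by lra.
Qed.

Lemma endpoint_sum_L2 s N M : 0 < s -> s < N%:R -> (N <= M)%N ->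
  \sum_(N.+1 <= n < M.+1) legendre_weight n * endpoint_term s n ^+ 2 <=
  2 `^ (6 * s + 8) * gamma (s + 1) ^+ 2 / (pi ^+ 2 * (4 * s + 2)) *
  ((N%:R + 1) ^+ 2 * gamma (2 * N%:R - 2 * s + 1) / ((2 * N%:R + 1) ^+ 2 * gamma (2 * N%:R + 2 * s + 3))).
Proof.
move=> s0 sN NM; have pi0 := pi_gt0 R.
pose T n := 2 `^ (6 * s + 6) * gamma (s + 1) ^+ 2 / (pi ^+ 2 * (4 * s + 2)) * (gamma (2 * n%:R - 2 * s + 1) / gamma (2 * n%:R + 2 * s + 3)).
have s42 : 0 < 4 * s + 2 by lra.
have s1 : 0 < s + 1 by lra.
have gs := gamma_gt0 s1.
have tt0 x : 0 < 2 `^ x :> R by rewrite powR_gt0.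
have K0 := tt0 (6 * s + 6).
have pos n : (N <= n)%N -> 0 < 2 * n%:R - 2 * s + 1 /\ 0 < 2 * n%:R + 2 * s + 3.
  rewrite -(ler_nat R) => Nn; have n0 : 0 <= n%:R :> R by [].
  by split; lra.
(* The stated bound is [T N] times [(2 N + 2)^2 / (2 N + 1)^2], since [2 ^ 8] is four times
   [2 ^ 6]. *)
apply: (@le_trans _ _ (T N)); last first.
  have [p1 p2] := pos N (leqnn N); have g1 := gamma_gt0 p1; have g2 := gamma_gt0 p2.
  have N0 : 0 <= N%:R :> R by [].
  rewrite /T; have -> : 2 `^ (6 * s + 8) = 4 * 2 `^ (6 * s + 6) :> R.
    have -> : 6 * s + 8 = 6 * s + 6 + 1 + 1 by ring.
    by rewrite !(powR_addr _ 1 (ltr0Sn R 1)) powRr1//; ring.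
  have n1 : 0 < 2 * N%:R + 1 :> R by lra.
  have -> : 4 * 2 `^ (6 * s + 6) * gamma (s + 1) ^+ 2 / (pi ^+ 2 * (4 * s + 2)) *
    ((N%:R + 1) ^+ 2 * gamma (2 * N%:R - 2 * s + 1) / ((2 * N%:R + 1) ^+ 2 * gamma (2 * N%:R + 2 * s + 3))) =
    2 `^ (6 * s + 6) * gamma (s + 1) ^+ 2 / (pi ^+ 2 * (4 * s + 2)) * (gamma (2 * N%:R - 2 * s + 1) / gamma (2 * N%:R + 2 * s + 3)) *
    (4 * (N%:R + 1) ^+ 2 / (2 * N%:R + 1) ^+ 2).
    move: (gamma _) (gamma _) (gamma _) (2 `^ _) (pi : R) pi0 g1 g2 gs K0 => u v x y P pi0 g1 g2 gs K0.
    by field; rewrite !gt_eqF.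
  rewrite ler_peMr//; first by sign.
  rewrite ler_pdivlMr ?exprn_gt0// mul1r.
  have -> : 4 * (N%:R + 1) ^+ 2 = (2 * N%:R + 2) ^+ 2 :> R by ring.
  by rewrite ler_pXn2r ?nnegrE//; lra.
apply: (@telescope_one _ _ T) => // [n Nn|n Nn].
  have [p1 p2] := pos n Nn; have g1 := gamma_gt0 p1; have g2 := gamma_gt0 p2; rewrite /T; sign.
have [p1 p2] := pos n Nn; have g1 := gamma_gt0 p1; have g2 := gamma_gt0 p2.
have n0 : 0 <= n%:R :> R by [].
have ns : s < n%:R by apply: (lt_le_trans sN); rewrite ler_nat.
rewrite /T /legendre_weight /endpoint_term -[n.+1%:R]natr1.
pose p := n%:R - s + 2^-1; pose q := n%:R + s + 2 + 2^-1.
have h0 : 0 < 2^-1 :> R by rewrite invr_gt0.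
have p0 : 0 < p by rewrite addr_gt0// subr_gt0.
have r0 : 0 < n%:R + s + 2 by lra.
have q0 : 0 < q by rewrite addr_gt0.
have ph : 0 < p + 2^-1 by rewrite addr_gt0. have qh : 0 < q + 2^-1 by rewrite addr_gt0.
have -> : n%:R + 1 - s = p + 2^-1 by rewrite /p; field.
have -> : n%:R + 1 + s + 2 = q + 2^-1 by rewrite /q; field.
have -> : 2 * (n%:R + 1) - 2 * s + 1 = 2 * n%:R - 2 * s + 1 + 1 + 1 by ring.
have -> : 2 * (n%:R + 1) + 2 * s + 3 = 2 * n%:R + 2 * s + 3 + 1 + 1 by ring.
have p11 : 0 < 2 * n%:R - 2 * s + 1 + 1 by lra.
have p21 : 0 < 2 * n%:R + 2 * s + 3 + 1 by lra.
have d1 := gamma_duplication p0; have d2 := gamma_duplication q0.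
have e1 : 2 * p = 2 * n%:R - 2 * s + 1 by rewrite /p; field.
have e2 : 2 * q = 2 * n%:R + 2 * s + 3 + 1 + 1 by rewrite /q; field.
rewrite e1 in d1; rewrite e2 in d2.
have ga := gamma_gt0 p0. have gb := gamma_gt0 ph. have gc := gamma_gt0 q0. have gd := gamma_gt0 qh.
(* The half-step quotient of Gamma is at most the root of [p] at [p], and at least the root of
   [n + s + 2] at [q]; and [p <= n + s + 2]. *)
have key : gamma (p + 2^-1) * gamma q <= gamma p * gamma (q + 2^-1).
  have h1 := gamma_half_bound p0; have h2 := gamma_half_bound r0.
  have gr := gamma_gt0 r0.
  have -> : q + 2^-1 = n%:R + s + 2 + 1 by rewrite /q; field.
  rewrite (gammaS r0); rewrite -/q in h2.
  have k1 : 0 <= gamma (p + 2^-1) * gamma q by sign.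
  have k2 : 0 <= gamma p * ((n%:R + s + 2) * gamma (n%:R + s + 2)) by sign.
  rewrite -(@ler_pXn2r _ 2) ?nnegrE// !exprMn.
  apply: (@le_trans _ _ (p * gamma p ^+ 2 * ((n%:R + s + 2) * gamma (n%:R + s + 2) ^+ 2))).
    by apply: ler_pM => //; exact: sqr_ge0.
  have -> : gamma p ^+ 2 * ((n%:R + s + 2) ^+ 2 * gamma (n%:R + s + 2) ^+ 2) =
    (n%:R + s + 2) * gamma p ^+ 2 * ((n%:R + s + 2) * gamma (n%:R + s + 2) ^+ 2) by ring.
  apply: ler_wpM2r; first by sign.
  apply: ler_wpM2r; first by sign.
  by rewrite /p; lra.
have t0 := tt0 s. have u0 := tt0 (2 * n%:R - 2 * s + 1).
have e3 : 2 `^ (2 * n%:R + 2 * s + 3 + 1 + 1) = 2 `^ (2 * n%:R - 2 * s + 1) * 2 `^ s ^+ 4 * 16 :> R.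
  have -> : 2 * n%:R + 2 * s + 3 + 1 + 1 = (2 * n%:R - 2 * s + 1) + s + s + s + s + 1 + 1 + 1 + 1 by ring.
  move: (2 * n%:R - 2 * s + 1) => A.
  by rewrite !(powR_addr _ 1 (ltr0Sn R 1)) !(powR_addr _ s (ltr0Sn R 1)) powRr1//; ring.
have e4 : 2 `^ (6 * s + 6) = 2 `^ s ^+ 6 * 64 :> R.
  have -> : 6 * s + 6 = s + s + s + s + s + s + 1 + 1 + 1 + 1 + 1 + 1 by ring.
  by rewrite !(powR_addr _ 1 (ltr0Sn R 1)) !(powR_addr _ s (ltr0Sn R 1)) powRr1//; ring.
rewrite e3 in d2; rewrite e4 (gammaS p11) (gammaS p1).
rewrite (gammaS p21) (gammaS p2) in d2 *.
have g0 : 0 < gamma 2^-1 :> R by exact: gamma_gt0.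
move: d1 d2 key g1 g2 g0 ga gb gc gd gs t0 u0.
move: (gamma (p + 2^-1)) (gamma p) (gamma (q + 2^-1)) (gamma q) (gamma (2 * n%:R - 2 * s + 1)) (gamma (2 * n%:R + 2 * s + 3)) (gamma 2^-1) (gamma (s + 1)) (2 `^ (2 * n%:R - 2 * s + 1)) (2 `^ s) (pi : R) pi0.
move=> b a d c u v G W t k P P0 d1 d2 key u0 v0 G0 a0 b0 c0 d0 W0 k0 t0.
have -> : k ^+ 6 * 64 * W ^+ 2 / (P ^+ 2 * (4 * s + 2)) * (u / v) - k ^+ 6 * 64 * W ^+ 2 / (P ^+ 2 * (4 * s + 2)) *
   ((2 * n%:R - 2 * s + 1 + 1) * ((2 * n%:R - 2 * s + 1) * u) / ((2 * n%:R + 2 * s + 3 + 1) * ((2 * n%:R + 2 * s + 3) * v))) =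
   64 * k ^+ 6 * W ^+ 2 / P ^+ 2 * (4 * n%:R + 5) * (2 * G * u) / (2 * G * ((2 * n%:R + 2 * s + 3 + 1) * ((2 * n%:R + 2 * s + 3) * v))).
  by field; rewrite !gt_eqF.
rewrite d1 d2.
have -> : 64 * k ^+ 6 * W ^+ 2 / P ^+ 2 * (4 * n%:R + 5) * (t * a * b) / (t * k ^+ 4 * 16 * c * d) =
   (2 * k ^+ 2 * W ^+ 2 / P ^+ 2 * (b / (c * d ^+ 2))) * (2 * (4 * n%:R + 5) * (a * d)).
  by field; rewrite !gt_eqF.
have n3 : 0 < 2 * (n%:R + 1) + 1 :> R by lra.
have -> : 2 / (2 * (n%:R + 1) + 1) * ((2 * (n%:R + 1) + 1) * k * W / P * (b / d)) ^+ 2 =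
   (2 * k ^+ 2 * W ^+ 2 / P ^+ 2 * (b / (c * d ^+ 2))) * ((2 * (n%:R + 1) + 1) * (b * c)).
  by field; rewrite !gt_eqF.
apply: ler_wpM2l; first by sign.
apply: (le_trans (ler_wpM2l (ltW n3) key)); apply: ler_wpM2r; first by sign.
by lra.
Qed.

End GammaQuotientSums.

(** * Norms on the interval *)

Section OmegaNorms.
Context {R : realType}.
Notation leb := (@lebesgue_measure R).
Implicit Types f : R -> R.

Lemma Lnorm_Omega_sup_le f S : 0 <= S -> (forall x : R, -1 < x -> x < 1 -> `|f x| <= S) ->
  (Lnorm_Omega +oo f <= S%:E)%E.
Proof.
move=> S0 fS; rewrite /Lnorm_Omega unlock; case: ifP => _; last by rewrite lee_fin.
apply/ess_sup_inf.ess_supP; apply: aeW => x /=; rewrite lee_fin patchE; case: ifPn => [/set_mem|_].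
  by rewrite /= in_itv/= => /andP[]; exact: fS.
by rewrite normr0.
Qed.

Lemma Lnorm_Omega_2_le f (C T : R) : measurable_fun (`]-1, 1[%classic : set R) f ->
  (forall x : R, -1 < x -> x < 1 -> `|f x| <= C) ->
  \int[leb]_(x in `]-1, 1[) f x ^+ 2 <= T -> (Lnorm_Omega 2%:E f <= (Num.sqrt T)%:E)%E.
Proof.
move=> mf fC fT.
have if2 : leb.-integrable `]-1, 1[ (EFin \o (fun x => f x ^+ 2)).
  apply: (@itv_integrable_bounded _ _ _ _ (C ^+ 2)); first exact: measurable_funX.
  move=> x x0 x1; have h := fC x x0 x1; rewrite normrX lerXn2r// nnegrE//.
  exact: le_trans h.
have e : (\int[leb]_x (`|((f \_ `]-1, 1[) x)%:E| `^ 2))%E = (\int[leb]_(x in `]-1, 1[) f x ^+ 2)%:E.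
  rewrite /Rintegral fineK; last exact: (@integrable_fin_num _ _ R leb).
  rewrite [RHS]integral_mkcond; apply: eq_integral => x _.
  rewrite abse_EFin poweR_EFin powR_mulrn// real_normK ?num_real// !patchE.
  by case: ifPn => // _; rewrite expr0n.
rewrite /Lnorm_Omega unlock /= e poweR_EFin lee_fin.
rewrite powR12_sqrt; last by apply: Rintegral_ge0 => x _; exact: sqr_ge0.
by apply: ler_wsqrtr.
Qed.

End OmegaNorms.

(** * The two error bounds *)

Section Main.
Context {R : realType}.
Notation leb := (@lebesgue_measure R).
Variables (k m : nat) (mu : R) (u : R -> R) (v : nat -> R -> R).
Hypotheses (hk : (1 <= k)%N) (hmu : k%:R - 1 < mu <= k%:R) (hu : AC_BV_regular mu k m u v).

Let TV := fine (total_variation (-1) 1 (v m)).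
Let L l := `|lim (v l x @[x --> (-1 : R)^'+])|.
Let U := TV + `|sin (mu * pi)| * \sum_(l < m.+1) L l.
Let s := mu + m%:R.
Let sonin_term n : R := (2 `^ s * Num.sqrt pi)^-1 * (gamma ((n%:R - s) / 2) / gamma ((n%:R + s + 1) / 2)).

Let N11 : -1 <= 1 :> R. Proof. by lra. Qed.

Let bvm : bounded_variation (-1) 1 (v m).
Proof. by case: hu => [ud [_ []]]. Qed.

Let mu0 : 0 < mu.
Proof. by case/andP: hmu => h _; apply: le_lt_trans h; rewrite subr_ge0 ler1n. Qed.

Let s0 : 0 < s. Proof. by rewrite ltr_pwDl. Qed.

Let TV0 : 0 <= TV. Proof. by apply: fine_ge0; exact: total_variation_ge0. Qed.

Let L0 l : 0 <= L l. Proof. exact: normr_ge0. Qed.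

Let sL0 : 0 <= \sum_(l < m.+1) L l. Proof. by apply: sumr_ge0 => l _; exact: L0. Qed.

Let sin0 : 0 <= `|sin (mu * pi)| :> R. Proof. exact: normr_ge0. Qed.

Let U0 : 0 <= U. Proof. by apply: addr_ge0 => //; exact: mulr_ge0. Qed.

Lemma U_minusE : U_minus mu m v = U%:E.
Proof.
rewrite /U_minus -[total_variation _ _ _]fineK; last exact/bounded_variationP.
by rewrite -EFinD.
Qed.

Let acu : absolutely_continuous (-1) 1 u.
Proof. by case: hu => [ud [[<- _ h] _]]; exact: h. Qed.

Let term_ge0 n : s < n%:R -> 0 <= sonin_term n.
Proof.
move=> sn; have n0 : 0 <= n%:R :> R by [].
have p1 : 0 < (n%:R - s) / 2 by rewrite divr_gt0// subr_gt0.
have p2 : 0 < (n%:R + s + 1) / 2 by rewrite divr_gt0//; move: s0; lra.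
have g1 := gamma_gt0 p1; have g2 := gamma_gt0 p2.
by apply: mulr_ge0; [rewrite invr_ge0 mulr_ge0 ?powR_ge0 ?sqrtr_ge0|rewrite divr_ge0// ltW].
Qed.

(** The sines at the orders [mu + l] agree up to sign, so a single factor [|sin (mu * pi)|] comes
    out of the sum. *)
Lemma legendre_coef_le n : s < n%:R ->
  `|legendre_coef u n| <= sonin_term n * TV + `|sin (mu * pi)| * \sum_(l < m.+1) L l * endpoint_term (mu + l%:R) n.
Proof.
move=> sn; have n0 : 0 <= n%:R :> R by [].
have n1 : 0 < 2 * n%:R + 1 :> R by rewrite ltr_wpDl// mulr_ge0.
have mun : mu < n%:R by apply: le_lt_trans sn; rewrite lerDl.
have n2 : 0 < (2 * n%:R + 1) / 2 :> R by rewrite divr_gt0.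
have hB (x : R) : -1 < x -> x < 1 -> `|rint (s + 1) (legendre n) x| <= ((2 * n%:R + 1) / 2)^-1 * sonin_term n.
  by move=> x0 x1; rewrite ler_pdivlMl// rint_legendre_bound.
apply: (le_trans (legendre_coef_bound hk hmu hu mun hB)); rewrite mulrDr.
apply: lerD; first by rewrite mulrA mulVKf ?gt_eqF.
rewrite !mulr_sumr; apply: ler_sum => l _.
rewrite mulrCA [leRHS]mulrCA; apply: ler_wpM2l; first exact: L0.
have e : `|sin ((mu + l%:R) * pi)| = `|sin (mu * pi)| by rewrite mulrDl abs_sin_shift.
rewrite -e; apply: rint_legendre_endpoint; first by rewrite ltr_pwDl.
by apply: le_lt_trans sn; rewrite lerD2l ler_nat -ltnS.
Qed.

Let umeas : measurable_fun (`]-1, 1[%classic : set R) u. Proof. exact: ac_measurable acu. Qed.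

(** Both [TV] and each [|sin (mu * pi)| * L l] are at most [U], so every sum over the degree is
    estimated on its own. *)
Lemma sup_error_bound N : 1 / 2 < mu -> s <= N%:R ->
  (Lnorm_Omega +oo (u \- legendre_proj N u)%R
    <= ((1 / (2 `^ (s - 1) * (s - 1 / 2) * Num.sqrt pi) * (gamma ((N%:R - s + 1) / 2) / gamma ((N%:R + s) / 2))
        + \sum_(j < m.+1) 2 `^ (mu + j%:R) * gamma (mu + j%:R + 1) / (pi * (mu + j%:R))
            * (gamma (N%:R - (mu + j%:R) + 1) / gamma (N%:R + (mu + j%:R) + 1))) * U)%:E)%E.
Proof.
move=> mu12 sN; set X := 1 / _ * _; set Y := \sum_(j < _) _.
have sp : 0 < Num.sqrt pi :> R by rewrite sqrtr_gt0 pi_gt0.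
have t0 : 0 < 2 `^ s :> R by rewrite powR_gt0.
have s12 : 0 < s - 1 / 2 by rewrite subr_gt0 (lt_le_trans mu12)// lerDl.
have sn n : (N < n)%N -> s < n%:R by move=> Nn; apply: le_lt_trans sN _; rewrite ltr_nat.
have Yj0 (j : 'I_m.+1) : 0 < mu + j%:R by rewrite ltr_pwDl.
have YjN (j : 'I_m.+1) : mu + j%:R <= N%:R by apply: le_trans sN; rewrite lerD2l ler_nat -ltnS.
have hX M : (N <= M)%N -> \sum_(N.+1 <= n < M.+1) sonin_term n <= X.
  move=> NM; rewrite -mulr_sumr.
  have s2 : 1 / 2 < s by rewrite -subr_gt0.
  have -> : X = (2 `^ s * Num.sqrt pi)^-1 * (2 / (s - 1 / 2) * (gamma ((N%:R - s + 1) / 2) / gamma ((N%:R + s) / 2))).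
    rewrite /X (powR_addr s (-1) (ltr0Sn R 1)) powR_inv1//.
    move: (gamma _ / _) (2 `^ s) t0 (Num.sqrt pi) sp (s - 1 / 2) s12 => g t t0 q q0 r r0.
    by field; rewrite !gt_eqF.
  by apply: ler_wpM2l; [rewrite invr_ge0 mulr_ge0// ltW|exact: sonin_sum].
have hY M (j : 'I_m.+1) : (N <= M)%N -> \sum_(N.+1 <= n < M.+1) endpoint_term (mu + j%:R) n <=
   2 `^ (mu + j%:R) * gamma (mu + j%:R + 1) / (pi * (mu + j%:R)) * (gamma (N%:R - (mu + j%:R) + 1) / gamma (N%:R + (mu + j%:R) + 1)).
  by move=> NM; apply: endpoint_sum.
have X0 : 0 <= X by apply: le_trans (hX N (leqnn N)); rewrite big_geq.
have Y0 (j : 'I_m.+1) : 0 <= 2 `^ (mu + j%:R) * gamma (mu + j%:R + 1) / (pi * (mu + j%:R)) * (gamma (N%:R - (mu + j%:R) + 1) / gamma (N%:R + (mu + j%:R) + 1)).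
  have j0 := Yj0 j; have jN := YjN j; have p0 := pi_gt0 R.
  have p1 : 0 < mu + j%:R + 1 by rewrite addr_gt0.
  have p2 : 0 < N%:R - (mu + j%:R) + 1 by rewrite ltr_pwDr// subr_ge0.
  have p3 : 0 < N%:R + (mu + j%:R) + 1 by rewrite addr_gt0// ltr_wpDl.
  have g1 := gamma_gt0 p1; have g2 := gamma_gt0 p2; have g3 := gamma_gt0 p3.
  by sign.
have tot M : (N <= M)%N -> \sum_(N.+1 <= n < M.+1) `|legendre_coef u n| <= (X + Y) * U.
  move=> NM.
  apply: (@le_trans _ _ (\sum_(N.+1 <= n < M.+1) (sonin_term n * TV + `|sin (mu * pi)| * \sum_(l < m.+1) L l * endpoint_term (mu + l%:R) n))).
    rewrite big_seq [leRHS]big_seq; apply: ler_sum => n; rewrite mem_index_iota => /andP[Nn _].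
    exact: legendre_coef_le (sn n Nn).
  rewrite big_split/= mulrDl; apply: lerD.
    rewrite -mulr_suml; apply: ler_pM => //; [|exact: hX|by rewrite lerDl mulr_ge0].
    rewrite big_seq; apply: sumr_ge0 => n; rewrite mem_index_iota => /andP[Nn _].
    exact: term_ge0 (sn n Nn).
  have -> : \sum_(N.+1 <= n < M.+1) `|sin (mu * pi)| * \sum_(l < m.+1) L l * endpoint_term (mu + l%:R) n =
     \sum_(l < m.+1) (\sum_(N.+1 <= n < M.+1) endpoint_term (mu + l%:R) n) * (`|sin (mu * pi)| * L l).
    rewrite -mulr_sumr exchange_big/= mulr_sumr; apply: eq_bigr => l _.
    by rewrite -mulr_sumr mulrA mulrC.
  rewrite /Y mulr_suml; apply: ler_sum => l _; apply: ler_pM.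
  - rewrite big_seq; apply: sumr_ge0 => n; rewrite mem_index_iota => /andP[Nn _].
    by apply: endpoint_term_ge0 => //; apply: le_lt_trans (YjN l) _; rewrite ltr_nat.
  - exact: mulr_ge0.
  - exact: hY.
  - apply: (@le_trans _ _ (`|sin (mu * pi)| * \sum_(l < m.+1) L l)); last by rewrite lerDr.
    rewrite ler_wpM2l// (bigD1 l)//= lerDl.
    by apply: sumr_ge0 => i _; exact: L0.
apply: Lnorm_Omega_sup_le; first by rewrite mulr_ge0// addr_ge0// sumr_ge0.
have [C C0 hC] := ac_bounded acu.
have uc e (e0 : 0 < e) := ac_uniformly_continuous acu e0.
have hC' (x : R) : -1 < x -> x < 1 -> `|u x| <= C by move=> x0 x1; apply: hC; exact: ltW.
move=> x x0 x1; exact: (legendre_sup_error umeas hC' uc hC tot x0 x1).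
Qed.

Lemma L2_error_bound N : s < N%:R ->
  (Lnorm_Omega 2%:E (u \- legendre_proj N u)%R
    <= (Num.sqrt (4 / ((2 * s + 1) * pi) * (gamma (N%:R - s) / gamma (N%:R + s + 1))
         + 2 `^ (6 * mu + 8) * gamma (mu + 1) ^+ 2 / (pi ^+ 2 * (4 * mu + 2))
           * ((N%:R + 1) ^+ 2 * gamma (2 * N%:R - 2 * mu + 1) / ((2 * N%:R + 1) ^+ 2 * gamma (2 * N%:R + 2 * mu + 3)))) * U)%:E)%E.
Proof.
move=> sN; set X := 4 / _ * _; set Y := _ / _ * _.
have sn n : (N < n)%N -> s + 1 < n%:R.
  by move=> Nn; apply: (@lt_le_trans _ _ (N%:R + 1)); [rewrite ltrD2r|rewrite natr1 ler_nat].
have sn' n : (N < n)%N -> s < n%:R by move=> /sn; apply: lt_trans; rewrite ltrDl.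
have muN : mu < N%:R by apply: le_lt_trans sN; rewrite lerDl.
(* The condition [mu + l + 2 < n] of [endpoint_term_decreasing] holds as [l < m] and
   [n >= N + 1 > mu + m + 1]. *)
have b_dec n (l : nat) : (N < n)%N -> (l <= m)%N -> endpoint_term (mu + l%:R) n <= endpoint_term mu n.
  move=> Nn; elim: l => [|l IH] lm; first by rewrite addr0.
  apply: le_trans (IH (ltnW lm)); rewrite -[l.+1%:R]natr1 addrA; apply: endpoint_term_decreasing.
    by rewrite ltr_pwDl.
  apply: le_lt_trans (sn n Nn); rewrite (_ : mu + l%:R + 2 = mu + (l%:R + 1) + 1); last by ring.
  by rewrite lerD2r lerD2l natr1 ler_nat.
have mun n : (N < n)%N -> mu < n%:R by move=> /sn'; apply: le_lt_trans; rewrite lerDl.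
(* The bound on the coefficient is [a x + b z] with [x + z = U], and its square is at most
   [(a^2 + b^2) (x + z)^2] for nonnegative entries; this puts both contributions under one root. *)
have coef n : (N < n)%N -> legendre_coef u n ^+ 2 <= (sonin_term n ^+ 2 + endpoint_term mu n ^+ 2) * U ^+ 2.
  move=> Nn; have a0 := term_ge0 (sn' n Nn); have b0 := endpoint_term_ge0 mu0 (mun n Nn).
  have h : `|legendre_coef u n| <= sonin_term n * TV + endpoint_term mu n * (`|sin (mu * pi)| * \sum_(l < m.+1) L l).
    apply: (le_trans (legendre_coef_le (sn' n Nn))); rewrite lerD2l mulrCA; apply: ler_wpM2l => //.
    rewrite mulr_sumr; apply: ler_sum => l _; rewrite mulrC; apply: ler_wpM2r; first exact: L0.
    by apply: b_dec => //; rewrite -ltnS.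
  rewrite -[legendre_coef u n ^+ 2]real_normK ?num_real//.
  have z0 : 0 <= `|sin (mu * pi)| * \sum_(l < m.+1) L l by exact: mulr_ge0.
  move: h z0 TV0 a0 b0; rewrite /U.
  move: (`|sin (mu * pi)| * \sum_(l < m.+1) L l) TV (sonin_term n) (endpoint_term mu n) (`|legendre_coef u n|) (normr_ge0 (legendre_coef u n)) => z x a b t t0' h z0 x0 a0 b0.
  apply: (@le_trans _ _ ((a * x + b * z) ^+ 2)); first by rewrite lerXn2r// nnegrE addr_ge0// mulr_ge0.
  rewrite -subr_ge0.
  have -> : (a ^+ 2 + b ^+ 2) * (x + z) ^+ 2 - (a * x + b * z) ^+ 2 =
    a ^+ 2 * z ^+ 2 + b ^+ 2 * x ^+ 2 + x * z * (a ^+ 2 + b ^+ 2 + (a - b) ^+ 2) by ring.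
  by sign.
have tot M : (N <= M)%N -> \sum_(N.+1 <= n < M.+1) legendre_weight n * legendre_coef u n ^+ 2 <= (X + Y) * U ^+ 2.
  move=> NM.
  apply: (@le_trans _ _ (\sum_(N.+1 <= n < M.+1) (legendre_weight n * sonin_term n ^+ 2 + legendre_weight n * endpoint_term mu n ^+ 2) * U ^+ 2)).
    rewrite big_seq [leRHS]big_seq; apply: ler_sum => n; rewrite mem_index_iota => /andP[Nn _].
    by rewrite -mulrDr -mulrA; apply: ler_wpM2l; [apply: ltW; exact: legendre_weight_gt0|exact: coef].
  rewrite -mulr_suml big_split/=; apply: ler_wpM2r; first exact: sqr_ge0.
  by apply: lerD; [exact: sonin_sum_L2|exact: endpoint_sum_L2].
have XY0 : 0 <= X + Y.
  apply: addr_ge0; first by apply: le_trans (sonin_sum_L2 s0 sN (leqnn N)); rewrite big_geq.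
  by apply: le_trans (endpoint_sum_L2 mu0 muN (leqnn N)); rewrite big_geq.
have [C C0 hC] := ac_bounded acu.
have uc e (e0 : 0 < e) := ac_uniformly_continuous acu e0.
have hC' (x : R) : -1 < x -> x < 1 -> `|u x| <= C by move=> x0 x1; apply: hC; exact: ltW.
have -> : Num.sqrt (X + Y) * U = Num.sqrt ((X + Y) * U ^+ 2) by rewrite sqrtrM// sqrtr_sqr ger0_norm.
apply: (@Lnorm_Omega_2_le _ _ (C + \sum_(n < N.+1) `|legendre_coef u n|)).
- apply: measurable_funB; first exact: umeas.
  rewrite (_ : legendre_proj N u = horner (\sum_(n < N.+1) legendre_coef u n *: legendre n)); last first.
    by apply/funext => y; rewrite legendre_projE.
  by have /integrableP[/measurable_EFinP] := poly_integrable (\sum_(n < N.+1) legendre_coef u n *: legendre n).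
- by move=> x x0 x1; rewrite (le_trans (ler_normB _ _))// lerD ?hC'// legendre_proj_le// ltW.
- exact: (legendre_L2_error umeas hC' uc hC tot).
Qed.

End Main.

Theorem theorem2 (R : realType) (k m : nat) (mu : R)
    (hk : (1 <= k)%N) (hmu : k%:R - 1 < mu <= k%:R)
    (u : R -> R) (v : nat -> R -> R) (hu : AC_BV_regular mu k m u v) :
  (1 / 2 < mu ->
   forall N : nat, mu + m%:R <= N%:R ->
   (Lnorm_Omega +oo (u \- legendre_proj N u)%R
    <= (1 / (2 `^ (mu + m%:R - 1) * (mu + m%:R - 1 / 2) * Num.sqrt pi)
          * (Gamma ((N%:R - mu - m%:R + 1) / 2)
             / Gamma ((N%:R + mu + m%:R) / 2))
        + \sum_(j < m.+1)
            2 `^ (mu + j%:R) * Gamma (mu + j%:R + 1) / (pi * (mu + j%:R))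
            * (Gamma (N%:R - mu - j%:R + 1) / Gamma (N%:R + mu + j%:R + 1)))%:E
       * U_minus mu m v)%E)
  /\
  (- (1 / 2) < mu ->
   forall N : nat, mu + m%:R < N%:R ->
   (Lnorm_Omega 2%:E (u \- legendre_proj N u)%R
    <= (Num.sqrt
          (4 / ((2 * mu + 2 * m%:R + 1) * pi)
             * (Gamma (N%:R - mu - m%:R) / Gamma (N%:R + mu + m%:R + 1))
           + 2 `^ (6 * mu + 8) * Gamma (mu + 1) ^+ 2
               / (pi ^+ 2 * (4 * mu + 2))
             * ((N%:R + 1) ^+ 2 * Gamma (2 * N%:R - 2 * mu + 1)
                / ((2 * N%:R + 1) ^+ 2 * Gamma (2 * N%:R + 2 * mu + 3)))))%:E
       * U_minus mu m v)%E).
Proof.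
have GE (x : R) : Gamma x = gamma x by rewrite gamma.unlock.
rewrite (U_minusE hu); split => [mu12 N sN|_ N sN]; rewrite -EFinM !GE.
  have -> : N%:R - mu - m%:R + 1 = N%:R - (mu + m%:R) + 1 by ring.
  have -> : N%:R + mu + m%:R = N%:R + (mu + m%:R) by ring.
  apply: (le_trans (sup_error_bound hk hmu hu mu12 sN)).
  rewrite le_eqVlt; apply/orP; left; apply/eqP; congr (((_ + _) * _)%:E).
  apply: eq_bigr => j _; rewrite !GE.
  have -> : N%:R - mu - j%:R + 1 = N%:R - (mu + j%:R) + 1 by ring.
  by have -> : N%:R + mu + j%:R + 1 = N%:R + (mu + j%:R) + 1 by ring.
have -> : 2 * mu + 2 * m%:R + 1 = 2 * (mu + m%:R) + 1 by ring.
have -> : N%:R - mu - m%:R = N%:R - (mu + m%:R) by ring.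
have -> : N%:R + mu + m%:R + 1 = N%:R + (mu + m%:R) + 1 by ring.
exact: (L2_error_bound hk hmu hu sN).
Qed.
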